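(* Let $\varphi=\Phi I\in H^\infty$, where $I$ is inner and $\Phi$ is outer, and suppose there exists $0<\delta<1$ such that (i) $|\varphi|$ is an apical Helson--Szegő weight at level $\delta$, and (ii) the interior of $L_\Phi^-(\delta)$ is nonempty and contains $\sigma(I)$. Then $\varphi$ is not saturated.
   Context: $\mathbb{T}$ is the unit circle with normalized Lebesgue measure; $H^p$ ($1\le p\le\infty$) is the subspace of $L^p(\mathbb{T})$ of functions with Fourier coefficients supported on $\{0,1,2,\dots\}$, and $H^\infty_0$ is the subspace of $H^\infty$ of functions vanishing at the origin. A function $\varphi\in H^\infty$ is saturated if $\|\varphi\|_\infty = \inf_{f\in H^\infty_0}\|\varphi-\overline{f}\|_\infty$. Every $\varphi \in H^\infty$ factors as $\varphi=\Phi I$ with $I$ inner ($|I|=1$ a.e.) and $\Phi$ outer. For a bounded function $\psi$ and $0\le\delta\le1$, $L_\psi^+(\delta)=\{e^{i\theta}\in\mathbb{T}: |\psi(e^{i\theta})|\ge\|\psi\|_\infty\delta\}$ and $L_\psi^-(\delta)=\{e^{i\theta}\in\mathbb{T}: |\psi(e^{i\theta})|<\|\psi\|_\infty\delta\}$. Writing $I=BS$ with $B$ Blaschke and $S$ singular inner, $\sigma(I)$ is the union of the accumulation points of the zeros of $B$ and the support of the singular measure of $S$. For real $v\in L^1(\mathbb{T})$, $\tilde v$ denotes its conjugate function. A bounded positive function $w$ on $\mathbb{T}$ is an apical Helson--Szegő weight at level $\delta$ (with $0<\delta<1$) if $w=\exp(u+v)$ where $u\in L^\infty(\mathbb{T})$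 and $v\in L^1(\mathbb{T})$ are real-valued and $\operatorname{ess\,sup}_{L_w^+(\delta)}|\tilde v|<\pi/2$. *)

(* Defs.v *)
(* mathcomp-analysis over an abstract R : realType,
   complex numbers R[i] from mathcomp-real-closed. *)
From HB Require Import structures.
From mathcomp Require Import all_boot all_order all_algebra.
From mathcomp Require Import all_classical all_reals all_analysis.
From mathcomp Require Import complex.
Set Implicit Arguments. Unset Strict Implicit. Unset Printing Implicit Defensive.
Import Order.TTheory GRing.Theory Num.Theory.
Import numFieldNormedType.Exports.
Local Open Scope classical_set_scope.
Local Open Scope ring_scope.
Local Open Scope complex_scope.

(* Conventions.  The unit circle T is parametrized by the angle:
   a function on T is a 2pi-periodic function R -> R[i] (or R -> R), the
   point e^{i theta} of T corresponds to theta (and theta + 2 pi k), and a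
   subset of T is represented by the (2pi-periodic) set of its angles.
   The normalized Lebesgue measure of T is (2 pi)^-1 times Lebesgue measure
   on the fundamental domain T0 = [0, 2pi[. *)

Section Defs.
Variable R : realType.
Implicit Types (f g : R -> R[i]) (z w : R[i]).

Definition Lm : set R -> \bar R := lebesgue_measure.

(* modulus, exponential and e^{it} in R[i] *)
Definition cabs (z : R[i]) : R := Num.sqrt (complex.Re z ^+ 2 + complex.Im z ^+ 2).
Definition cexp (z : R[i]) : R[i] :=
  (expR (complex.Re z) * cos (complex.Im z)) +i* (expR (complex.Re z) * sin (complex.Im z)).
Definition eit (t : R) : R[i] := cos t +i* sin t.

(* fundamental domain of the circle *)
Definition T0 : set R := `[0, 2 * pi[.

Definition periodic {V : Type} (f : R -> V) := forall t, f (t + 2 * pi) = f t.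

(* integral of a complex valued function: real part + i imaginary part *)
Definition cint (mu : {measure set (measurableTypeR R) -> \bar R}) (D : set R)
  (g : R -> R[i]) : R[i] :=
  (Rintegral mu D (fun t => complex.Re (g t))) +i*
  (Rintegral mu D (fun t => complex.Im (g t))).

(* integral against normalized Lebesgue measure dm on T *)
Definition mavg (g : R -> R[i]) : R[i] :=
  ((2 * pi)^-1)%:C * cint lebesgue_measure T0 g.

(* Fourier coefficients  \hat f(n) = \int f(t) e^{-int} dm(t) *)
Definition fourier f (n : int) : R[i] := mavg (fun t => f t * eit (- (n%:~R * t))).

Definition cmeasurable f :=
  measurable_fun setT (fun t => complex.Re (f t)) /\
  measurable_fun setT (fun t => complex.Im (f t)).

(* essential supremum of a real function over a set A of T *)
Definition esssup_on (A : set R) (g : R -> R) : \bar R :=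
  ereal_inf [set y | \forall t \ae Lm, A t -> ((g t)%:E <= y)%E].

(* the L^infinity norm on T *)
Definition norm_inf f : \bar R := esssup_on T0 (fun t => cabs (f t)).

(* H^infinity: bounded (measurable) functions on T with Fourier
   coefficients supported on {0,1,2,...} *)
Definition Hinf f :=
  [/\ periodic f, cmeasurable f, (norm_inf f < +oo)%E &
      forall n : int, n < 0 -> fourier f n = 0].

(* H^infinity_0: functions of H^infinity vanishing at the origin,
   i.e. whose analytic extension F satisfies F(0) = \hat f(0) = 0 *)
Definition Hinf0 f := Hinf f /\ fourier f 0 = 0.

Definition saturated f :=
  norm_inf f = ereal_inf [set norm_inf (fun t => f t - (g t)^*) | g in Hinf0].

(* Inner functions *)
Definition inner f := Hinf f /\ \forall t \ae Lm, cabs (f t) = 1.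

(* The extension of f to the disc (Poisson integral), z in D *)
Definition poisson_ext f z : R[i] :=
  mavg (fun t => f t * ((1 - cabs z ^+ 2) / cabs (eit t - z) ^+ 2)%:C).

(* Herglotz integral \int (e^{it}+z)/(e^{it}-z) u(t) dm(t) *)
Definition herglotz (u : R -> R) z : R[i] :=
  mavg (fun t => (eit t + z) / (eit t - z) * (u t)%:C).

(* Outer functions: F(z) = c exp(\int (e^{it}+z)/(e^{it}-z) log k(t) dm(t))
   with |c| = 1, k > 0, log k in L^1 *)
Definition outer f :=
  Hinf f /\ exists (k : R -> R) (c : R[i]),
    [/\ forall t, 0 < k t, measurable_fun setT k,
        Lm.-integrable T0 (fun t => (ln (k t))%:E), cabs c = 1 &
        forall z, cabs z < 1 -> poisson_ext f z = c * cexp (herglotz (fun t => ln (k t)) z)].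

(* level sets L_psi^+(delta), L_psi^-(delta) of a bounded function psi *)
Definition Lplus (psi : R -> R) (delta : R) : set R :=
  [set t | fine (esssup_on T0 psi) * delta <= psi t].
Definition Lminus (psi : R -> R) (delta : R) : set R :=
  [set t | psi t < fine (esssup_on T0 psi) * delta].

(* conjugate function (principal value):
   \tilde v(theta) = lim_{e -> 0+} (1/2pi) \int_{e <= |t| <= pi} v(theta - t) cot(t/2) dt *)
Definition conj_fun (v : R -> R) (theta : R) : R :=
  lim ((2 * pi)^-1 * Rintegral lebesgue_measure [set t : R | e <= `|t| <= pi]
          (fun t => v (theta - t) * (cos (t / 2) / sin (t / 2)))
       @[e --> 0^'+]).

(* apical Helson--Szego weight at level delta *)
Definition apical_HS (w : R -> R) (delta : R) :=
  [/\ 0 < delta < 1, measurable_fun setT w, (esssup_on T0 w < +oo)%E,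
      (\forall t \ae Lm, 0 < w t) &
      exists u v : R -> R,
        [/\ periodic u /\ periodic v, measurable_fun setT u /\ measurable_fun setT v,
            (esssup_on T0 (fun t => `|u t|%R) < +oo)%E /\
            Lm.-integrable T0 (fun t => (v t)%:E),
            (\forall t \ae Lm, w t = expR (u t + v t)) &
            (esssup_on (T0 `&` Lplus w delta) (fun t => `|conj_fun v t|%R) < (pi / 2)%:E)%E]].

(* Blaschke products.  The zero sequence is a : nat -> option R[i]
   (None stands for "no zero", so that finite and infinite sequences are
   both allowed); zeros are repeated according to multiplicity. *)
Definition bfactor w z : R[i] :=
  if w == 0 then z else (cabs w)%:C / w * ((w - z) / (1 - w^* * z)).

Definition bpartial (a : nat -> option R[i]) (N : nat) z : R[i] :=
  \prod_(k < N) (if a k is Some w then bfactor w z else 1).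

Definition blaschke_prod (a : nat -> option R[i]) z : R[i] :=
  (limn (fun N => complex.Re (bpartial a N z))) +i*
  (limn (fun N => complex.Im (bpartial a N z))).

Definition blaschke_seq (a : nat -> option R[i]) :=
  (forall k w, a k = Some w -> cabs w < 1) /\
  (\sum_(0 <= k <oo) (if a k is Some w then 1 - cabs w else 0)%:E < +oo)%E.

(* singular inner functions: positive finite Borel measure on T (carried by
   T0) singular with respect to Lebesgue measure *)
Definition singular_meas (mu : {measure set (measurableTypeR R) -> \bar R}) :=
  (mu T0 < +oo)%E /\
  exists A : set R, [/\ measurable A, A `<=` T0, Lm A = 0%E & mu (T0 `\` A) = 0%E].

Definition sing_inner (mu : {measure set (measurableTypeR R) -> \bar R}) z : R[i] :=
  cexp (- cint mu T0 (fun t => (eit t + z) / (eit t - z))).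

(* sigma(I) = accumulation points of the zeros of B  U  support of mu *)
Definition zero_acc (a : nat -> option R[i]) : set R :=
  [set th : R | forall e : R, 0 < e -> forall N : nat,
     exists k w, [/\ (N <= k)%N, a k = Some w & cabs (w - eit th) < e]].

Definition msupport (mu : {measure set (measurableTypeR R) -> \bar R}) : set R :=
  [set th : R | forall e : R, 0 < e ->
     (0 < mu (T0 `&` [set t | (cabs (eit t - eit th) < e)%R]))%E].

Definition sigma_inner (a : nat -> option R[i])
  (mu : {measure set (measurableTypeR R) -> \bar R}) : set R :=
  zero_acc a `|` msupport mu.

End Defs.

(* Main.v *)
(** It suffices to find [g] in [H^infty_0] with [Re (phi g)] bounded below by a
    positive constant on the set where [|phi|] is at least [delta ||phi||]: then
    [phi - tau conj g] has a smaller norm than [phi] for small [tau > 0].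

    Since [|Phi| = exp (u + v)], the outer function satisfies
    [Phi * exp (- u - i u~) = c' exp (v + i v~)] on the circle (Fatou's theorem and
    radial limits of Herglotz integrals at Lebesgue points), and its argument is,
    up to [c'], bounded away from [pi / 2] on that set. It remains to multiply
    [e^{it} I] by an element of the disc algebra making it almost positive off the
    gap [O], the interior of [L_Phi^-(delta)]. On the circle each Blaschke factor times
    [(1 - conj w z)^2] is a constant multiple of [z] times a positive function,
    and [z] itself equals, up to a constant, [q^2 / |q|^2] with [q] vanishing only in the
    gap. As [sigma(I)] lies in [O], by compactness the tails of the Blaschke product are
    uniformly close to [1] off [O], and the singular factor [S(z)] is uniformly close
    to [S(rho z)] for some [rho < 1]. *)
Require Import Defs.
From HB Require Import structures.
From mathcomp Require Import all_boot all_order all_algebra.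
From mathcomp Require Import all_classical all_reals all_analysis.
From mathcomp Require Import measurable_realfun.
From mathcomp Require Import complex.
From mathcomp Require Import ring lra.
Set Implicit Arguments. Unset Strict Implicit. Unset Printing Implicit Defensive.
Import Order.TTheory GRing.Theory Num.Theory.
Import numFieldNormedType.Exports.
Local Open Scope classical_set_scope.
Local Open Scope ring_scope.
Local Open Scope complex_scope.

(** * Modulus, exponential and [e^{it}] in [R[i]] *)

Section ComplexBasics.
Context {R : realType}.
Implicit Types (z w : R[i]) (x y t : R).
Local Notation Re := (@complex.Re R).
Local Notation Im := (@complex.Im R).

(** Analytic functions enter only as uniform limits of polynomials on closed discs ([polyapp]), so
    the mean value property, the Poisson formula and the [L^2] monotonicity behind Fatou's theorem
    are checked on polynomials and passed to the limit. Boundedness of [u] makes [exp (- u - i u~)]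
    the boundary function of a bounded analytic function; [v] is merely integrable and stays in the
    exponent, controlled through its conjugate and only where [|phi|] is large. That is enough,
    since where [|phi|] is below [delta ||phi||] a small perturbation cannot reach the norm. The
    factor [e^{it}], which makes [g] vanish at the origin, is the real obstacle: its product with an
    element of the disc algebra has mean zero and so cannot be positive on the whole circle. The
    nonempty gap [O] is the place where positivity is given up, and nothing has to be controlled
    there because [O] lies in the low level set. All errors are kept relative to the positive
    function, so that they survive products and only cost a fraction of the cosine of the
    argument. *)

Lemma cabsE z : cabs z = Normc.normc z. Proof. by case: z. Qed.

Lemma cabs_ge0 z : 0 <= cabs z. Proof. exact: sqrtr_ge0. Qed.

Lemma cabs0 : cabs (0 : R[i]) = 0.
Proof. by rewrite cabsE Normc.normc0. Qed.

Lemma cabs1 : cabs (1 : R[i]) = 1.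
Proof. by rewrite cabsE Normc.normc1. Qed.

Lemma cabsM z w : cabs (z * w) = cabs z * cabs w.
Proof. by rewrite !cabsE Normc.normcM. Qed.

Lemma cabsV z : cabs z^-1 = (cabs z)^-1.
Proof. by rewrite !cabsE Normc.normcV. Qed.

Lemma cabs_eq0 z : (cabs z == 0) = (z == 0).
Proof.
apply/eqP/eqP => [|->]; last exact: cabs0.
by rewrite cabsE; exact: Normc.eq0_normc.
Qed.

Lemma cabs_gt0 z : (0 < cabs z) = (z != 0).
Proof. by rewrite lt_neqAle cabs_ge0 andbT eq_sym cabs_eq0. Qed.

Lemma sqr_cabs z : cabs z ^+ 2 = Re z ^+ 2 + Im z ^+ 2.
Proof. by rewrite sqr_sqrtr// addr_ge0 ?sqr_ge0. Qed.

Lemma cabsC x : cabs x%:C = `|x|.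
Proof. by rewrite /cabs /= expr0n addr0 sqrtr_sqr. Qed.

Lemma cabs_conj z : cabs (conjc z) = cabs z.
Proof. by case: z => a b; rewrite /cabs /= sqrrN. Qed.

Lemma cabsN z : cabs (- z) = cabs z.
Proof. by case: z => a b; rewrite /cabs /= !sqrrN. Qed.

Lemma cabs_subC z w : cabs (z - w) = cabs (w - z).
Proof. by rewrite -opprB cabsN. Qed.

Lemma cabsD z w : cabs (z + w) <= cabs z + cabs w.
Proof. by have := le_normcD z w; rewrite !cabsE. Qed.

Lemma cabsB z w : cabs (z - w) <= cabs z + cabs w.
Proof. by rewrite (le_trans (cabsD _ _))// cabsN. Qed.

Lemma cabs_triangle u z w : cabs (z - w) <= cabs (z - u) + cabs (u - w).
Proof. by rewrite (le_trans _ (cabsD _ _))// addrA subrK. Qed.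

Lemma cabs_lerB z w : cabs z - cabs w <= cabs (z - w).
Proof. by rewrite lerBlDr (le_trans _ (cabsD _ _))// subrK. Qed.

Lemma cabsX z n : cabs (z ^+ n) = cabs z ^+ n.
Proof. by elim: n => [|n IH]; rewrite ?expr0 ?cabs1// !exprS cabsM IH. Qed.

Lemma Re_le_cabs z : `|Re z| <= cabs z.
Proof. by rewrite -sqrtr_sqr ler_sqrt ?addr_ge0 ?sqr_ge0// lerDl sqr_ge0. Qed.

Lemma Im_le_cabs z : `|Im z| <= cabs z.
Proof. by rewrite -sqrtr_sqr ler_sqrt ?addr_ge0 ?sqr_ge0// lerDr sqr_ge0. Qed.

Lemma cabs_le_ReIm z : cabs z <= `|Re z| + `|Im z|.
Proof.
rewrite -(@ler_pXn2r _ 2) ?nnegrE ?addr_ge0 ?cabs_ge0// sqr_cabs sqrrD.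
by rewrite !real_normK ?num_real// lerD2r lerDl mulrn_wge0// mulr_ge0.
Qed.

Lemma ReD z w : Re (z + w) = Re z + Re w. Proof. by case: z; case: w. Qed.
Lemma ImD z w : Im (z + w) = Im z + Im w. Proof. by case: z; case: w. Qed.
Lemma ReN z : Re (- z) = - Re z. Proof. by case: z. Qed.
Lemma ImN z : Im (- z) = - Im z. Proof. by case: z. Qed.
Lemma ReM z w : Re (z * w) = Re z * Re w - Im z * Im w.
Proof. by case: z; case: w. Qed.
Lemma ImM z w : Im (z * w) = Re z * Im w + Im z * Re w.
Proof. by case: z; case: w. Qed.
Lemma ReV z : Re z^-1 = Re z / (Re z ^+ 2 + Im z ^+ 2). Proof. by case: z. Qed.
Lemma ImV z : Im z^-1 = - (Im z / (Re z ^+ 2 + Im z ^+ 2)).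
Proof. by case: z => a b /=; rewrite ?mulNr. Qed.
Lemma ReCM x z : Re (x%:C * z) = x * Re z.
Proof. by rewrite ReM /= mul0r subr0. Qed.
Lemma ImCM x z : Im (x%:C * z) = x * Im z.
Proof. by rewrite ImM /= mul0r addr0. Qed.
Lemma ReMC x z : Re (z * x%:C) = Re z * x.
Proof. by rewrite mulrC ReCM mulrC. Qed.
Lemma ImMC x z : Im (z * x%:C) = Im z * x.
Proof. by rewrite mulrC ImCM mulrC. Qed.
Lemma Re_conj z : Re (conjc z) = Re z. Proof. by case: z. Qed.
Lemma Im_conj z : Im (conjc z) = - Im z. Proof. by case: z. Qed.

Lemma complex_ext z w : Re z = Re w -> Im z = Im w -> z = w.
Proof. by case: z; case: w => a b c d /= -> ->. Qed.

Lemma mulcJ z : z * (conjc z) = (cabs z ^+ 2)%:C.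
Proof. by apply: complex_ext; rewrite ?ReM ?ImM Re_conj Im_conj /= ?sqr_cabs; ring. Qed.

Lemma conj_unit z : cabs z = 1 -> (conjc z) = z^-1.
Proof.
move=> z1; have z0 : z != 0 by rewrite -cabs_gt0 z1.
by apply: (mulfI z0); rewrite mulcJ z1 expr1n divff.
Qed.

Lemma conjcM z w : (conjc (z * w)) = (conjc z) * (conjc w). Proof. by rewrite rmorphM. Qed.

Lemma conjcD z w : conjc (z + w) = conjc z + conjc w.
Proof. by apply: complex_ext; rewrite ?ReD ?ImD ?Re_conj ?Im_conj ?ReD ?ImD ?opprD. Qed.

Lemma conjcN z : conjc (- z) = - conjc z. Proof. by case: z. Qed.

Lemma conjcV z : conjc z^-1 = (conjc z)^-1. Proof. exact: conjc_inv. Qed.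

Lemma eitD t s : eit (t + s) = eit t * eit s.
Proof. by rewrite /eit cosD sinD; apply: complex_ext; rewrite ?ReM ?ImM /=; ring. Qed.

Lemma eit0 : eit (0 : R) = 1. Proof. by rewrite /eit cos0 sin0. Qed.

Lemma cabs_eit t : cabs (eit t) = 1.
Proof. by rewrite /cabs /= cos2Dsin2 sqrtr1. Qed.

Lemma eit_neq0 t : eit t != 0. Proof. by rewrite -cabs_gt0 cabs_eit. Qed.

Lemma eitN t : eit (- t) = (eit t)^-1.
Proof. by apply: (mulfI (eit_neq0 t)); rewrite -eitD subrr eit0 divff// eit_neq0. Qed.

Lemma conj_eit t : (conjc (eit t)) = eit (- t).
Proof. by rewrite eitN conj_unit// cabs_eit. Qed.

Lemma eit2pi t : eit (t + 2 * pi) = eit t.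
Proof. by rewrite /eit mulrC mulr_natr cosD2pi sinD2pi. Qed.

Lemma eitMn t n : eit (n%:R * t) = eit t ^+ n.
Proof.
elim: n => [|n IH]; first by rewrite mul0r eit0 expr0.
by rewrite -natr1 mulrDl mul1r eitD IH exprSr.
Qed.

Lemma cexpD z w : cexp (z + w) = cexp z * cexp w.
Proof.
rewrite /cexp ReD ImD expRD cosD sinD.
by apply: complex_ext; rewrite ?ReM ?ImM /=; ring.
Qed.

Lemma cexp0 : cexp (0 : R[i]) = 1.
Proof. by rewrite /cexp /= expR0 cos0 sin0 !mul1r. Qed.

Lemma cexpE z : cexp z = (expR (Re z))%:C * eit (Im z).
Proof. by apply: complex_ext; rewrite ?ReCM ?ImCM. Qed.

Lemma cabs_cexp z : cabs (cexp z) = expR (Re z).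
Proof. by rewrite cexpE cabsM cabsC cabs_eit mulr1 ger0_norm// expR_ge0. Qed.

Lemma cexp_neq0 z : cexp z != 0.
Proof. by rewrite -cabs_gt0 cabs_cexp expR_gt0. Qed.

Lemma cexpN z : cexp (- z) = (cexp z)^-1.
Proof. by apply: (mulfI (cexp_neq0 z)); rewrite -cexpD subrr cexp0 divff// cexp_neq0. Qed.

Lemma cexpMn z n : cexp (n%:R * z) = cexp z ^+ n.
Proof.
elim: n => [|n IH]; first by rewrite mul0r cexp0 expr0.
by rewrite -natr1 mulrDl mul1r cexpD IH exprSr.
Qed.

Lemma cabs_eitB t s : cabs (eit t - eit s) ^+ 2 = 4 * sin ((t - s) / 2) ^+ 2.
Proof.
have -> : t - s = ((t - s) / 2) *+ 2 by rewrite mulr2n -splitr.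
set h := (t - s) / 2.
have -> : (h *+ 2) / 2 = h by rewrite mulr2n; field.
have -> : t = s + h *+ 2 by rewrite /h mulr2n -splitr; ring.
rewrite sqr_cabs /= mulr2n !cosD !sinD !cosD.
have := cos2Dsin2 s; have := cos2Dsin2 h.
set a := cos h; set b := sin h; set c := cos s; set d := sin s => ab cd.
(* This is [|eit s|^2 * |eit (2 h) - 1|^2]: the common rotation is split off. *)
transitivity ((c ^+ 2 + d ^+ 2) * (((a ^+ 2 - b ^+ 2) - 1) ^+ 2 + (2 * a * b) ^+ 2)).
  by ring.
have a2 : a ^+ 2 = 1 - b ^+ 2 by rewrite -ab addrK.
by rewrite cd mul1r !exprMn a2; ring.
Qed.

Lemma sin_le_id x : 0 <= x -> sin x <= x.
Proof.
rewrite le_eqVlt => /predU1P[<-|x0]; first by rewrite sin0.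
have [|c _] := @MVT R sin cos 0 x x0.
- by apply: continuous_subspaceT => y; exact: continuous_sin.
- rewrite sin0 !subr0 => ->.
  by rewrite ler_piMl// ?cos_le1// ltW.
Qed.

Lemma norm_sin_le x : `|sin x| <= `|x|.
Proof.
have pos y : 0 <= y -> `|sin y| <= y.
  move=> y0; rewrite ler_norml sin_le_id// andbT.
  (* Up to [pi / 2] the sine is nonnegative; beyond, [- y] is already below [- 1]. *)
  have [y1|y1] := leP y (pi / 2).
    rewrite lerNl (le_trans _ y0)// oppr_le0 sin_ge0_pi// y0/=.
    by rewrite (le_trans y1)// ler_pdivrMr// ler_peMr ?pi_ge0// (ler_nat _ 1 2).
  by have := sin_geN1 y; have := pihalf_ge1 R; lra.
have [x0|x0] := leP 0 x; first by rewrite (ger0_norm x0) pos.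
by rewrite -normrN -sinN (ltr0_norm x0) pos// oppr_ge0 ltW.
Qed.

Lemma cabs_eitB_le t s : cabs (eit t - eit s) <= `|t - s|.
Proof.
rewrite -(@ler_pXn2r _ 2) ?nnegrE ?cabs_ge0// cabs_eitB.
have := norm_sin_le ((t - s) / 2); rewrite normrM [`|2^-1|]gtr0_norm ?invr_gt0//.
set a := sin _; set b := t - s => ab.
have : `|a| ^+ 2 <= (`|b| / 2) ^+ 2 by rewrite ler_pXn2r ?nnegrE ?divr_ge0.
by rewrite exprMn !real_normK ?num_real// => ?; lra.
Qed.

End ComplexBasics.

(** * Measurability of complex-valued functions *)

Section ComplexMeasurability.
Context {R : realType}.
Implicit Types (f g : R -> R[i]) (h : R -> R).
Local Notation Re := (@complex.Re R).
Local Notation Im := (@complex.Im R).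

(** The inverse is the power with exponent [-1]; at 0 both are 0 by convention, so only the sign of
    [h] matters. *)
Lemma measurable_funV_ge0 h : measurable_fun setT h -> (forall t, 0 <= h t) ->
  measurable_fun setT (fun t => (h t)^-1).
Proof.
move=> mh h0; apply: (eq_measurable_fun (fun t => (h t) `^ (-1))).
  by move=> t _; rewrite powR_inv1.
by apply: (@measurableT_comp _ _ _ _ _ _ (fun x => x `^ (-1)) _ h) => //;
  exact: measurable_powR.
Qed.

Lemma cmeasurable_cst (z : R[i]) : cmeasurable (fun _ : R => z).
Proof. by split; exact: measurable_cst. Qed.

Lemma cmeasurableD f g : cmeasurable f -> cmeasurable g ->
  cmeasurable (fun t => f t + g t).
Proof.
by case=> ? ? [? ?]; split; under eq_fun do rewrite ?ReD ?ImD;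
  exact: measurable_funD.
Qed.

Lemma cmeasurableN f : cmeasurable f -> cmeasurable (fun t => - f t).
Proof.
by case=> ? ?; split; under eq_fun do rewrite ?ReN ?ImN; exact: measurable_funN.
Qed.

Lemma cmeasurableB f g : cmeasurable f -> cmeasurable g ->
  cmeasurable (fun t => f t - g t).
Proof. by move=> ? ?; apply: cmeasurableD => //; exact: cmeasurableN. Qed.

Lemma cmeasurableM f g : cmeasurable f -> cmeasurable g ->
  cmeasurable (fun t => f t * g t).
Proof.
case=> ? ? [? ?]; split; under eq_fun do rewrite ?ReM ?ImM.
  by apply: measurable_funB; apply: measurable_funM.
by apply: measurable_funD; apply: measurable_funM.
Qed.

Lemma cmeasurableX f n : cmeasurable f -> cmeasurable (fun t => f t ^+ n).
Proof.
move=> mf; elim: n => [|n IH]; first exact: cmeasurable_cst.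
by under eq_fun do rewrite exprS; exact: cmeasurableM.
Qed.

Lemma cmeasurableV f : cmeasurable f -> cmeasurable (fun t => (f t)^-1).
Proof.
case=> mr mi.
have mn : measurable_fun setT (fun t => (Re (f t) ^+ 2 + Im (f t) ^+ 2)^-1).
  apply: measurable_funV_ge0 => [|t]; last by rewrite addr_ge0 ?sqr_ge0.
  by apply: measurable_funD; exact: measurable_funX.
split; under eq_fun do rewrite ?ReV ?ImV.
  exact: measurable_funM.
by apply: measurable_funN; exact: measurable_funM.
Qed.

Lemma cmeasurable_conj f : cmeasurable f -> cmeasurable (fun t => (conjc (f t))).
Proof.
case=> ? ?; split; first by under eq_fun do rewrite Re_conj.
by under eq_fun do rewrite Im_conj; exact: measurable_funN.
Qed.

Lemma cmeasurableC h : measurable_fun setT h -> cmeasurable (fun t => (h t)%:C).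
Proof. by move=> mh; split => //; exact: measurable_cst. Qed.

Lemma cmeasurable_sum (I : Type) (r : seq I) (F : I -> R -> R[i]) :
  (forall i, cmeasurable (F i)) -> cmeasurable (fun t => \sum_(i <- r) F i t).
Proof.
move=> mF; elim: r => [|i r IH].
  by under eq_fun do rewrite big_nil; exact: cmeasurable_cst.
by under eq_fun do rewrite big_cons; exact: cmeasurableD.
Qed.

Lemma cmeasurable_eit : cmeasurable (@eit R).
Proof.
by split; apply: continuous_measurable_fun; [exact: continuous_cos|exact: continuous_sin].
Qed.

Lemma cmeasurable_eitM (c : R) : cmeasurable (fun t => eit (c * t)).
Proof.
by split; [apply: (@measurableT_comp _ _ _ _ _ _ (@cos R)) |
           apply: (@measurableT_comp _ _ _ _ _ _ (@sin R))] => //;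
  apply: continuous_measurable_fun; [exact: continuous_cos|exact: continuous_sin].
Qed.

Lemma measurable_cabs f : cmeasurable f -> measurable_fun setT (fun t => cabs (f t)).
Proof.
case=> mr mi; apply: (eq_measurable_fun
  (fun t => (Re (f t) ^+ 2 + Im (f t) ^+ 2) `^ (2^-1))).
  by move=> t _; rewrite powR12_sqrt// addr_ge0 ?sqr_ge0.
apply: (@measurableT_comp _ _ _ _ _ _ (fun x : R => x `^ 2^-1)).
  exact: measurable_powR.
by apply: measurable_funD; exact: measurable_funX.
Qed.

Lemma measurable_Re f : cmeasurable f -> measurable_fun setT (fun t => Re (f t)).
Proof. by case. Qed.

Lemma measurable_Im f : cmeasurable f -> measurable_fun setT (fun t => Im (f t)).
Proof. by case. Qed.

End ComplexMeasurability.

(** * Componentwise integrals of complex-valued functions *)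

Section ComplexIntegral.
Context {R : realType}.
Variables (mu : {measure set (measurableTypeR R) -> \bar R}) (D : set R).
Hypothesis mD : measurable (D : set (measurableTypeR R)).
Implicit Types (f g : R -> R[i]) (h : R -> R).
Local Notation Re := (@complex.Re R).
Local Notation Im := (@complex.Im R).

Definition cintegrable f :=
  mu.-integrable D (EFin \o (fun t => Re (f t))) /\
  mu.-integrable D (EFin \o (fun t => Im (f t))).

Lemma integrable_dom h (k : R -> R) : measurable_fun setT h ->
  (forall t, D t -> `|h t| <= k t) -> mu.-integrable D (EFin \o k) ->
  mu.-integrable D (EFin \o h).
Proof.
move=> mh hk ik; apply: (le_integrable mD _ _ ik).
  by apply/measurable_EFinP; exact: measurable_funTS.
move=> t Dt /=; rewrite lee_fin (le_trans (hk _ Dt))//; exact: ler_norm.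
Qed.

Lemma cintegrable_dom f (k : R -> R) : cmeasurable f ->
  (forall t, D t -> cabs (f t) <= k t) -> mu.-integrable D (EFin \o k) ->
  cintegrable f.
Proof.
case=> mr mi fk ik; split; apply: (@integrable_dom _ k) => // t Dt.
  exact: le_trans (Re_le_cabs _) (fk _ Dt).
exact: le_trans (Im_le_cabs _) (fk _ Dt).
Qed.

Lemma eq_cint f g : {in D, f =1 g} -> cint mu D f = cint mu D g.
Proof.
by move=> fg; rewrite /cint; congr (_ +i* _); apply: eq_Rintegral => t tD;
  rewrite fg.
Qed.

Lemma integrableRD h (k : R -> R) : mu.-integrable D (EFin \o h) ->
  mu.-integrable D (EFin \o k) -> mu.-integrable D (EFin \o (fun t => h t + k t)).
Proof. by move=> hi ki; apply: eq_integrable (integrableD mD hi ki). Qed.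

Lemma integrableRZ (x : R) h : mu.-integrable D (EFin \o h) ->
  mu.-integrable D (EFin \o (fun t => x * h t)).
Proof. by move=> hi; apply: eq_integrable (integrableZl mD x hi). Qed.

Lemma integrableRB h (k : R -> R) : mu.-integrable D (EFin \o h) ->
  mu.-integrable D (EFin \o k) -> mu.-integrable D (EFin \o (fun t => h t - k t)).
Proof. by move=> hi ki; apply: eq_integrable (integrableB mD hi ki). Qed.

Lemma cintegrableD f g : cintegrable f -> cintegrable g ->
  cintegrable (fun t => f t + g t).
Proof.
case=> fr fi [gr gi]; split.
  by under eq_fun do rewrite ReD; exact: integrableRD.
by under eq_fun do rewrite ImD; exact: integrableRD.
Qed.

Lemma cintegrableZ (z : R[i]) f : cintegrable f -> cintegrable (fun t => z * f t).
Proof.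
case=> fr fi; split.
  by under eq_fun do rewrite ReM; apply: integrableRB; exact: integrableRZ.
by under eq_fun do rewrite ImM; apply: integrableRD; exact: integrableRZ.
Qed.

Lemma cintegrableN f : cintegrable f -> cintegrable (fun t => - f t).
Proof.
by move=> /(cintegrableZ (-1)); under eq_fun do rewrite mulN1r.
Qed.

Lemma cintegrableB f g : cintegrable f -> cintegrable g ->
  cintegrable (fun t => f t - g t).
Proof. by move=> ? ?; apply: cintegrableD => //; exact: cintegrableN. Qed.

Lemma cintD f g : cintegrable f -> cintegrable g ->
  cint mu D (fun t => f t + g t) = cint mu D f + cint mu D g.
Proof.
case=> fr fi [gr gi]; apply: complex_ext; rewrite ?ReD ?ImD /=.
  by rewrite -RintegralD//; apply: eq_Rintegral => t _; rewrite ReD.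
by rewrite -RintegralD//; apply: eq_Rintegral => t _; rewrite ImD.
Qed.

Lemma cintZ (z : R[i]) f : cintegrable f ->
  cint mu D (fun t => z * f t) = z * cint mu D f.
Proof.
case=> fr fi; apply: complex_ext; rewrite ?ReM ?ImM /=.
  rewrite -RintegralZl// -[X in _ - X]RintegralZl//.
  rewrite -RintegralB//; [|exact: integrableRZ|exact: integrableRZ].
  by apply: eq_Rintegral => t _; rewrite ReM.
rewrite -RintegralZl// -[X in _ + X]RintegralZl//.
rewrite -RintegralD//; [|exact: integrableRZ|exact: integrableRZ].
by apply: eq_Rintegral => t _; rewrite ImM.
Qed.

Lemma cintB f g : cintegrable f -> cintegrable g ->
  cint mu D (fun t => f t - g t) = cint mu D f - cint mu D g.
Proof.
move=> fi gi; rewrite cintD//; last exact: cintegrableN.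
rewrite -[in RHS](mulN1r (cint mu D g)) -cintZ//; congr (_ + _).
by apply: eq_cint => t _; rewrite mulN1r.
Qed.

Lemma cint0 : cint mu D (fun=> 0) = 0.
Proof. by rewrite /cint /= !Rintegral_cst// !mul0r. Qed.

Lemma cintegrable0 : cintegrable (fun=> 0).
Proof. by split; exact: integrable0. Qed.

Lemma cintegrable_sum (I : Type) (r : seq I) (F : I -> R -> R[i]) :
  (forall i, cintegrable (F i)) -> cintegrable (fun t => \sum_(i <- r) F i t).
Proof.
move=> iF; elim: r => [|i r IH].
  by under eq_fun do rewrite big_nil; exact: cintegrable0.
by under eq_fun do rewrite big_cons; exact: cintegrableD.
Qed.

Lemma cint_sum (I : Type) (r : seq I) (F : I -> R -> R[i]) :
  (forall i, cintegrable (F i)) ->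
  cint mu D (fun t => \sum_(i <- r) F i t) = \sum_(i <- r) cint mu D (F i).
Proof.
move=> iF; elim: r => [|i r IH].
  by rewrite big_nil -[RHS]cint0; apply: eq_cint => t _; rewrite big_nil.
rewrite big_cons -IH -cintD//; last exact: cintegrable_sum.
by apply: eq_cint => t _; rewrite big_cons.
Qed.

Lemma norm_Rintegral_le h (k : R -> R) : mu.-integrable D (EFin \o h) ->
  mu.-integrable D (EFin \o k) -> (forall t, D t -> `|h t| <= k t) ->
  `|Rintegral mu D h| <= Rintegral mu D k.
Proof.
move=> ih ik hk; apply: le_trans (le_normr_Rintegral mD ih) _.
by apply: le_Rintegral => //; exact: integrable_norm.
Qed.

(** Real and imaginary parts are bounded separately, which costs the factor 2. The estimate only
    serves to show that integrals are small or bounded, so the constant is harmless. *)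
Lemma cabs_cint_le f (k : R -> R) : cintegrable f ->
  mu.-integrable D (EFin \o k) -> (forall t, D t -> cabs (f t) <= k t) ->
  cabs (cint mu D f) <= 2 * Rintegral mu D k.
Proof.
case=> fr fi ik fk; rewrite (le_trans (cabs_le_ReIm _))// mulr2n mulrDl mul1r.
by apply: lerD; apply: norm_Rintegral_le => // t Dt; apply: le_trans (fk _ Dt);
  [exact: Re_le_cabs|exact: Im_le_cabs].
Qed.

End ComplexIntegral.

(** * Integrability over the fundamental domain *)

Section CircleIntegral.
Context {R : realType}.
Local Notation leb := (@lebesgue_measure R).

Lemma measurable_T0 : measurable (@T0 R : set (measurableTypeR R)).
Proof. exact: measurable_itv. Qed.

Lemma twopi_gt0 : 0 < 2 * pi :> R.
Proof. by rewrite mulr_gt0// pi_gt0. Qed.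

Lemma leb_T0 : leb (@T0 R) = (2 * pi)%:E.
Proof. by rewrite /T0 lebesgue_measure_itv /= lte_fin twopi_gt0 sube0. Qed.

(** The measure is any one finite on [T0]: the lemma is applied both to Lebesgue measure and to the
    singular measure of the inner function. *)
Lemma integrable_T0_cst (mu : {measure set (measurableTypeR R) -> \bar R}) (M : R) :
  (mu (@T0 R) < +oo)%E -> mu.-integrable (@T0 R) (EFin \o (fun=> M)).
Proof.
move=> fT; apply: measurable_bounded_integrable => //.
- exact: measurable_T0.
- by exists `|M|; split => // x Mx t _; exact: ltW.
Qed.

Lemma cintegrable_bdd (mu : {measure set (measurableTypeR R) -> \bar R})
  (f : R -> R[i]) (M : R) : (mu (@T0 R) < +oo)%E -> cmeasurable f ->
  (forall t, T0 t -> cabs (f t) <= M) -> cintegrable mu (@T0 R) f.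
Proof.
move=> fT mf fM; apply: (cintegrable_dom measurable_T0 mf fM).
exact: integrable_T0_cst.
Qed.

End CircleIntegral.

(** * Uniform limits of polynomials on a closed disc *)

Section PolynomialApproximation.
Context {R : realType}.
Implicit Types (F G : R[i] -> R[i]) (z w : R[i]) (r e : R).

(** Substitute for analyticity in the disc of radius [r] with continuity up to its boundary; for
    [r = 1] this is the disc algebra. *)
Definition polyapp r F := forall e, 0 < e ->
  exists p : {poly R[i]}, forall z, cabs z <= r -> cabs (F z - p.[z]) <= e.

Lemma poly_bounded (p : {poly R[i]}) r :
  exists M : R, 0 < M /\ forall z, cabs z <= r -> cabs p.[z] <= M.
Proof.
elim/poly_ind: p => [|p c [M [M0 IH]]].
  by exists 1; split => // z _; rewrite horner0 cabs0.
exists (M * (`|r| + 1) + cabs c); split.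
  by rewrite ltr_pwDl ?cabs_ge0// mulr_gt0// ltr_wpDl.
move=> z zr; rewrite hornerMXaddC (le_trans (cabsD _ _))// lerD2r cabsM.
rewrite ler_pM ?cabs_ge0 ?IH// (le_trans zr)// (le_trans (ler_norm r))//.
by rewrite lerDl.
Qed.

Lemma poly_lipschitz (p : {poly R[i]}) r : exists L : R, 0 <= L /\
  forall z w, cabs z <= r -> cabs w <= r -> cabs (p.[z] - p.[w]) <= L * cabs (z - w).
Proof.
elim/poly_ind: p => [|p c [L [L0 IH]]].
  by exists 0; split => // z w _ _; rewrite !horner0 subrr cabs0 mul0r.
have [M [M0 pM]] := poly_bounded p r.
exists (L * `|r| + M); split; first by rewrite addr_ge0 ?mulr_ge0// ltW.
move=> z w zr wr; rewrite !hornerMXaddC.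
have -> : p.[z] * z + c - (p.[w] * w + c) =
  (p.[z] - p.[w]) * z + p.[w] * (z - w) by ring.
rewrite (le_trans (cabsD _ _))// !cabsM mulrDl lerD//; last first.
  by rewrite ler_wpM2r ?cabs_ge0// pM.
rewrite (le_trans (ler_wpM2r (cabs_ge0 _) (IH _ _ zr wr)))//.
rewrite mulrAC ler_wpM2r ?cabs_ge0// ler_wpM2l//.
exact: le_trans zr (ler_norm _).
Qed.

Lemma polyapp_bounded r F : polyapp r F ->
  exists M : R, 0 < M /\ forall z, cabs z <= r -> cabs (F z) <= M.
Proof.
move=> /(_ 1 ltr01)[p Fp]; have [M [M0 pM]] := poly_bounded p r.
exists (1 + M); split => [|z zr]; first by rewrite addr_gt0.
rewrite -[F z](subrK p.[z]) (le_trans (cabsD _ _))// lerD ?Fp// pM//.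
Qed.

Lemma polyapp_continuous r F z : polyapp r F -> cabs z <= r ->
  forall e, 0 < e -> exists d : R, 0 < d /\
    forall w, cabs w <= r -> cabs (w - z) < d -> cabs (F w - F z) < e.
Proof.
move=> aF zr e e0; have e4 : 0 < e / 4 by rewrite divr_gt0.
have [p pF] := aF _ e4; have [L [L0 pL]] := poly_lipschitz p r.
have L1 : 0 < L + 1 by rewrite ltr_wpDl.
exists (e / 4 / (L + 1)); split; first by rewrite divr_gt0.
move=> w wr wz; have h1 := pF _ wr; have h2 := pF _ zr; have h3 := pL _ _ wr zr.
have h4 : L * cabs (w - z) <= e / 4.
  rewrite (@le_trans _ _ ((L + 1) * cabs (w - z)))//.
    by rewrite ler_wpM2r ?cabs_ge0// lerDl.
  by rewrite mulrC -ler_pdivlMr// ltW.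
have -> : F w - F z = (F w - p.[w]) + (p.[w] - p.[z]) - (F z - p.[z]) by ring.
have h5 := cabsB (F w - p.[w] + (p.[w] - p.[z])) (F z - p.[z]).
have h6 := cabsD (F w - p.[w]) (p.[w] - p.[z]).
lra.
Qed.

Lemma polyapp_poly r (p : {poly R[i]}) : polyapp r (horner p).
Proof. by move=> e e0; exists p => z _; rewrite subrr cabs0 ltW. Qed.

Lemma eq_polyapp r F G : (forall z, cabs z <= r -> F z = G z) ->
  polyapp r F -> polyapp r G.
Proof. by move=> FG aF e /aF[p pF]; exists p => z zr; rewrite -FG// pF. Qed.

Lemma polyapp_cst r z : polyapp r (fun=> z).
Proof. by apply: eq_polyapp (polyapp_poly r z%:P) => w _; rewrite hornerC. Qed.

Lemma polyapp_id r : polyapp r id.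
Proof. by apply: eq_polyapp (polyapp_poly r 'X) => w _; rewrite hornerX. Qed.

Lemma polyappD r F G : polyapp r F -> polyapp r G -> polyapp r (fun z => F z + G z).
Proof.
move=> aF aG e e0; have e2 : 0 < e / 2 by rewrite divr_gt0.
have [p pF] := aF _ e2; have [q qG] := aG _ e2.
exists (p + q) => z zr; rewrite hornerD opprD addrACA (splitr e).
by rewrite (le_trans (cabsD _ _))// lerD ?pF ?qG.
Qed.

Lemma polyappM r F G : polyapp r F -> polyapp r G -> polyapp r (fun z => F z * G z).
Proof.
move=> aF aG e e0.
have [M [M0 FM]] := polyapp_bounded aF.
have [q qG] := aG (e / 2 / M) (divr_gt0 (divr_gt0 e0 (ltr0n _ 2)) M0).
have [N [N0 qN]] := poly_bounded q r.
(* The polynomial [p] comes last because its tolerance depends on the bound [N] of [q], whereas [q]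
   only needs the bound of [F]. *)
have [p pF] := aF (e / 2 / N) (divr_gt0 (divr_gt0 e0 (ltr0n _ 2)) N0).
exists (p * q) => z zr; rewrite hornerM (splitr e).
have -> : F z * G z - p.[z] * q.[z] = F z * (G z - q.[z]) + (F z - p.[z]) * q.[z].
  by ring.
rewrite (le_trans (cabsD _ _))// !cabsM lerD//.
  rewrite mulrC (le_trans (ler_pM _ _ (qG _ zr) (FM _ zr))) ?cabs_ge0//.
  by rewrite divfK ?gt_eqF.
by rewrite (le_trans (ler_pM _ _ (pF _ zr) (qN _ zr))) ?cabs_ge0// divfK ?gt_eqF.
Qed.

Lemma polyappX r F n : polyapp r F -> polyapp r (fun z => F z ^+ n).
Proof.
move=> aF; elim: n => [|n IH].
  by apply: eq_polyapp (polyapp_cst r 1) => z _; rewrite expr0.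
by apply: eq_polyapp (polyappM aF IH) => z _; rewrite exprS.
Qed.

Lemma polyappZ r (c : R[i]) F : polyapp r F -> polyapp r (fun z => c * F z).
Proof. by move=> aF; apply: polyappM aF; exact: polyapp_cst. Qed.

Lemma polyappN r F : polyapp r F -> polyapp r (fun z => - F z).
Proof.
by move=> aF; apply: eq_polyapp (polyappZ (-1) aF) => z _; rewrite mulN1r.
Qed.

Lemma polyapp_lim r F : (forall e, 0 < e -> exists G, polyapp r G /\
    forall z, cabs z <= r -> cabs (F z - G z) <= e) -> polyapp r F.
Proof.
move=> FG e e0; have e2 : 0 < e / 2 by rewrite divr_gt0.
have [G [/(_ _ e2)[p pG] {}FG]] := FG _ e2.
exists p => z zr; rewrite (splitr e) (le_trans (cabs_triangle (G z) _ _))//.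
by rewrite lerD ?pG ?FG.
Qed.

Lemma polyapp_dilate r (s : R) F : 0 <= s -> polyapp (s * r) F ->
  polyapp r (fun z => F (s%:C * z)).
Proof.
move=> s0 aF e /aF[p pF]; exists (p \Po (s%:C *: 'X)) => z zr.
rewrite horner_comp hornerZ hornerX pF// cabsM cabsC ger0_norm//.
by rewrite ler_wpM2l.
Qed.

(** The remainder of the geometric series is exactly [z ^+ n / (1 - z)]. *)
Lemma geometric_error z r n : cabs z <= r -> r < 1 ->
  cabs ((1 - z)^-1 - \sum_(k < n) z ^+ k) <= r ^+ n / (1 - r).
Proof.
move=> zr r1; have d0 : 0 < 1 - r by rewrite subr_gt0.
have r0 : 0 <= r := le_trans (cabs_ge0 _) zr.
have dz : 1 - r <= cabs (1 - z).
  by rewrite (le_trans _ (cabs_lerB _ _))// cabs1 lerD2l lerN2.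
have z1 : 1 - z != 0 by rewrite -cabs_gt0 (lt_le_trans d0).
have -> : (1 - z)^-1 - \sum_(k < n) z ^+ k = z ^+ n / (1 - z).
  apply: (mulfI z1); rewrite mulrBr divff// -[in LHS](opprB z 1) mulNr.
  by rewrite -subrX1 opprK addrC subrK mulrCA divff// mulr1.
rewrite cabsM cabsX cabsV ler_pM ?exprn_ge0 ?cabs_ge0 ?invr_ge0 ?cabs_ge0//.
  by rewrite lerXn2r ?nnegrE ?cabs_ge0.
by rewrite lef_pV2 ?posrE// (lt_le_trans d0).
Qed.

Lemma geometric_small r e : 0 <= r < 1 -> 0 < e -> exists n, r ^+ n <= e.
Proof.
move=> /andP[r0 r1] e0.
have : (fun n => r ^+ n) @ \oo --> (0 : R) by apply: cvg_expr; rewrite ger0_norm.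
move=> /cvgr0Pnorm_le /(_ _ e0)[n _ /(_ n (leqnn n))/= h].
by exists n; apply: le_trans h; exact: ler_norm.
Qed.

(** The only possible pole [1 / w] lies outside the closed disc of radius [r], so the geometric
    series in [w * z] converges uniformly there. *)
Lemma polyapp_geometric r w : cabs w * r < 1 -> 0 <= r ->
  polyapp r (fun z => (1 - w * z)^-1).
Proof.
move=> wr1 r0 e e0; set q := cabs w * r.
have q0 : 0 <= q by rewrite mulr_ge0 ?cabs_ge0.
have q1 : 0 < 1 - q by rewrite subr_gt0.
have [n nq] := @geometric_small q (e * (1 - q)) (introT andP (conj q0 wr1))
  (mulr_gt0 e0 q1).
exists (\sum_(k < n) (w ^+ k) *: 'X^k) => z zr.
have -> : (\sum_(k < n) (w ^+ k) *: 'X^k).[z] = \sum_(k < n) (w * z) ^+ k.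
  by rewrite horner_sum; apply: eq_bigr => k _; rewrite hornerZ hornerXn exprMn.
rewrite (le_trans (@geometric_error _ q n _ wr1))//.
  by rewrite cabsM ler_wpM2l ?cabs_ge0.
by rewrite ler_pdivrMr.
Qed.

End PolynomialApproximation.

(** * First-order expansions and the exponential of an analytic function *)

Section ComplexExponential.
Context {R : realType}.
Implicit Types (F G : R[i] -> R[i]) (z w : R[i]) (r e x y : R).
Local Notation Re := (@complex.Re R).
Local Notation Im := (@complex.Im R).

Lemma expR_taylor1 x : `|x| <= 2^-1 -> `|expR x - 1 - x| <= 2 * x ^+ 2.
Proof.
rewrite ler_norml => /andP[x1 x2].
have h1 := expR_ge1Dx x; have h2 := expR_ge1Dx (- x).
rewrite ger0_norm; last by lra.
have h3 : expR x * (1 - x) <= 1.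
  rewrite -[leRHS](expRxMexpNx_1 x).
  by apply: ler_wpM2l h2; exact: expR_ge0.
(* By the previous line the product is at most [- x ^+ 2 * (1 - 2 * x)], which is where [x <= 1 / 2]
   enters. *)
have : (expR x - 1 - x - 2 * x ^+ 2) * (1 - x) <= 0 by nra.
by rewrite pmulr_lle0; lra.
Qed.

Lemma cos_taylor1 x : 0 <= 1 - cos x <= x ^+ 2 / 2.
Proof.
rewrite subr_ge0 cos_le1/=.
have -> : cos x = 1 - 2 * sin (x / 2) ^+ 2.
  have {1}-> : x = (x / 2) *+ 2 by rewrite mulr2n -splitr.
  by rewrite cos_mulr2n cos2sin2; ring.
have : `|sin (x / 2)| ^+ 2 <= `|x / 2| ^+ 2.
  by rewrite ler_pXn2r ?nnegrE// norm_sin_le.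
by rewrite !real_normK ?num_real// exprMn => ?; lra.
Qed.

Lemma sin_taylor1 x : `|x| <= 1 -> `|sin x - x| <= x ^+ 2.
Proof.
have pos y : 0 <= y -> y <= 1 -> `|sin y - y| <= y ^+ 2.
  rewrite le_eqVlt => /predU1P[<-|y0 y1]; first by rewrite sin0 subrr normr0 sqr_ge0.
  have [|c /andP[c0 cy]] := @MVT R sin cos 0 y y0.
    by apply: continuous_subspaceT => u; exact: continuous_sin.
  rewrite sin0 !subr0 => ->.
  have /andP[d1 d2] := cos_taylor1 c.
  rewrite !bnd_simp in c0 cy.
  rewrite ler0_norm; nra.
move=> x1; have [x0|x0] := leP 0 x.
  by apply: pos => //; apply: le_trans x1; exact: ler_norm.
have := pos (- x); rewrite oppr_ge0 ltW// sinN sqrrN -opprD normrN.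
by apply => //; apply: le_trans x1; rewrite -normrN ler_norm.
Qed.

(** Real and imaginary parts each cost [3 * m ^+ 2]: with [E = expR x], write
    [E c - 1 - x = (E - 1 - x) - E (1 - c)] and [E s - y = (E - 1) s + (s - y)]. *)
Lemma cexp_taylor1 w : cabs w <= 2^-1 -> cabs (cexp w - 1 - w) <= 6 * cabs w ^+ 2.
Proof.
move=> w1; set m := cabs w in w1 *.
have m0 : 0 <= m := cabs_ge0 w.
have xm : `|Re w| <= m := Re_le_cabs w.
have ym : `|Im w| <= m := Im_le_cabs w.
rewrite (le_trans (cabs_le_ReIm _))// !ReD !ImD !ReN !ImN /= subr0.
have hx := expR_taylor1 (le_trans xm w1).
have hy := @sin_taylor1 (Im w) (le_trans ym _).
have {}hy : `|sin (Im w) - Im w| <= Im w ^+ 2 by apply: hy; lra.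
have /andP[c1 c2] := cos_taylor1 (Im w).
have hs := norm_sin_le (Im w).
have hs1 := sin_max (Im w).
move: xm ym hx hy c1 c2 hs hs1.
set x := Re w; set y := Im w; set E := expR x; set s := sin y; set c := cos y.
move=> xm ym hx hy c1 c2 hs hs1.
have x2 : x ^+ 2 <= m ^+ 2 by rewrite -(real_normK (num_real x)) ler_pXn2r ?nnegrE.
have y2 : y ^+ 2 <= m ^+ 2 by rewrite -(real_normK (num_real y)) ler_pXn2r ?nnegrE.
have E0 : 0 <= E := expR_ge0 x.
have m2 : m ^+ 2 <= m / 2 by nra.
have E2 : `|E - 1| <= 2 * m.
  have -> : E - 1 = (E - 1 - x) + x by ring.
  by rewrite (le_trans (ler_normD _ _))//; lra.
have E3 : E <= 2 by move: E2; rewrite ler_norml => /andP[]; lra.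
have r1 : `|E * c - 1 - x| <= 3 * m ^+ 2.
  have -> : E * c - 1 - x = (E - 1 - x) - E * (1 - c) by ring.
  rewrite (le_trans (ler_normB _ _))// [`|E * _|]ger0_norm ?mulr_ge0//.
  by nra.
have r2 : `|E * s - y| <= 3 * m ^+ 2.
  have -> : E * s - y = (E - 1) * s + (s - y) by ring.
  rewrite (le_trans (ler_normD _ _))// normrM.
  have : `|E - 1| * `|s| <= (2 * m) * m by rewrite ler_pM// (le_trans hs).
  by nra.
by lra.
Qed.

(** Telescoping gives the exponent [n.-1]; the assumption [1 <= m] allows it to be rounded up to
    [n]. *)
Lemma cabs_subX z w (m : R) n : 1 <= m -> cabs z <= m -> cabs w <= m ->
  cabs (z ^+ n - w ^+ n) <= n%:R * cabs (z - w) * m ^+ n.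
Proof.
move=> m1 zm wm; have m0 : 0 <= m by apply: le_trans m1.
elim: n => [|n IH]; first by rewrite !expr0 subrr cabs0 !mul0r.
have -> : z ^+ n.+1 - w ^+ n.+1 = z * (z ^+ n - w ^+ n) + (z - w) * w ^+ n.
  by rewrite !exprS; ring.
rewrite (le_trans (cabsD _ _))// !cabsM cabsX -natr1 !mulrDl mul1r lerD//.
  rewrite exprS mulrCA ler_pM ?cabs_ge0//.
rewrite ler_wpM2l ?cabs_ge0// exprS.
rewrite (@le_trans _ _ (m ^+ n))// ?lerXn2r ?nnegrE ?cabs_ge0//.
by rewrite ler_peMl// exprn_ge0.
Qed.

(** Uniform limit of [(1 + F / n) ^+ n]: [cexp F] is the [n]-th power of [cexp (F / n)], the two
    bases differ by [O(1 / n ^+ 2)], and taking powers multiplies this by [n * expR M]. *)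
Lemma polyapp_cexp r F : polyapp r F -> polyapp r (fun z => cexp (F z)).
Proof.
move=> aF; apply: polyapp_lim => e e0.
have [M [M0 FM]] := polyapp_bounded aF.
(* The first term makes [F / n] at most [1 / 2] in modulus, the second brings the error
   [6 * M ^+ 2 * expR M / n] below [e]. *)
pose N := (`|2 * M| + `|6 * M ^+ 2 * expR M / e|).
have [n nN] : exists n : nat, N < n%:R by exists (Num.truncn N).+1; exact: truncnS_gt.
have n0 : (0 : R) < n%:R by apply: le_lt_trans nN; rewrite addr_ge0.
have n1 : 2 * M <= n%:R.
  by rewrite (le_trans (ler_norm _))// (le_trans _ (ltW nN))// lerDl.
have n2 : 6 * M ^+ 2 * expR M / e <= n%:R.
  by rewrite (le_trans (ler_norm _))// (le_trans _ (ltW nN))// lerDr.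
exists (fun z => (1 + n%:R^-1 * F z) ^+ n); split.
  by apply: polyappX; apply: polyappD; [exact: polyapp_cst|exact: polyappZ].
move=> z /FM zM; set w := n%:R^-1 * F z.
have nC : (n%:R : R[i]) = (n%:R : R)%:C by rewrite rmorph_nat.
have Fw : F z = n%:R * w.
  by rewrite mulrA divff ?mul1r// nC; apply: contraTN n0 => /eqP/complexI->; rewrite ltxx.
have wM : cabs w <= M / n%:R.
  rewrite cabsM cabsV nC cabsC ger0_norm; last exact: ltW.
  by rewrite mulrC ler_wpM2r// invr_ge0 ltW.
have w2 : cabs w <= 2^-1 by rewrite (le_trans wM)// ler_pdivrMr//; lra.
rewrite Fw cexpMn.
have m1 : 1 <= expR (M / n%:R) by rewrite -expR0 ler_expR divr_ge0// ltW.
rewrite (le_trans (@cabs_subX _ _ _ n m1 _ _))//.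
- by rewrite cabs_cexp ler_expR (le_trans _ wM)// (le_trans (ler_norm _) (Re_le_cabs _)).
- rewrite (le_trans (cabsD _ _))// cabs1 (le_trans _ (expR_ge1Dx _))//.
  by rewrite lerD2l.
rewrite -expRM_natl mulrCA divff ?gt_eqF// mulr1 opprD addrA.
have h := cexp_taylor1 w2.
have h2 : cabs w ^+ 2 <= (M / n%:R) ^+ 2 by rewrite ler_pXn2r ?nnegrE ?cabs_ge0// divr_ge0// ltW.
apply: (@le_trans _ _ (n%:R * (6 * (M / n%:R) ^+ 2) * expR M)).
  rewrite ler_wpM2r ?expR_ge0// ler_wpM2l ?(ltW n0)// (le_trans h)//.
  by rewrite ler_wpM2l.
have -> : n%:R * (6 * (M / n%:R) ^+ 2) * expR M = 6 * M ^+ 2 * expR M / n%:R.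
  by field; rewrite gt_eqF.
by rewrite ler_pdivrMr// [e * _]mulrC -ler_pdivrMr.
Qed.

End ComplexExponential.

(** * The Herglotz kernel and its power series *)

Section Herglotz.
Context {R : realType}.
Implicit Types (F : R[i] -> R[i]) (z : R[i]) (r : R) (w : R -> R).
Local Notation T0 := (@T0 R).

Lemma cabs_eitB_ge (t : R) z : 1 - cabs z <= cabs (eit t - z).
Proof. by rewrite (le_trans _ (cabs_lerB _ _))// cabs_eit. Qed.

Lemma eitB_neq0 (t : R) z : cabs z < 1 -> eit t - z != 0.
Proof.
by move=> z1; rewrite -cabs_gt0 (lt_le_trans _ (cabs_eitB_ge t z))// subr_gt0.
Qed.

Lemma cabs_Hkernel (t : R) z : cabs z < 1 ->
  cabs ((eit t + z) / (eit t - z)) <= 2 / (1 - cabs z).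
Proof.
move=> z1; rewrite cabsM cabsV ler_pM ?cabs_ge0 ?invr_ge0 ?cabs_ge0//.
  rewrite (le_trans (cabsD _ _))// cabs_eit; lra.
have d : 0 < 1 - cabs z by rewrite subr_gt0.
by rewrite lef_pV2 ?posrE ?cabs_eitB_ge// (lt_le_trans d)// cabs_eitB_ge.
Qed.

Lemma cmeasurable_Hkernel z : cmeasurable (fun t : R => (eit t + z) / (eit t - z)).
Proof.
apply: cmeasurableM; first by apply: cmeasurableD;
  [exact: cmeasurable_eit|exact: cmeasurable_cst].
apply: cmeasurableV; apply: cmeasurableB;
  [exact: cmeasurable_eit|exact: cmeasurable_cst].
Qed.

Variables (mu : {measure set (measurableTypeR R) -> \bar R}).

Lemma cintegrable_bddM (f : R -> R[i]) w (M : R) : cmeasurable f ->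
  measurable_fun setT w -> mu.-integrable T0 (EFin \o w) -> 0 <= M ->
  (forall t, T0 t -> cabs (f t) <= M) ->
  cintegrable mu T0 (fun t => f t * (w t)%:C).
Proof.
move=> mf mw iw M0 fM; apply: (@cintegrable_dom _ _ _ measurable_T0 _ (fun t => M * `|w t|)).
- by apply: cmeasurableM => //; exact: cmeasurableC.
- by move=> t Tt; rewrite cabsM cabsC ler_wpM2r// fM.
- exact: (integrableRZ measurable_T0 M (integrable_norm iw)).
Qed.

Lemma cintegrable_Hkernel z w : cabs z < 1 ->
  measurable_fun setT w -> mu.-integrable T0 (EFin \o w) ->
  cintegrable mu T0 (fun t => (eit t + z) / (eit t - z) * (w t)%:C).
Proof.
move=> z1 mw iw; apply: (@cintegrable_bddM _ _ (2 / (1 - cabs z))) => //.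
- exact: cmeasurable_Hkernel.
- by rewrite divr_ge0// subr_ge0 ltW.
- by move=> t _; exact: cabs_Hkernel.
Qed.

(** Moments of [w mu], not normalized: the Herglotz integral has constant term [Hcoef w 0] and
    coefficients [2 * Hcoef w k] for [k > 0]. The measure is arbitrary so that the exponent of the
    singular factor ([w = 1]) is covered too. *)
Definition Hcoef w (k : nat) : R[i] :=
  cint mu T0 (fun t => eit (- t) ^+ k * (w t)%:C).

Lemma cintegrable_Hcoef w k : measurable_fun setT w ->
  mu.-integrable T0 (EFin \o w) ->
  cintegrable mu T0 (fun t => eit (- t) ^+ k * (w t)%:C).
Proof.
move=> mw iw; apply: (@cintegrable_bddM _ _ 1) => //.
  by under eq_fun do rewrite -mulN1r; apply/cmeasurableX/cmeasurable_eitM.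
by move=> t _; rewrite cabsX cabs_eit expr1n.
Qed.

(** The kernel is [2 / (1 - z * eit (- t)) - 1]; truncating the geometric series leaves
    [2 * r ^+ n / (1 - r)], doubled again by [cabs_cint_le]. *)
Lemma herglotz_error w z r n : measurable_fun setT w ->
  mu.-integrable T0 (EFin \o w) -> cabs z <= r -> r < 1 ->
  cabs (cint mu T0 (fun t => (eit t + z) / (eit t - z) * (w t)%:C) -
    (\sum_(k < n) (2 * Hcoef w k) * z ^+ k - Hcoef w 0)) <=
  4 * (r ^+ n / (1 - r)) * Rintegral mu T0 (fun t => `|w t|).
Proof.
move=> mw iw zr r1; have z1 : cabs z < 1 := le_lt_trans zr r1.
have mT := @measurable_T0 R.
pose P t : R[i] := \sum_(k < n) (2 * z ^+ k) * (eit (- t) ^+ k * (w t)%:C).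
have iP : cintegrable mu T0 P.
  apply: cintegrable_sum => // k.
  exact: (cintegrableZ mT _ (cintegrable_Hcoef k mw iw)).
have -> : \sum_(k < n) (2 * Hcoef w k) * z ^+ k = cint mu T0 P.
  rewrite cint_sum => // [|k]; last first.
    exact: (cintegrableZ mT _ (cintegrable_Hcoef k mw iw)).
  apply: eq_bigr => k _; rewrite cintZ//; last exact: cintegrable_Hcoef.
  by rewrite /Hcoef; ring.
have i0 := cintegrable_Hcoef 0 mw iw.
have iK := cintegrable_Hkernel z1 mw iw.
rewrite -cintB// -cintB//; last exact: cintegrableB.
rewrite (le_trans (cabs_cint_le mT _ (k := fun t => 2 * (r ^+ n / (1 - r)) * `|w t|) _ _))//.
- by apply: cintegrableB => //; exact: cintegrableB.
- exact: (integrableRZ mT _ (integrable_norm iw)).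
- move=> t _.
  have -> : (eit t + z) / (eit t - z) * (w t)%:C - (P t - eit (- t) ^+ 0 * (w t)%:C) =
    2 * ((1 - z * eit (- t))^-1 - \sum_(k < n) (z * eit (- t)) ^+ k) * (w t)%:C.
    rewrite /P expr0 mul1r.
    have -> : \sum_(k < n) 2 * z ^+ k * (eit (- t) ^+ k * (w t)%:C) =
      2 * (\sum_(k < n) (z * eit (- t)) ^+ k) * (w t)%:C.
      by rewrite mulr_sumr mulr_suml; apply: eq_bigr => k _; rewrite exprMn; ring.
    have -> : (1 - z * eit (- t))^-1 = eit t / (eit t - z).
      rewrite eitN; field; rewrite eit_neq0 eitB_neq0//=.
    by field; exact: eitB_neq0.
  rewrite !cabsM cabsC ler_wpM2r// ler_pM ?cabs_ge0//.
    by rewrite -[2]/(2%:R) -(rmorph_nat (real_complex R)) cabsC ger0_norm.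
  by apply: geometric_error => //; rewrite cabsM cabs_eit mulr1.
by rewrite RintegralZl//; [lra|exact: integrable_norm].
Qed.

Lemma polyapp_cint w r : measurable_fun setT w ->
  mu.-integrable T0 (EFin \o w) -> 0 <= r < 1 ->
  polyapp r (fun z => cint mu T0 (fun t => (eit t + z) / (eit t - z) * (w t)%:C)).
Proof.
move=> mw iw /andP[r0 r1] e e0.
pose A := 4 / (1 - r) * Rintegral mu T0 (fun t => `|w t|).
have A0 : 0 <= A by rewrite mulr_ge0 ?Rintegral_ge0// divr_ge0// subr_ge0 ltW.
have A1 : 0 < A + 1 by rewrite ltr_wpDl.
have [n nr] := @geometric_small _ r (e / (A + 1)) (introT andP (conj r0 r1))
  (divr_gt0 e0 A1).
exists (\sum_(k < n) (2 * Hcoef w k) *: 'X^k - (Hcoef w 0)%:P) => z zr.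
rewrite hornerD hornerN hornerC horner_sum.
under eq_bigr do rewrite hornerZ hornerXn.
rewrite (le_trans (herglotz_error n mw iw zr r1))//.
have -> : 4 * (r ^+ n / (1 - r)) * Rintegral mu T0 (fun t => `|w t|) = r ^+ n * A.
  by rewrite /A; ring.
rewrite (@le_trans _ _ (e / (A + 1) * A))// ?ler_wpM2r//.
by rewrite mulrAC ler_pdivrMr// ler_wpM2l ?(ltW e0)// lerDl.
Qed.

End Herglotz.

(** * Invariance of Lebesgue measure and integrals over a period *)

Section PeriodicIntegrals.
Context {R : realType}.
Local Notation leb := (@lebesgue_measure R).
Local Notation mR := (measurableTypeR R).

Lemma ge0_integral_invariant (phi : mR -> mR) (D : set R) (f : R -> \bar R) :
  measurable_fun setT phi ->
  (forall A : set mR, measurable A -> leb (phi @^-1` A) = leb A) ->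
  measurable (D : set mR) -> measurable_fun setT f -> (forall x, (0 <= f x)%E) ->
  (\int[leb]_(x in D) f x = \int[leb]_(x in phi @^-1` D) f (phi x))%E.
Proof.
move=> mphi inv mD mf f0.
pose mix := isMeasurableFun.Build _ _ _ _ _ mphi.
pose phi' : {mfun mR >-> mR} := HB.pack phi mix.
rewrite -(@ge0_integral_pushforward _ _ _ _ _ phi mphi leb D f)//; last first.
  exact: measurable_funTS.
by apply: eq_measure_integral => A mA _; rewrite -[RHS]/(leb (phi @^-1` A)) inv.
Qed.

Lemma integral_invariant (phi : mR -> mR) (D : set R) (f : R -> R) :
  measurable_fun setT phi ->
  (forall A : set mR, measurable A -> leb (phi @^-1` A) = leb A) ->
  measurable (D : set mR) -> measurable_fun setT f ->
  (\int[leb]_(x in D) (f x)%:E = \int[leb]_(x in phi @^-1` D) (f (phi x))%:E)%E.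
Proof.
move=> mphi inv mD mf; rewrite integralE [RHS]integralE.
have mf' : measurable_fun setT (EFin \o f) by exact/measurable_EFinP.
congr (_ - _)%E.
  rewrite (ge0_integral_invariant mphi inv mD (measurable_funepos mf'))//.
  by apply: eq_integral => t _; rewrite !funeposE.
rewrite (ge0_integral_invariant mphi inv mD (measurable_funeneg mf'))//.
by apply: eq_integral => t _; rewrite !funenegE.
Qed.

Lemma Rintegral_invariant (phi : mR -> mR) (D : set R) (f : R -> R) :
  measurable_fun setT phi ->
  (forall A : set mR, measurable A -> leb (phi @^-1` A) = leb A) ->
  measurable (D : set mR) -> measurable_fun setT f ->
  Rintegral leb D f = Rintegral leb (phi @^-1` D) (fun x => f (phi x)).
Proof.
by move=> mphi inv mD mf; rewrite /Rintegral (integral_invariant mphi inv mD mf).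
Qed.

(** The translated measure agrees with Lebesgue measure on half-open intervals, and this
    characterizes it. *)
Lemma leb_shift (a : R) (A : set mR) : measurable A ->
  leb ((fun t : mR => t + a : mR) @^-1` A) = leb A.
Proof.
move=> mA.
have mphi : measurable_fun setT (fun t : mR => t + a : mR).
  by apply: continuous_measurable_fun => t; apply: cvgD; [exact: cvg_id|exact: cvg_cst].
pose mix := isMeasurableFun.Build _ _ _ _ _ mphi.
pose phi' : {mfun mR >-> mR} := HB.pack (fun t : mR => t + a : mR) mix.
apply/esym; rewrite -[RHS]/(pushforward leb phi' A).
apply: lebesgue_measure_unique => //= _ [[x y]] _ <-.
rewrite /pushforward.
have -> : phi' @^-1` [set` `]x, y]] = [set` `](x - a), (y - a)]].
  by apply/seteqP; split => t /=; rewrite !in_itv/= ltrBlDr lerBrDr.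
rewrite !lebesgue_measure_itv/= !lte_fin ltrD2r.
by case: ifP => // _; rewrite -!EFinD; congr EFin; ring.
Qed.

Lemma Rintegral_shift (a : R) (D : set R) (f : R -> R) :
  measurable (D : set mR) -> measurable_fun setT f ->
  Rintegral leb D f = Rintegral leb [set t | D (t + a)] (fun t => f (t + a)).
Proof.
move=> mD mf; apply: (@Rintegral_invariant (fun t : mR => t + a : mR)) => //.
  by apply: continuous_measurable_fun => t; apply: cvgD; [exact: cvg_id|exact: cvg_cst].
exact: leb_shift.
Qed.

Lemma Rintegral_reflect (a : R) (D : set R) (f : R -> R) :
  measurable (D : set mR) -> measurable_fun setT f ->
  Rintegral leb D f = Rintegral leb [set t | D (a - t)] (fun t => f (a - t)).
Proof.
move=> mD mf; apply: (@Rintegral_invariant (fun t : mR => a - t : mR)) => //.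
  by apply: continuous_measurable_fun => t; apply: cvgB; [exact: cvg_cst|exact: cvg_id].
(* The reflection is negation followed by the translation by [a], and both preserve Lebesgue
   measure. *)
move=> A mA; rewrite -[RHS](leb_shift a)//.
rewrite -[RHS]lebesgue_measureN; last first.
  rewrite -[X in measurable X]setTI; apply: (_ : measurable_fun setT (fun t : mR => t + a : mR)) => //.
  by apply: continuous_measurable_fun => t; apply: cvgD; [exact: cvg_id|exact: cvg_cst].
by rewrite /pushforward; congr (leb _); apply/seteqP; split => t /=; rewrite addrC.
Qed.

Lemma Rintegral_itvU (a b c : R) (f : R -> R) : measurable_fun setT f ->
  a <= b <= c ->
  (\int[leb]_(x in `[a, c[) (f x)%:E =
   \int[leb]_(x in `[a, b[) (f x)%:E + \int[leb]_(x in `[b, c[) (f x)%:E)%E.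
Proof.
move=> mf /andP[ab bc].
rewrite -integral_setU//.
- by congr (integral _ _ _); rewrite -itv_bndbnd_setU.
- by apply/measurable_EFinP; exact: measurable_funTS.
- apply/disj_setPS => x /= [] /=; rewrite !in_itv/= => /andP[_ h1] /andP[h2 _].
  by move: (lt_le_trans h1 h2); rewrite ltxx.
Qed.

(** For [a >= 0] the part of the window beyond [2 * pi] is moved back by one period; a negative [a]
    is compared with [a + 2 * pi]. *)
Lemma Rintegral_period (G : R -> R) (a : R) : Defs.periodic G ->
  measurable_fun setT G -> - (2 * pi) <= a <= 2 * pi ->
  Rintegral leb `[a, (a + 2 * pi)[ G = Rintegral leb (@T0 R) G.
Proof.
move=> pG mG.
have pos (b : R) : 0 <= b <= 2 * pi ->
    Rintegral leb `[b, (b + 2 * pi)[ G = Rintegral leb (@T0 R) G.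
  move=> /andP[b0 b2]; rewrite /Rintegral; congr fine.
  rewrite (@Rintegral_itvU b (2 * pi))//; last by rewrite b2 lerDr.
  rewrite /T0 (@Rintegral_itvU 0 b (2 * pi))// ?b0// addeC; congr (_ + _)%E.
  have mphi : measurable_fun setT (fun t : mR => t + 2 * pi : mR).
    by apply: continuous_measurable_fun => t; apply: cvgD; [exact: cvg_id|exact: cvg_cst].
  have e : (fun t : mR => t + 2 * pi : mR) @^-1` `[(2 * pi), (b + 2 * pi)[ = `[0, b[%classic.
    apply/seteqP; split => t /=; rewrite !in_itv/= ?ltrD2r.
      by rewrite -lerBlDr subrr.
    by rewrite -{1}[2 * pi]add0r lerD2r.
  rewrite (integral_invariant mphi (leb_shift (2 * pi)) _ mG)// e.
  by apply: eq_integral => t _; rewrite pG.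
move=> /andP[a1 a2]; have [a0|a0] := leP 0 a; first by rewrite pos// a0.
rewrite -[RHS](pos (a + 2 * pi)); last first.
  by rewrite -lerBlDr sub0r a1/= gerDr ltW.
rewrite [RHS](Rintegral_shift (2 * pi))//.
congr (fine _); under [RHS]eq_integral do rewrite pG.
congr (integral _ _ _); apply/seteqP; split => t /=; rewrite !in_itv/= lerD2r.
  by rewrite ltrD2r.
by rewrite ltrD2r.
Qed.

Lemma Rintegral_T0_shift (G : R -> R) (a : R) : Defs.periodic G ->
  measurable_fun setT G -> 0 <= a <= 2 * pi ->
  Rintegral leb (@T0 R) (fun t => G (t + a)) = Rintegral leb (@T0 R) G.
Proof.
move=> pG mG /andP[a0 a2].
transitivity (Rintegral leb `[a, (a + 2 * pi)[ G); last first.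
  by rewrite Rintegral_period// a2 andbT (le_trans _ a0)// oppr_le0 ltW// twopi_gt0.
rewrite [RHS](Rintegral_shift a)//; congr (fine _); congr (integral _ _ _).
apply/seteqP; split => t; rewrite /T0/= !in_itv/=.
  by rewrite -[X in X <= t + a]add0r [a + _]addrC lerD2r ltrD2r.
by rewrite -[X in X <= t + a]add0r [a + _]addrC lerD2r ltrD2r.
Qed.

Lemma cint_T0_shift (G : R -> R[i]) (a : R) : Defs.periodic G ->
  cmeasurable G -> 0 <= a <= 2 * pi ->
  cint leb (@T0 R) (fun t => G (t + a)) = cint leb (@T0 R) G.
Proof.
move=> pG [mr mi] a02; rewrite /cint.
rewrite (@Rintegral_T0_shift (fun t => complex.Re (G t)))//; last by move=> t; rewrite pG.
by rewrite (@Rintegral_T0_shift (fun t => complex.Im (G t)))// => t; rewrite pG.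
Qed.

Lemma eitX_2pi (n : nat) (t : R) : eit (t + 2 * pi) ^+ n = eit t ^+ n.
Proof. by rewrite eit2pi. Qed.

Lemma leb_T0_lty : (leb (@T0 R) < +oo)%E.
Proof. by rewrite leb_T0 ltry. Qed.

Lemma cintegrable_unimod (f : R -> R[i]) : cmeasurable f ->
  (forall t, cabs (f t) <= 1) -> cintegrable leb (@T0 R) f.
Proof.
move=> mf f1; by apply: (@cintegrable_bdd _ _ _ 1) => //; exact: leb_T0_lty.
Qed.

Lemma cintegrable_eitX n : cintegrable leb (@T0 R) (fun t => eit t ^+ n).
Proof.
apply: cintegrable_unimod; first exact/cmeasurableX/cmeasurable_eit.
by move=> t; rewrite cabsX cabs_eit expr1n.
Qed.

(* Shifting the variable by [pi / n] multiplies the integrand by [-1]. *)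
Lemma cint_eitX n : cint leb (@T0 R) (fun t => eit t ^+ n.+1) = 0.
Proof.
have a02 : 0 <= (pi : R) / n.+1%:R <= 2 * pi.
  rewrite divr_ge0 ?pi_ge0//= ler_pdivrMr//.
  rewrite -[X in X <= _]mulr1 -mulrA mulrCA ler_wpM2l ?pi_ge0//.
  by rewrite -natrM ler1n muln_gt0.
have := @cint_T0_shift (fun t => eit t ^+ n.+1) _ (@eitX_2pi n.+1)
  (cmeasurableX _ cmeasurable_eit) a02.
have e : eit (pi / n.+1%:R) ^+ n.+1 = -1 :> R[i].
  rewrite -eitMn mulrCA divff// mulr1 /eit cospi sinpi.
  by apply: complex_ext; rewrite ?ReN ?ImN /= ?oppr0.
under eq_cint do rewrite eitD exprMn e mulrC.
rewrite cintZ//; [|exact: measurable_T0|exact: cintegrable_eitX].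
rewrite mulN1r => /esym/eqP; rewrite -addr_eq0 -mulr2n => /eqP h.
apply/eqP; move: h => /eqP; rewrite -mulr_natr mulf_eq0 => /orP[//|].
by rewrite pnatr_eq0.
Qed.

Lemma cint_cst (c : R[i]) : cint leb (@T0 R) (fun=> c) = c * (2 * pi)%:C.
Proof.
rewrite /cint !Rintegral_cst; [|exact: measurable_T0..].
by apply: complex_ext; rewrite ?ReMC ?ImMC /= leb_T0.
Qed.

Lemma cint_conj (f : R -> R[i]) : cintegrable leb (@T0 R) f ->
  cint leb (@T0 R) (fun t => (conjc (f t))) = (conjc (cint leb (@T0 R) f)).
Proof.
case=> fr fi; apply: complex_ext; rewrite ?Re_conj ?Im_conj /=.
  by apply: eq_Rintegral => t _; rewrite Re_conj.
have -> : - Rintegral leb (@T0 R) (fun t => complex.Im (f t)) =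
   (-1) * Rintegral leb (@T0 R) (fun t => complex.Im (f t)) by rewrite mulN1r.
rewrite -RintegralZl//; last exact: measurable_T0.
by apply: eq_Rintegral => t _; rewrite Im_conj mulN1r.
Qed.

Lemma cint_eitNX n : cint leb (@T0 R) (fun t => eit (- t) ^+ n.+1) = 0.
Proof.
rewrite -[RHS](conjc0 R) -(cint_eitX n) -cint_conj; last exact: cintegrable_eitX.
by apply: eq_cint => t _; rewrite -conj_eit rmorphXn.
Qed.

End PeriodicIntegrals.

(** * Means on the circle, the Poisson kernel and its action on monomials *)

Section PoissonKernel.
Context {R : realType}.
Implicit Types (u v : R -> R) (z : R[i]) (f g : R -> R[i]) (F : R[i] -> R[i]).
Local Notation leb := (@lebesgue_measure R).
Local Notation T0 := (@T0 R).
Local Notation Re := (@complex.Re R).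
Local Notation Tint f := (cintegrable leb T0 f).

Lemma Rintegral_T0_cst (x : R) : Rintegral leb T0 (fun=> x) = x * (2 * pi).
Proof.
rewrite Rintegral_cst; last exact: measurable_T0.
by congr (_ * _); exact: (congr1 fine leb_T0).
Qed.

Lemma twopiV_ge0 : 0 <= (2 * pi)^-1 :> R.
Proof. by rewrite invr_ge0 ltW// twopi_gt0. Qed.

Lemma mavgD f g : Tint f -> Tint g -> mavg (fun t => f t + g t) = mavg f + mavg g.
Proof.
by move=> fi gi; rewrite /mavg (cintD measurable_T0 fi gi) mulrDr.
Qed.

Lemma mavgB f g : Tint f -> Tint g -> mavg (fun t => f t - g t) = mavg f - mavg g.
Proof.
by move=> fi gi; rewrite /mavg (cintB measurable_T0 fi gi) mulrBr.
Qed.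

Lemma mavgZ z f : Tint f -> mavg (fun t => z * f t) = z * mavg f.
Proof.
by move=> fi; rewrite /mavg (cintZ measurable_T0 z fi) mulrCA.
Qed.

Lemma eq_mavg f g : (forall t, f t = g t) -> mavg f = mavg g.
Proof. by move=> fg; congr mavg; apply/funext. Qed.

Lemma mavg_sum (I : Type) (r : seq I) (G : I -> R -> R[i]) :
  (forall i, Tint (G i)) ->
  mavg (fun t => \sum_(i <- r) G i t) = \sum_(i <- r) mavg (G i).
Proof.
by move=> iG; rewrite /mavg (cint_sum measurable_T0)// mulr_sumr.
Qed.

Lemma mavg_cst z : mavg (fun=> z) = z.
Proof.
rewrite /mavg cint_cst mulrCA -rmorphM /= mulVf ?mulr1//.
by rewrite gt_eqF// twopi_gt0.
Qed.

Lemma cabs_mavg_le f (M : R) : Tint f -> (forall t, T0 t -> cabs (f t) <= M) ->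
  cabs (mavg f) <= 2 * M.
Proof.
move=> fi fM; rewrite /mavg cabsM cabsC ger0_norm ?twopiV_ge0//.
rewrite ler_pdivrMl ?twopi_gt0//.
have := cabs_cint_le measurable_T0 fi (integrable_T0_cst M leb_T0_lty) fM.
by rewrite Rintegral_T0_cst => /le_trans; apply; rewrite le_eqVlt; apply/orP/or_introl/eqP; ring.
Qed.

Lemma Tint_bdd f (M : R) : cmeasurable f -> (forall t, T0 t -> cabs (f t) <= M) -> Tint f.
Proof. by move=> mf fM; apply: (@cintegrable_bdd _ _ _ M) => //; exact: leb_T0_lty. Qed.

Lemma mavg_eitX n : mavg (fun t : R => eit t ^+ n.+1) = 0.
Proof. by rewrite /mavg cint_eitX mulr0. Qed.

Lemma mavg_conj f : Tint f -> mavg (fun t => (conjc (f t))) = (conjc (mavg f)).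
Proof. by move=> fi; rewrite /mavg (cint_conj fi) conjcM; congr (_ * _); rewrite conjc_real. Qed.

Lemma integrable_leb_cst (M : R) : leb.-integrable T0 (EFin \o (fun=> M)).
Proof. exact: (integrable_T0_cst M leb_T0_lty). Qed.

Lemma Re_Hkernel (t : R) z : Re ((eit t + z) / (eit t - z)) =
  (1 - cabs z ^+ 2) / cabs (eit t - z) ^+ 2.
Proof.
rewrite !sqr_cabs ReM ReV ImV mulrN opprK !mulrA -mulrDl; congr (_ / _).
have := cos2Dsin2 t; rewrite !ReD !ImD !ReN !ImN /= => <-; ring.
Qed.

Lemma herglotz1 z : cabs z < 1 -> herglotz (fun=> 1) z = 1.
Proof.
move=> z1; rewrite /herglotz.
have m1 : measurable_fun setT (fun _ : R => 1 : R) by exact: measurable_cst.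
have i1 := integrable_leb_cst 1.
pose r := cabs z; have r01 : 0 <= r < 1 by rewrite cabs_ge0.
set X := mavg _; apply/eqP; rewrite -subr_eq0 -cabs_eq0 eq_le cabs_ge0 andbT.
apply/ler_addgt0Pl => /= e e0; rewrite addr0.
have d0 : 0 < 1 - r by rewrite subr_gt0.
have [n nr] := @geometric_small _ r (e * (1 - r) / 4) r01
  (divr_gt0 (mulr_gt0 e0 d0) (ltr0n _ 4)).
have c0 : Hcoef leb (fun=> 1) 0 = (2 * pi)%:C.
  rewrite /Hcoef -[RHS]mul1r -cint_cst; apply: eq_cint => t _.
  by rewrite expr0 mul1r.
have cS k : Hcoef leb (fun=> 1) k.+1 = 0.
  rewrite /Hcoef -[RHS](cint_eitNX k); apply: eq_cint => t _.
  by rewrite mulr1.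
(* With [n.+1] terms the index 0 is present, and it is the only one with a nonzero moment:
   [2 c_0 - c_0 = 2 pi]. *)
have := herglotz_error n.+1 m1 i1 (lexx r) z1.
rewrite big_ord_recl c0 big1 => [|i _]; last by rewrite cS mulr0 mul0r.
rewrite expr0 mulr1 addr0.
have -> : 2 * (2 * pi)%:C - (2 * pi)%:C = (2 * pi)%:C :> R[i] by ring.
under eq_Rintegral do rewrite normr1.
rewrite Rintegral_T0_cst mul1r => h.
have -> : X - 1 = ((2 * pi)^-1)%:C * (cint leb T0 (fun t =>
    (eit t + z) / (eit t - z) * 1%:C) - (2 * pi)%:C).
  by rewrite mulrBr -rmorphM /= mulVf// gt_eqF// twopi_gt0.
rewrite cabsM cabsC ger0_norm ?twopiV_ge0// ler_pdivrMl ?twopi_gt0//.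
rewrite (le_trans h)// mulrC ler_wpM2l ?(ltW twopi_gt0)//.
rewrite mulrA ler_pdivrMr// -ler_pdivlMl// mulrC (le_trans _ nr)//.
by rewrite exprS ler_piMl// ?exprn_ge0 ?cabs_ge0// ltW.
Qed.

Lemma cmeasurable_Poisson z :
  cmeasurable (fun t : R => ((1 - cabs z ^+ 2) / cabs (eit t - z) ^+ 2)%:C).
Proof.
under eq_fun do rewrite -Re_Hkernel.
by apply: cmeasurableC; apply: measurable_Re; exact: cmeasurable_Hkernel.
Qed.

Lemma Poisson_ge0 z (t : R) : cabs z < 1 ->
  0 <= (1 - cabs z ^+ 2) / cabs (eit t - z) ^+ 2.
Proof.
by move=> z1; rewrite divr_ge0 ?exprn_ge0 ?cabs_ge0// subr_ge0 expr_le1 ?cabs_ge0// ltW.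
Qed.

Lemma Poisson_le z (t : R) : cabs z < 1 ->
  (1 - cabs z ^+ 2) / cabs (eit t - z) ^+ 2 <= 2 / (1 - cabs z).
Proof.
move=> z1; rewrite -Re_Hkernel (le_trans (ler_norm _))//.
by rewrite (le_trans (Re_le_cabs _))// cabs_Hkernel.
Qed.

Lemma Re_herglotz u z : Re (herglotz u z) =
  (2 * pi)^-1 * Rintegral leb T0 (fun t =>
    (1 - cabs z ^+ 2) / cabs (eit t - z) ^+ 2 * u t).
Proof.
rewrite /herglotz /mavg ReCM /=; congr (_ * _); apply: eq_Rintegral => t _.
by rewrite ReMC Re_Hkernel.
Qed.

Lemma herglotzD u v z : cabs z < 1 ->
  measurable_fun setT u -> leb.-integrable T0 (EFin \o u) ->
  measurable_fun setT v -> leb.-integrable T0 (EFin \o v) ->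
  herglotz (fun t => u t + v t) z = herglotz u z + herglotz v z.
Proof.
move=> z1 mu iu mv iv; rewrite /herglotz -mavgD; [|exact: cintegrable_Hkernel..].
by apply: eq_mavg => t; rewrite rmorphD mulrDr.
Qed.

Lemma herglotz_ae_eq u v z : cabs z < 1 ->
  measurable_fun setT u -> measurable_fun setT v ->
  {ae leb, forall t, T0 t -> u t = v t} -> herglotz u z = herglotz v z.
Proof.
move=> z1 mu mv uv; rewrite /herglotz /mavg /cint.
have mK := cmeasurable_Hkernel z.
have mKw (w : R -> R) : measurable_fun setT w ->
  cmeasurable (fun t => (eit t + z) / (eit t - z) * (w t)%:C).
  by move=> mw; apply: cmeasurableM => //; exact: cmeasurableC.
congr (_ * (_ +i* _)); congr fine; apply: ae_eq_integral.
- exact: measurable_T0.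
- by apply/measurable_EFinP; apply: measurable_funTS; have [] := mKw _ mu.
- by apply/measurable_EFinP; apply: measurable_funTS; have [] := mKw _ mv.
- by case: uv => N [mN N0 hN]; exists N; split=> // t /= nt; apply: hN => /= h; apply: nt => Tt; rewrite h.
- exact: measurable_T0.
- by apply/measurable_EFinP; apply: measurable_funTS; have [] := mKw _ mu.
- by apply/measurable_EFinP; apply: measurable_funTS; have [] := mKw _ mv.
- by case: uv => N [mN N0 hN]; exists N; split=> // t /= nt; apply: hN => /= h; apply: nt => Tt; rewrite h.
Qed.

Lemma polyapp_herglotz u (r : R) : measurable_fun setT u ->
  leb.-integrable T0 (EFin \o u) -> 0 <= r < 1 -> polyapp r (herglotz u).
Proof. by move=> mu iu r01; apply: polyappZ; exact: polyapp_cint. Qed.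

(** The Poisson kernel is nonnegative and, by [herglotz1], has mean 1. *)
Lemma Re_herglotz_bounded u z (M : R) : cabs z < 1 -> measurable_fun setT u ->
  (forall t, `|u t| <= M) -> `|Re (herglotz u z)| <= M.
Proof.
move=> z1 mu uM; rewrite Re_herglotz normrM ger0_norm ?twopiV_ge0//.
have mT := @measurable_T0 R.
have mP : measurable_fun setT (fun t : R => (1 - cabs z ^+ 2) / cabs (eit t - z) ^+ 2).
  by have [] := cmeasurable_Poisson z.
have iP : leb.-integrable T0 (EFin \o
    (fun t => (1 - cabs z ^+ 2) / cabs (eit t - z) ^+ 2)).
  apply: (@integrable_dom _ _ _ mT _ (fun=> 2 / (1 - cabs z))) => //.
    by move=> t _; rewrite ger0_norm ?Poisson_ge0// Poisson_le.
  exact: integrable_leb_cst.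
apply: (@le_trans _ _ (M * Re (herglotz (fun=> 1) z))); last by rewrite herglotz1//= mulr1.
rewrite Re_herglotz mulrCA ler_wpM2l ?twopiV_ge0//.
under [in leRHS]eq_Rintegral do rewrite mulr1.
rewrite -RintegralZl//; apply: norm_Rintegral_le => //.
- apply: (@integrable_dom _ _ _ mT _ (fun t => M * ((1 - cabs z ^+ 2) / cabs (eit t - z) ^+ 2))).
  + exact: measurable_funM.
  + by move=> t _; rewrite normrM ger0_norm ?Poisson_ge0// mulrC ler_wpM2r// Poisson_ge0.
  + exact: integrableRZ.
- exact: integrableRZ.
- by move=> t _; rewrite normrM ger0_norm ?Poisson_ge0// mulrC ler_wpM2r// Poisson_ge0.
Qed.

Lemma Tint_eitX_Hkernel z n : cabs z < 1 ->
  Tint (fun t => eit t ^+ n * ((eit t + z) / (eit t - z))).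
Proof.
move=> z1; apply: (@Tint_bdd _ (2 / (1 - cabs z))).
  by apply: cmeasurableM; [exact/cmeasurableX/cmeasurable_eit|exact: cmeasurable_Hkernel].
by move=> t _; rewrite cabsM cabsX cabs_eit expr1n mul1r cabs_Hkernel.
Qed.

(** With [K] the Herglotz kernel, [e^{it} K = z K + e^{it} + z]; averaging against [e^{ikt}] gives a
    recursion in [k]. *)
Lemma mavg_eitX_Hkernel z n : cabs z < 1 ->
  mavg (fun t => eit t ^+ n.+1 * ((eit t + z) / (eit t - z))) = 2 * z ^+ n.+1.
Proof.
move=> z1.
have step k : mavg (fun t => eit t ^+ k.+1 * ((eit t + z) / (eit t - z))) =
    z * mavg (fun t => eit t ^+ k * ((eit t + z) / (eit t - z))) + z * mavg (fun t => eit t ^+ k).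
  rewrite -!mavgZ; [|exact: cintegrable_eitX|exact: Tint_eitX_Hkernel].
  rewrite -[RHS]addr0 -(mavg_eitX k) -!mavgD.
  - apply: eq_mavg => t; have h := eitB_neq0 t z1.
    by rewrite exprS; field.
  - apply: (cintegrableD measurable_T0).
      exact: (cintegrableZ measurable_T0 z (Tint_eitX_Hkernel _ z1)).
    exact: (cintegrableZ measurable_T0 z (cintegrable_eitX _)).
  - exact: cintegrable_eitX.
  - exact: (cintegrableZ measurable_T0 z (Tint_eitX_Hkernel _ z1)).
  - exact: (cintegrableZ measurable_T0 z (cintegrable_eitX _)).
elim: n => [|n IH].
  rewrite step; under eq_mavg do rewrite expr0 mul1r.
  under [X in _ + z * X]eq_mavg do rewrite expr0.
  rewrite mavg_cst -[X in z * X + _](_ : herglotz (fun=> 1) z = _).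
    by rewrite herglotz1//; ring.
  by apply: eq_mavg => t; rewrite mulr1.
by rewrite step IH mavg_eitX mulr0 addr0 mulrCA -exprS.
Qed.

Lemma Tint_eitX_conj_Hkernel z n : cabs z < 1 ->
  Tint (fun t => eit t ^+ n * (conjc ((eit t + z) / (eit t - z)))).
Proof.
move=> z1; apply: (@Tint_bdd _ (2 / (1 - cabs z))).
  apply: cmeasurableM; [exact/cmeasurableX/cmeasurable_eit|].
  exact/cmeasurable_conj/cmeasurable_Hkernel.
by move=> t _; rewrite cabsM cabs_conj cabsX cabs_eit expr1n mul1r cabs_Hkernel.
Qed.

(** On the circle the conjugate kernel is [(1 + conjc z * eit t) / (1 - conjc z * eit t)]. Clearing
    the denominator shows that each mean is [conjc z] times the next one; iterated, it is
    [conjc z ^+ m] times a bounded quantity, for every [m]. *)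
Lemma mavg_eitX_conj_Hkernel z n : cabs z < 1 ->
  mavg (fun t => eit t ^+ n.+1 * (conjc ((eit t + z) / (eit t - z)))) = 0.
Proof.
move=> z1.
have step k : mavg (fun t => eit t ^+ k.+1 * (conjc ((eit t + z) / (eit t - z)))) =
    (conjc z) * mavg (fun t => eit t ^+ k.+2 * (conjc ((eit t + z) / (eit t - z)))).
  rewrite -mavgZ; last exact: Tint_eitX_conj_Hkernel.
  apply/eqP; rewrite -subr_eq0 -mavgB; last 2 first.
  - exact: Tint_eitX_conj_Hkernel.
  - exact: (cintegrableZ measurable_T0 (conjc z) (Tint_eitX_conj_Hkernel _ z1)).
  rewrite (_ : mavg _ = mavg (fun t => eit t ^+ k.+1 + (conjc z) * eit t ^+ k.+2)).
    rewrite mavgD; [|exact: cintegrable_eitX|].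
      by rewrite (mavgZ _ (cintegrable_eitX _)) !mavg_eitX mulr0 addr0.
    exact: (cintegrableZ measurable_T0 (conjc z) (cintegrable_eitX _)).
  apply: eq_mavg => t.
  have h : 1 - eit t * (conjc z) != 0.
    rewrite -cabs_gt0 (lt_le_trans _ (cabs_lerB _ _))//.
    by rewrite cabs1 cabsM cabs_eit cabs_conj mul1r subr_gt0.
  have -> : (conjc ((eit t + z) / (eit t - z))) = (1 + eit t * (conjc z)) / (1 - eit t * (conjc z)).
    rewrite conjcM conjcV !conjcD conjcN conj_eit eitN.
    have h' := eit_neq0 t; field.
    by rewrite h' h.
  by rewrite !exprS; field.
set X := mavg _.
have bnd m : cabs X <= cabs z ^+ m * (2 * (2 / (1 - cabs z))).
  have -> : X = (conjc z) ^+ m *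
      mavg (fun t => eit t ^+ (m + n).+1 * (conjc ((eit t + z) / (eit t - z)))).
    elim: m => [|m IH]; first by rewrite expr0 mul1r.
    by rewrite IH step mulrA -exprSr addSn.
  rewrite cabsM cabsX cabs_conj ler_wpM2l ?exprn_ge0 ?cabs_ge0//.
  apply: cabs_mavg_le; first exact: Tint_eitX_conj_Hkernel.
  by move=> t _; rewrite cabsM cabs_conj cabsX cabs_eit expr1n mul1r cabs_Hkernel.
apply/eqP; rewrite -cabs_eq0 eq_le cabs_ge0 andbT.
apply/ler_addgt0Pl => /= e e0; rewrite addr0.
have d0 : 0 < 2 * (2 / (1 - cabs z)) by rewrite mulr_gt0// divr_gt0// subr_gt0.
have [m mz] := @geometric_small _ (cabs z) (e / (2 * (2 / (1 - cabs z))))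
  (introT andP (conj (cabs_ge0 z) z1)) (divr_gt0 e0 d0).
by rewrite (le_trans (bnd m))// -ler_pdivlMr.
Qed.

Lemma poisson_ext_eitX z n : cabs z < 1 ->
  poisson_ext (fun t => eit t ^+ n) z = z ^+ n.
Proof.
move=> z1; rewrite /poisson_ext.
rewrite (_ : mavg _ = mavg (fun t => 2^-1 * (eit t ^+ n * ((eit t + z) / (eit t - z)))
   + 2^-1 * (eit t ^+ n * (conjc ((eit t + z) / (eit t - z)))))); last first.
  apply: eq_mavg => t; rewrite -Re_Hkernel -mulrDr -mulrDr mulrCA; congr (_ * _).
  by rewrite ReJ_add mulrC.
have i1 := Tint_eitX_Hkernel n z1; have i2 := Tint_eitX_conj_Hkernel n z1.
rewrite mavgD; [|exact: (cintegrableZ measurable_T0)..].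
rewrite !mavgZ//; case: n i1 i2 => [|n] i1 i2.
  under eq_mavg do rewrite expr0 mul1r.
  under [X in _ + _ * X]eq_mavg do rewrite expr0 mul1r.
  have i0 : Tint (fun t => (eit t + z) / (eit t - z)).
    by move: i1; under eq_fun do rewrite expr0 mul1r.
  rewrite mavg_conj// -[X in _ * X + _](_ : herglotz (fun=> 1) z = _); last first.
    by apply: eq_mavg => t; rewrite mulr1.
  have -> : mavg (fun t => (eit t + z) / (eit t - z)) = herglotz (fun=> 1) z.
    by apply: eq_mavg => t; rewrite mulr1.
  by rewrite herglotz1// conjc1 expr0; field.
by rewrite mavg_eitX_Hkernel// mavg_eitX_conj_Hkernel// mulr0 addr0 mulrA mulVf ?mul1r//.
Qed.

End PoissonKernel.

(** * Limits of complex-valued functions along a filter *)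

Section ComplexConvergence.
Context {R : realType} {T : Type} (F : set_system T) {FF : Filter F}.
Implicit Types (f g : T -> R[i]) (z w : R[i]).
Local Notation Re := (@complex.Re R).
Local Notation Im := (@complex.Im R).

(** Componentwise, as limits and integrals of complex functions are formed in the definitions;
    [ccvg_cabsB] and [ccvg_squeeze] translate to and from the modulus. *)
Definition ccvg f z := (Re (f x) @[x --> F] --> Re z) /\ (Im (f x) @[x --> F] --> Im z).

Lemma ccvg_cst z : ccvg (fun=> z) z.
Proof. by split; exact: cvg_cst. Qed.

Lemma ccvgD f g z w : ccvg f z -> ccvg g w -> ccvg (fun x => f x + g x) (z + w).
Proof.
case=> fr fi [gr gi]; split; rewrite ?ReD ?ImD.
  by under eq_cvg do rewrite ReD; exact: cvgD.
by under eq_cvg do rewrite ImD; exact: cvgD.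
Qed.

Lemma ccvgN f z : ccvg f z -> ccvg (fun x => - f x) (- z).
Proof.
case=> fr fi; split; rewrite ?ReN ?ImN.
  by under eq_cvg do rewrite ReN; exact: cvgN.
by under eq_cvg do rewrite ImN; exact: cvgN.
Qed.

Lemma ccvgM f g z w : ccvg f z -> ccvg g w -> ccvg (fun x => f x * g x) (z * w).
Proof.
case=> fr fi [gr gi]; split; rewrite ?ReM ?ImM.
  by under eq_cvg do rewrite ReM; apply: cvgB; exact: cvgM.
by under eq_cvg do rewrite ImM; apply: cvgD; exact: cvgM.
Qed.

Lemma ccvgV f z : z != 0 -> ccvg f z -> ccvg (fun x => (f x)^-1) z^-1.
Proof.
move=> z0 [fr fi].
have n0 : Re z ^+ 2 + Im z ^+ 2 != 0 by rewrite -sqr_cabs expf_neq0// cabs_eq0.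
have cn : (Re (f x) ^+ 2 + Im (f x) ^+ 2) @[x --> F] --> Re z ^+ 2 + Im z ^+ 2.
  by apply: cvgD; apply: cvgM.
split; rewrite ?ReV ?ImV.
  by under eq_cvg do rewrite ReV; apply: cvgM => //; exact: cvgV.
under eq_cvg do rewrite ImV; apply: cvgN; apply: cvgM => //; exact: cvgV.
Qed.

Lemma ccvg_cabsB f z : ccvg f z -> cabs (f x - z) @[x --> F] --> 0.
Proof.
case=> fr fi.
have h : (`|Re (f x) - Re z| + `|Im (f x) - Im z|) @[x --> F] --> 0.
  have k (u : T -> R) (l : R) : u x @[x --> F] --> l -> `|u x - l| @[x --> F] --> 0.
    move=> ul; rewrite -(@normr0 _ R) -(subrr l); apply: cvg_norm.
    by apply: cvgB => //; exact: cvg_cst.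
  by rewrite -[X in _ --> X]addr0; apply: cvgD; exact: k.
apply: (squeeze_cvgr _ (cvg_cst 0) h); apply: nearW => x.
by rewrite cabs_ge0/= (le_trans (cabs_le_ReIm _))// !ReD !ImD !ReN !ImN.
Qed.

Lemma ccvg_squeeze f z (h : T -> R) : (\forall x \near F, cabs (f x - z) <= h x) ->
  h x @[x --> F] --> 0 -> ccvg f z.
Proof.
move=> fh h0.
have hN : (- h x) @[x --> F] --> 0 by rewrite -oppr0; exact: cvgN.
have key (p : R[i] -> R) : (forall w, `|p w| <= cabs w) ->
    (forall x, p (f x) - p z = p (f x - z)) -> p (f x) @[x --> F] --> p z.
  move=> ple pB; suff : (p (f x) - p z) @[x --> F] --> 0.
    move=> /(cvgD (cvg_cst (p z))); rewrite addr0.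
    by under eq_cvg do rewrite addrC subrK.
  apply: (squeeze_cvgr _ hN h0); apply: filterS fh => x fx.
  by rewrite pB -ler_norml (le_trans (ple _)).
split.
  by apply: key => [w|x]; [exact: Re_le_cabs|rewrite ReD ReN].
by apply: key => [w|x]; [exact: Im_le_cabs|rewrite ImD ImN].
Qed.

Lemma ccvg_cabs f z : ccvg f z -> cabs (f x) @[x --> F] --> cabs z.
Proof.
move=> /ccvg_cabsB h; suff : (cabs (f x) - cabs z) @[x --> F] --> 0.
  move=> /(cvgD (cvg_cst (cabs z))); rewrite addr0.
  by under eq_cvg do rewrite addrC subrK.
have hN : (- cabs (f x - z)) @[x --> F] --> 0 by rewrite -oppr0; exact: cvgN.
apply: (squeeze_cvgr _ hN h); apply: nearW => x.
rewrite cabs_lerB andbT lerNl opprB cabs_subC; exact: cabs_lerB.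
Qed.

End ComplexConvergence.

Section ComplexConvergenceLimits.
Context {R : realType} {T : Type} (F : set_system T) {FF : ProperFilter F}.
Implicit Types (f g : T -> R[i]) (z w : R[i]).

Lemma ccvg_unique f z w : ccvg F f z -> ccvg F f w -> z = w.
Proof.
by case=> fr fi [gr gi]; apply: complex_ext; [exact: (cvg_unique _ fr gr)|
  exact: (cvg_unique _ fi gi)].
Qed.

Lemma ccvg_cabs_le f z (M : R) : ccvg F f z ->
  (\forall x \near F, cabs (f x) <= M) -> cabs z <= M.
Proof.
move=> /ccvg_cabs h fM; rewrite -(cvg_lim _ h)//; apply: limr_le => //.
by apply: cvgP h.
Qed.

End ComplexConvergenceLimits.

(** * Parseval for polynomials and [L^2] monotonicity of dilations *)

Section CircleAnalysis.
Context {R : realType}.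
Implicit Types (F : R[i] -> R[i]) (f g : R -> R[i]) (z : R[i]) (r s : R).
Local Notation leb := (@lebesgue_measure R).
Local Notation T0 := (@T0 R).
Local Notation Re := (@complex.Re R).
Local Notation Im := (@complex.Im R).
Local Notation Tint f := (cintegrable leb T0 f).

Lemma poly_circle (p : {poly R[i]}) s (t : R) :
  p.[s%:C * eit t] = \sum_(i < size p) (p`_i * s%:C ^+ i) * eit t ^+ i.
Proof. by rewrite horner_coef; apply: eq_bigr => i _; rewrite exprMn mulrA. Qed.

Lemma cmeasurable_poly_circle (p : {poly R[i]}) s :
  cmeasurable (fun t => p.[s%:C * eit t]).
Proof.
under eq_fun do rewrite poly_circle.
apply: cmeasurable_sum => i; apply: cmeasurableM; first exact: cmeasurable_cst.
exact/cmeasurableX/cmeasurable_eit.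
Qed.

Lemma cabs_circle s (t : R) : 0 <= s -> cabs (s%:C * eit t) = s.
Proof. by move=> s0; rewrite cabsM cabsC cabs_eit mulr1 ger0_norm. Qed.

(** On the circle of radius [s] the function is a pointwise limit of polynomials, and measurability
    passes to the limit. *)
Lemma cmeasurable_polyapp r F s : polyapp r F -> 0 <= s <= r ->
  cmeasurable (fun t => F (s%:C * eit t)).
Proof.
move=> aF /andP[s0 sr].
have /choice[p pF] : forall n : nat, exists p : {poly R[i]},
    forall z, cabs z <= r -> cabs (F z - p.[z]) <= n.+1%:R^-1.
  by move=> n; apply: aF; rewrite invr_gt0.
have cv (t : R) : ccvg \oo (fun n => (p n).[s%:C * eit t]) (F (s%:C * eit t)).
  apply: (@ccvg_squeeze _ _ _ _ _ _ (@harmonic R)); last exact: cvg_harmonic.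
  by apply: nearW => n; rewrite cabs_subC; apply: pF; rewrite cabs_circle.
split; [apply: (@measurable_fun_cvg _ _ _ _ (fun n t => Re (p n).[s%:C * eit t])) |
        apply: (@measurable_fun_cvg _ _ _ _ (fun n t => Im (p n).[s%:C * eit t]))].
- by move=> n; apply: measurable_Re; exact: cmeasurable_poly_circle.
- by move=> t _; have [] := cv t.
- by move=> n; apply: measurable_Im; exact: cmeasurable_poly_circle.
- by move=> t _; have [] := cv t.
Qed.

Lemma mavg_orthogonal (i j : nat) :
  mavg (fun t : R => eit t ^+ i * conjc (eit t ^+ j)) = (i == j)%:R.
Proof.
have e (t : R) n : eit t ^+ n * conjc (eit t ^+ n) = 1.
  by rewrite mulcJ cabsX cabs_eit !expr1n.
have [ij|ij|->] := ltngtP i j.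
- rewrite -(subnK ij) -[RHS](conjc0 R) -(mavg_eitX (j - i.+1)) -mavg_conj; last first.
    exact: cintegrable_eitX.
  apply: eq_mavg => t; rewrite addnS exprS addnC exprD !conjcM.
  by rewrite exprS !conjcM mulrCA [X in _ * X]mulrA e mul1r.
- rewrite -(subnK ij) -[RHS](mavg_eitX (i - j.+1)); apply: eq_mavg => t.
  by rewrite addnS -addSn exprD -mulrA e mulr1.
- by rewrite -(mavg_cst 1); apply: eq_mavg => t; rewrite e.
Qed.

Lemma conjc_sum (I : Type) (l : seq I) (G : I -> R[i]) :
  conjc (\sum_(i <- l) G i) = \sum_(i <- l) conjc (G i).
Proof. by apply: (big_morph _ conjcD); exact: conjc0. Qed.

Lemma mavg_parseval n (a b : nat -> R[i]) :
  mavg (fun t => (\sum_(i < n) a i * eit t ^+ i) *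
                 conjc (\sum_(i < n) b i * eit t ^+ i)) =
  \sum_(i < n) a i * conjc (b i).
Proof.
have iT (i j : nat) : Tint (fun t => eit t ^+ i * conjc (eit t ^+ j)).
  apply: (@Tint_bdd _ _ 1).
    apply: cmeasurableM; first exact/cmeasurableX/cmeasurable_eit.
    exact/cmeasurable_conj/cmeasurableX/cmeasurable_eit.
  by move=> t _; rewrite cabsM cabs_conj !cabsX cabs_eit !expr1n mulr1.
rewrite (_ : mavg _ = mavg (fun t => \sum_(i < n) \sum_(j < n)
  (a i * conjc (b j)) * (eit t ^+ i * conjc (eit t ^+ j)))); last first.
  apply: eq_mavg => t; rewrite conjc_sum mulr_suml; apply: eq_bigr => i _.
  by rewrite mulr_sumr; apply: eq_bigr => j _; rewrite conjcM mulrACA.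
rewrite mavg_sum => [|i]; last first.
  by apply: (cintegrable_sum measurable_T0) => j; exact: (cintegrableZ measurable_T0).
apply: eq_bigr => i _; rewrite mavg_sum => [|j]; last exact: (cintegrableZ measurable_T0).
rewrite (bigD1 i)//= big1 ?addr0 => [|j ji].
  by rewrite mavgZ// mavg_orthogonal eqxx mulr1.
rewrite mavgZ// mavg_orthogonal; have -> : (i == j :> nat) = false; last by rewrite mulr0.
by rewrite eq_sym; exact: negbTE ji.
Qed.

Lemma Re_mavg f : Re (mavg f) = (2 * pi)^-1 * Rintegral leb T0 (fun t => Re (f t)).
Proof. by rewrite /mavg ReCM. Qed.

(** By Parseval the mean is the sum of [|p_i|^2 (r^i - s^i) s^i], with nonnegative terms only. *)
Lemma poly_dilate_mono (p : {poly R[i]}) r s : 0 <= s <= r ->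
  0 <= Re (mavg (fun t => (p.[r%:C * eit t] - p.[s%:C * eit t]) *
                          conjc p.[s%:C * eit t])).
Proof.
move=> /andP[s0 sr].
rewrite (_ : mavg _ = mavg (fun t =>
  (\sum_(i < size p) (p`_i * (r%:C ^+ i - s%:C ^+ i)) * eit t ^+ i) *
  conjc (\sum_(i < size p) (p`_i * s%:C ^+ i) * eit t ^+ i))); last first.
  apply: eq_mavg => t; rewrite !poly_circle -sumrB; congr (_ * _).
  by apply: eq_bigr => i _; rewrite mulrBr mulrBl.
rewrite (mavg_parseval (size p) (fun i => p`_i * (r%:C ^+ i - s%:C ^+ i))
  (fun i => p`_i * s%:C ^+ i)).
rewrite (_ : \sum_(i < _) _ = (\sum_(i < size p) (cabs p`_i ^+ 2 * ((r ^+ i - s ^+ i) * s ^+ i)))%:C).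
  apply: sumr_ge0 => i _; rewrite mulr_ge0 ?exprn_ge0 ?cabs_ge0// mulr_ge0//.
    by rewrite subr_ge0 lerXn2r ?nnegrE// (le_trans s0).
  exact: exprn_ge0.
rewrite rmorph_sum /=; apply: eq_bigr => i _.
have -> : (cabs p`_i ^+ 2 * ((r ^+ i - s ^+ i) * s ^+ i))%:C =
  (cabs p`_i ^+ 2)%:C * ((r ^+ i - s ^+ i) * s ^+ i)%:C by rewrite -rmorphM.
rewrite -mulcJ conjcM mulrACA; congr (_ * _).
have X (x : R) : x%:C ^+ i = (x ^+ i)%:C by rewrite rmorphXn.
by rewrite !X conjc_real -rmorphB -rmorphM.
Qed.

Lemma polyapp_dilate_mono F r s : polyapp r F -> 0 <= s <= r ->
  0 <= Re (mavg (fun t => (F (r%:C * eit t) - F (s%:C * eit t)) *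
                          conjc (F (s%:C * eit t)))).
Proof.
move=> aF sr; have [M [M0 FM]] := polyapp_bounded aF.
have /andP[s0 sr'] := sr; have r0 := le_trans s0 sr'.
have cs (t : R) : cabs (s%:C * eit t) <= r by rewrite cabs_circle.
have cr (t : R) : cabs (r%:C * eit t) <= r by rewrite cabs_circle.
apply/ler_addgt0Pl => e e0.
(* Replacing [F] by [p] changes the integrand by at most [4 M d + 2 d^2 <= d (4 M + 2)], as
   [d <= 1]; the outer 2 comes from [cabs_mavg_le]. *)
pose d := Num.min 1 (e / (2 * (4 * M + 2))).
have K0 : 0 < 2 * (4 * M + 2) by rewrite mulr_gt0// addr_gt0// mulr_gt0.
have d0 : 0 < d by rewrite lt_min ltr01 divr_gt0.
have d1 : d <= 1 by rewrite ge_min lexx.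
have de : d * (2 * (4 * M + 2)) <= e by rewrite -ler_pdivlMr// ge_min lexx orbT.
have [p pF] := aF _ d0.
have mp x : cmeasurable (fun t => p.[x%:C * eit t]) := cmeasurable_poly_circle p x.
have mFs : cmeasurable (fun t => F (s%:C * eit t)) by exact: cmeasurable_polyapp aF sr.
have mFr : cmeasurable (fun t => F (r%:C * eit t)).
  by apply: cmeasurable_polyapp aF _; rewrite r0 lexx.
pose A t := (F (r%:C * eit t) - F (s%:C * eit t)) * conjc (F (s%:C * eit t)).
pose B t := (p.[r%:C * eit t] - p.[s%:C * eit t]) * conjc p.[s%:C * eit t].
have mA : cmeasurable A.
  by apply: cmeasurableM; [exact: cmeasurableB|exact: cmeasurable_conj].
have mB : cmeasurable B.
  by apply: cmeasurableM; [exact: cmeasurableB|exact: cmeasurable_conj].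
have AB t : cabs (A t - B t) <= d * (4 * M + 2).
  rewrite /A /B; have := pF _ (cr t); have := pF _ (cs t).
  have := FM _ (cr t); have := FM _ (cs t).
  set x := F _; set y := F _; set x' := p.[_]; set y' := p.[_] => hx hy px py.
  have -> : (y - x) * conjc x - (y' - x') * conjc x' =
    ((y - y') - (x - x')) * conjc x + (y' - x') * conjc (x - x').
    by rewrite conjcD conjcN; ring.
  have h1 : cabs ((y - y') - (x - x')) <= 2 * d.
    by rewrite (le_trans (cabsB _ _))//; lra.
  have h2 : cabs (y' - x') <= 2 * M + 2 * d.
    have -> : y' - x' = y - x - ((y - y') - (x - x')) by ring.
    rewrite (le_trans (cabsB _ _))// lerD// (le_trans (cabsB _ _))//; lra.
  rewrite (le_trans (cabsD _ _))// !cabsM !cabs_conj.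
  have h3 : cabs (y - y' - (x - x')) * cabs x <= (2 * d) * M.
    by rewrite ler_pM ?cabs_ge0.
  have h4 : cabs (y' - x') * cabs (x - x') <= (2 * M + 2 * d) * d.
    by rewrite ler_pM ?cabs_ge0.
  nra.
have iA : Tint A.
  apply: (@Tint_bdd _ _ ((M + M) * M)) => // t _; rewrite cabsM cabs_conj.
  by rewrite ler_pM ?cabs_ge0 ?FM// (le_trans (cabsB _ _))// lerD// FM.
have iAB : Tint (fun t => A t - B t).
  by apply: (@Tint_bdd _ _ (d * (4 * M + 2))) => //; exact: cmeasurableB.
have iB : Tint B.
  have -> : B = (fun t => A t - (A t - B t)) by apply/funext => t; ring.
  exact: (cintegrableB measurable_T0).
have hB := poly_dilate_mono p sr.
have h := cabs_mavg_le iAB (fun t _ => AB t).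
have : Re (mavg B) - Re (mavg A) <= e.
  rewrite -ReN -ReD -opprB -mavgB// (le_trans (ler_norm _))//.
  by rewrite (le_trans (Re_le_cabs _))// cabsN (le_trans h)//; lra.
move: hB; rewrite -/(B) -/(A); lra.
Qed.

Lemma cabs_sqrB z w : cabs (z - w) ^+ 2 =
  cabs z ^+ 2 - cabs w ^+ 2 - 2 * Re ((z - w) * conjc w).
Proof. by rewrite !sqr_cabs ReM Re_conj Im_conj !ReD !ImD !ReN !ImN; ring. Qed.

(** Expanding the square by [cabs_sqrB], the cross term has the favourable sign by
    [polyapp_dilate_mono]. The [L^2] distance of two dilations is thus controlled by the increment
    of a monotone function of the radius. *)
Lemma L2_dilate_le F r s : polyapp r F -> 0 <= s <= r ->
  Rintegral leb T0 (fun t => cabs (F (r%:C * eit t) - F (s%:C * eit t)) ^+ 2) <=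
  Rintegral leb T0 (fun t => cabs (F (r%:C * eit t)) ^+ 2) -
  Rintegral leb T0 (fun t => cabs (F (s%:C * eit t)) ^+ 2).
Proof.
move=> aF sr; have := polyapp_dilate_mono aF sr; rewrite Re_mavg => h.
have [M [M0 FM]] := polyapp_bounded aF.
have /andP[s0 sr'] := sr; have r0 := le_trans s0 sr'.
have cs (t : R) : cabs (s%:C * eit t) <= r by rewrite cabs_circle.
have cr (t : R) : cabs (r%:C * eit t) <= r by rewrite cabs_circle.
have mFs : cmeasurable (fun t => F (s%:C * eit t)) by exact: cmeasurable_polyapp aF sr.
have mFr : cmeasurable (fun t => F (r%:C * eit t)).
  by apply: cmeasurable_polyapp aF _; rewrite r0 lexx.
have sqi f : cmeasurable f -> (forall t, cabs (f t) <= M) ->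
    leb.-integrable T0 (EFin \o (fun t => cabs (f t) ^+ 2)).
  move=> mf fM; apply: (@integrable_dom _ _ _ measurable_T0 _ (fun=> M ^+ 2)).
  - by apply: measurable_funX; exact: measurable_cabs.
  - move=> t _; rewrite ger0_norm ?exprn_ge0 ?cabs_ge0//.
    by rewrite lerXn2r ?nnegrE ?cabs_ge0// ltW.
  - exact: integrable_leb_cst.
have i1 := sqi _ mFr (fun t => FM _ (cr t)).
have i2 := sqi _ mFs (fun t => FM _ (cs t)).
have [i3 _] : Tint (fun t => (F (r%:C * eit t) - F (s%:C * eit t)) *
                          conjc (F (s%:C * eit t))).
  apply: (@Tint_bdd _ _ ((M + M) * M)).
    by apply: cmeasurableM; [exact: cmeasurableB|exact: cmeasurable_conj].
  move=> t _; rewrite cabsM cabs_conj.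
  by rewrite ler_pM ?cabs_ge0 ?FM// (le_trans (cabsB _ _))// lerD// FM.
under eq_Rintegral do rewrite cabs_sqrB.
rewrite RintegralB; [|exact: measurable_T0| |]; last 2 first.
- exact: (integrableRB measurable_T0).
- exact: (integrableRZ measurable_T0).
rewrite RintegralB; [|exact: measurable_T0|exact: i1|exact: i2].
rewrite RintegralZl; [|exact: measurable_T0|exact: i3].
rewrite lerBlDr lerDl mulr_ge0//.
by move: h; rewrite pmulr_rge0// invr_gt0 twopi_gt0.
Qed.

End CircleAnalysis.

(** * Boundary functions of bounded analytic functions *)

Section FatouTheorem.
Context {R : realType}.
Implicit Types (F : R[i] -> R[i]) (f g : R -> R[i]) (z : R[i]) (r s : R).
Local Notation leb := (@lebesgue_measure R).
Local Notation T0 := (@T0 R).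
Local Notation Re := (@complex.Re R).
Local Notation Im := (@complex.Im R).
Local Notation Tint f := (cintegrable leb T0 f).

Lemma ae_imp (P Q : R -> Prop) : {ae leb, forall t, P t} ->
  (forall t, P t -> Q t) -> {ae leb, forall t, Q t}.
Proof.
case=> N [mN N0 PN] PQ; exists N; split => // t /= nQ; apply: PN => /= Pt.
by apply: nQ; exact: PQ.
Qed.

Lemma ae_and (P Q : R -> Prop) : {ae leb, forall t, P t} ->
  {ae leb, forall t, Q t} -> {ae leb, forall t, P t /\ Q t}.
Proof.
case=> N [mN N0 PN] [N' [mN' N'0 QN]].
have [N2 [? ? h]] : leb.-negligible (N `|` N') by apply: negligibleU; apply/negligibleP.
exists N2; split => // t /= nPQ; apply: h; have [Pt|nPt] := pselect (P t).
  by right; apply: QN => /= Qt; exact: nPQ.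
by left; exact: PN.
Qed.

Lemma ae_all (P : R -> Prop) : (forall t, P t) -> {ae leb, forall t, P t}.
Proof. by move=> h; exists set0; split => // t /= []. Qed.

Lemma Rintegral_bounded_cvg (h : nat -> R -> R) (k : R -> R) (M : R) :
  (forall n, measurable_fun setT (h n)) -> measurable_fun setT k ->
  (forall n t, `|h n t| <= M) ->
  {ae leb, forall t, T0 t -> h ^~ t @ \oo --> k t} ->
  Rintegral leb T0 (h n) @[n --> \oo] --> Rintegral leb T0 k.
Proof.
move=> mh mk hM hk.
have mT := @measurable_T0 R.
have iM := integrable_leb_cst M.
have ae1 : {ae leb, forall t, T0 t -> (h n t)%:E @[n --> \oo] --> (k t)%:E}.
  apply: ae_imp hk _ => t ht /ht hkt; apply: cvg_EFin => //.
  by apply: nearW => n.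
have ae2 : {ae leb, forall t n, T0 t -> (`|(h n t)%:E| <= M%:E)%E}.
  by apply: ae_all => t n _; rewrite lee_fin.
have mhE n : measurable_fun T0 (fun t => (h n t)%:E).
  by apply: measurable_funTS; exact/measurable_EFinP.
have mkE : measurable_fun T0 (fun t => (k t)%:E).
  by apply: measurable_funTS; exact/measurable_EFinP.
have [ik _ cv] := dominated_convergence mT mhE mkE ae1 iM ae2.
apply: (@fine_cvg _ _ \oo _ (fun n => \int[leb]_(x in T0) (h n x)%:E)%E).
by rewrite fineK//; exact: integrable_fin_num.
Qed.

Lemma mavg_bounded_cvg (f : nat -> R -> R[i]) g (M : R) :
  (forall n, cmeasurable (f n)) -> cmeasurable g ->
  (forall n t, cabs (f n t) <= M) ->
  {ae leb, forall t, T0 t -> ccvg \oo (f ^~ t) (g t)} ->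
  ccvg \oo (fun n => mavg (f n)) (mavg g).
Proof.
move=> mf mg fM fg.
have hr : Rintegral leb T0 (fun t => Re (f n t)) @[n --> \oo] -->
    Rintegral leb T0 (fun t => Re (g t)).
  apply: (@Rintegral_bounded_cvg (fun n t => Re (f n t)) _ M).
  - by move=> n; exact: measurable_Re.
  - exact: measurable_Re.
  - by move=> n t; exact: le_trans (Re_le_cabs _) (fM n t).
  - by apply: ae_imp fg _ => t h /h[].
have hi : Rintegral leb T0 (fun t => Im (f n t)) @[n --> \oo] -->
    Rintegral leb T0 (fun t => Im (g t)).
  apply: (@Rintegral_bounded_cvg (fun n t => Im (f n t)) _ M).
  - by move=> n; exact: measurable_Im.
  - exact: measurable_Im.
  - by move=> n t; exact: le_trans (Im_le_cabs _) (fM n t).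
  - by apply: ae_imp fg _ => t h /h[].
by apply: ccvgM; [exact: ccvg_cst|split].
Qed.

(** Since the integrals of [|f_{n+1} - f_n|] are summable, the telescoping series converges
    absolutely almost everywhere. The limit is taken as a clamped [limn_sup], which makes [g]
    measurable, periodic and bounded everywhere, not only where the sequence converges. *)
Lemma fast_L2_cauchy_ae_cvg (f : nat -> R -> R[i]) (M : R) :
  (forall n, cmeasurable (f n)) -> (forall n, Defs.periodic (f n)) ->
  (forall n t, cabs (f n t) <= M) ->
  (forall n, Rintegral leb T0 (fun t => cabs (f n.+1 t - f n t) ^+ 2) <= 4^-1 ^+ n) ->
  exists g, [/\ cmeasurable g, Defs.periodic g, forall t, cabs (g t) <= 2 * M &
    {ae leb, forall t, T0 t -> ccvg \oo (f ^~ t) (g t)}].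
Proof.
move=> mf pf fM fL2.
have mT := @measurable_T0 R.
pose clamp (x : R) := Num.max (- M) (Num.min M x).
have M0 : 0 <= M := le_trans (cabs_ge0 _) (fM 0%N 0).
have clampM x : `|clamp x| <= M.
  rewrite ler_norml /clamp le_max lexx/= ge_max ge_min lexx/= andbT.
  by rewrite (le_trans _ M0)// oppr_le0.
have clampE x : `|x| <= M -> clamp x = x.
  by rewrite ler_norml => /andP[x1 x2]; rewrite /clamp min_r// max_r.
pose g t := clamp (limn_sup (fun n => Re (f n t))) +i* clamp (limn_sup (fun n => Im (f n t))).
have mclamp (h : R -> R) : measurable_fun setT h -> measurable_fun setT (fun t => clamp (h t)).
  move=> mh; apply: measurable_maxr; first exact: measurable_cst.
  by apply: measurable_minr => //; exact: measurable_cst.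
have msup (h : nat -> R -> R) : (forall n, measurable_fun setT (h n)) ->
    (forall n t, `|h n t| <= M) -> measurable_fun setT (fun t => limn_sup (h ^~ t)).
  move=> mh hM; apply: measurable_fun_limn_sup => // t _.
    exists M => _ [n _ <-]; exact: le_trans (ler_norm _) (hM n t).
  by exists (- M) => _ [n _ <-]; have := hM n t; rewrite ler_norml => /andP[].
exists g; split.
- split => /=; apply: mclamp; apply: msup => [n|n t].
  + exact: measurable_Re.
  + exact: le_trans (Re_le_cabs _) (fM n t).
  + exact: measurable_Im.
  + exact: le_trans (Im_le_cabs _) (fM n t).
- move=> t; rewrite /g; congr (clamp _ +i* clamp _); congr limn_sup;
    by apply/funext => n; rewrite pf.
- by move=> t; rewrite (le_trans (cabs_le_ReIm _))// mulr2n mulrDl mul1r lerD/=.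
pose a n t := cabs (f n.+1 t - f n t).
have ma n : measurable_fun setT (a n) by apply: measurable_cabs; exact: cmeasurableB.
have aM n t : a n t <= 2 * M.
  by rewrite (le_trans (cabsB _ _))// mulr2n mulrDl mul1r lerD.
have ia2 n : leb.-integrable T0 (EFin \o (fun t => a n t ^+ 2)).
  apply: (@integrable_dom _ _ _ mT _ (fun=> (2 * M) ^+ 2)).
  - exact: measurable_funX.
  - by move=> t _; rewrite ger0_norm ?exprn_ge0 ?cabs_ge0// lerXn2r ?nnegrE ?cabs_ge0// mulr_ge0.
  - exact: integrable_leb_cst.
have ia n : leb.-integrable T0 (EFin \o a n).
  apply: (@integrable_dom _ _ _ mT _ (fun=> 2 * M)) => //.
    by move=> t _; rewrite ger0_norm ?cabs_ge0.
  exact: integrable_leb_cst.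
have intA n : Rintegral leb T0 (a n) <= (2 * pi + 1) * 2^-1 ^+ n.
  pose q : R := 2^-1 ^+ n; have q0 : 0 < q by rewrite exprn_gt0// invr_gt0.
  (* Arithmetic-geometric mean with weight [q = 2^-n]: the squares integrate to at most [q^2], so
     the first moment is at most [2 pi q + q]. *)
  apply: (@le_trans _ _ (Rintegral leb T0 (fun t => q + q^-1 * a n t ^+ 2))).
    apply: le_Rintegral => //; first exact: ia.
      apply: integrableRD => //; first exact: integrable_leb_cst.
      exact: integrableRZ.
    move=> t _; set x := a n t.
    have : 0 <= q^-1 * (q - x) ^+ 2 by rewrite mulr_ge0 ?sqr_ge0// invr_ge0 ltW.
    have -> : q^-1 * (q - x) ^+ 2 = q + q^-1 * x ^+ 2 - 2 * x.
      by field; rewrite gt_eqF.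
    have x0 : 0 <= x := cabs_ge0 _.
    by move=> hq; rewrite -[leLHS]/x; lra.
  rewrite RintegralD//; [|exact: integrable_leb_cst|exact: integrableRZ].
  rewrite Rintegral_T0_cst RintegralZl//.
  have -> : (2 * pi + 1) * 2^-1 ^+ n = q * (2 * pi) + q by rewrite -/q; ring.
  rewrite lerD2l ler_pdivrMl// (le_trans (fL2 n))// /q -exprMn.
  by rewrite (_ : 4^-1 = 2^-1 * 2^-1)//; field.
have sumA : (\int[leb]_(t in T0) (\sum_(0 <= n <oo) (a n t)%:E) < +oo)%E.
  rewrite integral_nneseries//; last 2 first.
  - by move=> n; apply: measurable_funTS; apply/measurable_EFinP; exact: ma.
  - by move=> n t _; rewrite lee_fin cabs_ge0.
  apply: (@le_lt_trans _ _ (\sum_(0 <= n <oo) (geometric (2 * pi + 1) 2^-1 n)%:E)%E).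
    apply: lee_nneseries => n _.
      by rewrite integral_ge0// => t _; rewrite lee_fin cabs_ge0.
    rewrite -[leLHS]fineK; last by apply: integrable_fin_num => //; exact: ia.
    by rewrite lee_fin; exact: intA.
  have h := @cvg_geometric_series R (2 * pi + 1) 2^-1.
  rewrite (_ : (\sum_(0 <= n <oo) _)%E = ((2 * pi + 1) / (1 - 2^-1))%:E) ?ltry//.
  apply/cvg_lim => //.
  apply: cvg_EFin; first by apply: nearW => n; rewrite sumEFin.
  rewrite [X in X @ _ --> _](_ : _ = series (geometric (2 * pi + 1) 2^-1)).
    by apply: h; rewrite ger0_norm// invf_lt1// ltr1n.
  by apply/funext => n /=; rewrite sumEFin.
have iS : leb.-integrable T0 (fun t => \sum_(0 <= n <oo) (a n t)%:E)%E.
  apply/integrableP; split.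
    apply: measurable_funTS; apply: (@ge0_emeasurable_sum _ _ _ setT (fun n t => (a n t)%:E)) => //.
    + by move=> n t _ _; rewrite lee_fin cabs_ge0.
    + by move=> n _; apply/measurable_EFinP; exact: ma.
  apply: le_lt_trans sumA; rewrite le_eqVlt; apply/orP; left; apply/eqP.
  apply: eq_integral => t _; rewrite gee0_abs//.
  by apply: nneseries_ge0 => n _ _; rewrite lee_fin cabs_ge0.
apply: ae_imp (integrable_ae mT iS) _ => t St /St {}St.
have cva : cvgn (series (a ^~ t)).
  apply: nnseries_is_cvg => [n|]; first exact: cabs_ge0.
  by have := St; rewrite fin_numElt => /andP[].
have key (p : R[i] -> R) : (forall w, `|p w| <= cabs w) ->
    (forall z w, p (z - w) = p z - p w) -> cvgn (fun n => p (f n t)).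
  move=> ple pB; pose u : R^nat := fun n => p (f n t).
  have ct : cvgn (series (telescope u)).
    apply: normed_cvg; apply: (series_le_cvg _ _ _ cva) => n;
      [exact: normr_ge0|exact: cabs_ge0|].
    rewrite /=; have -> : telescope u n = p (f n.+1 t - f n t) by rewrite pB.
    exact: ple.
  rewrite (_ : (fun n => p (f n t)) = (fun n => u 0%N + series (telescope u) n)).
    by apply: is_cvgD => //; exact: is_cvg_cst.
  by apply/funext => n; rewrite -eq_sum_telescope.
have lim_clamp (u : R^nat) : (forall n, `|u n| <= M) -> cvgn u ->
    u @ \oo --> clamp (limn_sup u).
  move=> uM cu; rewrite cvg_limn_supE// clampE//.
  rewrite ler_norml; apply/andP; split.
    by apply: limr_ge => //; apply: nearW => n; have := uM n; rewrite ler_norml => /andP[].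
  by apply: limr_le => //; apply: nearW => n; exact: le_trans (ler_norm _) (uM n).
split => /=; apply: lim_clamp.
- by move=> n; exact: le_trans (Re_le_cabs _) (fM n t).
- by apply: key => [w|z w]; [exact: Re_le_cabs|rewrite ReD ReN].
- by move=> n; exact: le_trans (Im_le_cabs _) (fM n t).
- by apply: key => [w|z w]; [exact: Im_le_cabs|rewrite ImD ImN].
Qed.

(** Each monomial times [eit t ^+ k.+1] has a positive exponent, hence mean 0; uniform approximation
    carries this over to [F]. *)
Lemma mavg_polyapp_eitX r F (s : R) k : polyapp r F -> 0 <= s <= r ->
  mavg (fun t => F (s%:C * eit t) * eit t ^+ k.+1) = 0.
Proof.
move=> aF sr; have /andP[s0 sr'] := sr; have [M [M0 FM]] := polyapp_bounded aF.
have cs (t : R) : cabs (s%:C * eit t) <= r by rewrite cabs_circle.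
apply/eqP; rewrite -cabs_eq0 eq_le cabs_ge0 andbT.
apply/ler_addgt0Pl => /= e e0; rewrite addr0.
have [p pF] := aF (e / 2) (divr_gt0 e0 (ltr0n _ 2)).
have mF : cmeasurable (fun t => F (s%:C * eit t)) by exact: cmeasurable_polyapp aF sr.
have mp := cmeasurable_poly_circle p s.
have mE : cmeasurable (fun t : R => eit t ^+ k.+1) by exact/cmeasurableX/cmeasurable_eit.
have iF : Tint (fun t => F (s%:C * eit t) * eit t ^+ k.+1).
  apply: (@Tint_bdd _ _ M); first exact: cmeasurableM.
  by move=> t _; rewrite cabsM cabsX cabs_eit expr1n mulr1 FM.
have iFp : Tint (fun t => (F (s%:C * eit t) - p.[s%:C * eit t]) * eit t ^+ k.+1).
  apply: (@Tint_bdd _ _ (e / 2)); first by apply: cmeasurableM => //; exact: cmeasurableB.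
  by move=> t _; rewrite cabsM cabsX cabs_eit expr1n mulr1 pF.
have ip : Tint (fun t => p.[s%:C * eit t] * eit t ^+ k.+1).
  have := cintegrableB measurable_T0 iF iFp.
  by under eq_fun do rewrite -mulrBl opprB addrC subrK.
have p0 : mavg (fun t => p.[s%:C * eit t] * eit t ^+ k.+1) = 0.
  under eq_mavg do rewrite poly_circle mulr_suml.
  have iT (i : 'I_(size p)) : Tint (fun t : R => eit t ^+ i * eit t ^+ k.+1).
    by under eq_fun do rewrite -exprD; exact: cintegrable_eitX.
  rewrite (_ : mavg _ = mavg (fun t => \sum_(i < size p) (p`_i * s%:C ^+ i) *
    (eit t ^+ i * eit t ^+ k.+1))); last first.
    by apply: eq_mavg => t; apply: eq_bigr => i _; rewrite mulrA.
  rewrite mavg_sum => [|i]; last exact: (cintegrableZ measurable_T0).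
  apply: big1 => i _; rewrite mavgZ//; under eq_mavg do rewrite -exprD addnS.
  by rewrite mavg_eitX mulr0.
rewrite -[mavg _]subr0 -p0 -mavgB//; under eq_mavg do rewrite -mulrBl.
rewrite (le_trans (cabs_mavg_le iFp (M := e / 2) _))//; last by lra.
by move=> t _; rewrite cabsM cabsX cabs_eit expr1n mulr1 pF.
Qed.

Lemma poisson_ext_polyapp r F (s : R) z : polyapp r F -> 0 <= s <= r -> cabs z < 1 ->
  poisson_ext (fun t => F (s%:C * eit t)) z = F (s%:C * z).
Proof.
move=> aF sr z1; have /andP[s0 sr'] := sr; have [M [M0 FM]] := polyapp_bounded aF.
have cs (t : R) : cabs (s%:C * eit t) <= r by rewrite cabs_circle.
have csz : cabs (s%:C * z) <= r.
  rewrite cabsM cabsC ger0_norm// (le_trans _ sr')// ler_piMr// ltW//.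
pose K := 2 / (1 - cabs z); have K0 : 0 < K by rewrite divr_gt0// subr_gt0.
pose P (t : R) : R[i] := ((1 - cabs z ^+ 2) / cabs (eit t - z) ^+ 2)%:C.
have PK t : cabs (P t) <= K by rewrite cabsC ger0_norm ?Poisson_ge0// Poisson_le.
have mP : cmeasurable P := cmeasurable_Poisson z.
apply/eqP; rewrite -subr_eq0 -cabs_eq0 eq_le cabs_ge0 andbT.
apply/ler_addgt0Pl => /= e e0; rewrite addr0.
(* Error budget: the kernel bound [K], doubled by [cabs_mavg_le], plus the error at the point [s z]
   itself. *)
have d0 : 0 < e / (2 * K + 1) by rewrite divr_gt0// addr_gt0// mulr_gt0.
have [p pF] := aF _ d0.
have mF : cmeasurable (fun t => F (s%:C * eit t)) by exact: cmeasurable_polyapp aF sr.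
have mp := cmeasurable_poly_circle p s.
have iF : Tint (fun t => F (s%:C * eit t) * P t).
  apply: (@Tint_bdd _ _ (M * K)); first exact: cmeasurableM.
  by move=> t _; rewrite cabsM ler_pM ?cabs_ge0 ?FM.
have bFp t : cabs ((F (s%:C * eit t) - p.[s%:C * eit t]) * P t) <= e / (2 * K + 1) * K.
  by rewrite cabsM ler_pM ?cabs_ge0 ?pF.
have iFp : Tint (fun t => (F (s%:C * eit t) - p.[s%:C * eit t]) * P t).
  apply: (@Tint_bdd _ _ (e / (2 * K + 1) * K)) => //.
  by apply: cmeasurableM => //; exact: cmeasurableB.
have ip : Tint (fun t => p.[s%:C * eit t] * P t).
  have := cintegrableB measurable_T0 iF iFp.
  by under eq_fun do rewrite -mulrBl opprB addrC subrK.
have p0 : mavg (fun t => p.[s%:C * eit t] * P t) = p.[s%:C * z].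
  have iT (i : 'I_(size p)) : Tint (fun t : R => eit t ^+ i * P t).
    apply: (@Tint_bdd _ _ K).
      by apply: cmeasurableM => //; exact/cmeasurableX/cmeasurable_eit.
    by move=> t _; rewrite cabsM cabsX cabs_eit expr1n mul1r.
  rewrite (_ : mavg _ = mavg (fun t => \sum_(i < size p) (p`_i * s%:C ^+ i) *
    (eit t ^+ i * P t))); last first.
    apply: eq_mavg => t; rewrite poly_circle mulr_suml.
    by apply: eq_bigr => i _; rewrite mulrA.
  rewrite mavg_sum => [|i]; last exact: (cintegrableZ measurable_T0).
  rewrite horner_coef; apply: eq_bigr => i _; rewrite mavgZ//.
  by rewrite [mavg _](poisson_ext_eitX i z1) exprMn mulrA.
have -> : poisson_ext (fun t => F (s%:C * eit t)) z - F (s%:C * z) =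
    mavg (fun t => (F (s%:C * eit t) - p.[s%:C * eit t]) * P t) -
    (F (s%:C * z) - p.[s%:C * z]).
  under [in RHS]eq_mavg do rewrite mulrBl.
  by rewrite mavgB// p0 /poisson_ext -/P; ring.
rewrite (le_trans (cabsB _ _))//.
have h1 := cabs_mavg_le iFp (fun t _ => bFp t).
have h2 := pF _ csz.
have h3 : 2 * (e / (2 * K + 1) * K) + e / (2 * K + 1) = e.
  by field; rewrite gt_eqF// addr_gt0// mulr_gt0.
by rewrite -h3 lerD.
Qed.

Lemma norm_inf_le f (M : R) : {ae leb, forall t, T0 t -> cabs (f t) <= M} ->
  (norm_inf f <= M%:E)%E.
Proof.
move=> fM; apply: ereal_inf_lbound => /=.
by apply: ae_imp fM _ => t ht /ht; rewrite lee_fin.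
Qed.

Lemma fourier_neg f k : fourier f (Negz k) = mavg (fun t => f t * eit t ^+ k.+1).
Proof.
apply: eq_mavg => t; rewrite -eitMn NegzE; congr (_ * eit _).
by rewrite mulrNz mulNr opprK.
Qed.

(** The mean squares [N r] increase and are bounded, so along radii where [N] approaches its
    supremum geometrically the dilations are fast Cauchy in [L^2]; their almost everywhere limit is
    the boundary function. The bound [2 * M] instead of [M] comes from treating real and imaginary
    parts separately. *)
Theorem fatou F (M : R) : (forall r, 0 <= r < 1 -> polyapp r F) ->
  (forall z, cabs z < 1 -> cabs (F z) <= M) ->
  exists e, [/\ Hinf e, forall t, cabs (e t) <= 2 * M &
    forall z, cabs z < 1 -> poisson_ext e z = F z].
Proof.
move=> aF FM; have mT := @measurable_T0 R.
pose N r := Rintegral leb T0 (fun t => cabs (F (r%:C * eit t)) ^+ 2).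
have c1 r (t : R) : 0 <= r < 1 -> cabs (r%:C * eit t) < 1.
  by move=> /andP[r0 r1]; rewrite cabs_circle.
have M0 : 0 <= M by apply: le_trans (FM 0 _); rewrite ?cabs_ge0// cabs0.
have mFr r : 0 <= r < 1 -> cmeasurable (fun t => F (r%:C * eit t)).
  by move=> r01; apply: (cmeasurable_polyapp (aF _ r01)); case/andP: r01 => -> _ /=.
have NM r : 0 <= r < 1 -> N r <= M ^+ 2 * (2 * pi).
  move=> r01; rewrite -Rintegral_T0_cst; apply: le_Rintegral => //.
  - apply: (@integrable_dom _ _ _ mT _ (fun=> M ^+ 2)).
    + by apply: measurable_funX; apply: measurable_cabs; exact: mFr.
    + by move=> t _; rewrite ger0_norm ?exprn_ge0 ?cabs_ge0// lerXn2r ?nnegrE ?cabs_ge0// FM// c1.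
    + exact: integrable_leb_cst.
  - exact: integrable_leb_cst.
  - by move=> t _; rewrite lerXn2r ?nnegrE ?cabs_ge0// FM// c1.
have Nd r s : 0 <= s <= r -> r < 1 ->
    Rintegral leb T0 (fun t => cabs (F (r%:C * eit t) - F (s%:C * eit t)) ^+ 2) <= N r - N s.
  move=> sr r1; apply: L2_dilate_le => //; apply: aF.
  by rewrite r1 andbT; case/andP: sr; exact: le_trans.
have Nmono r s : 0 <= s <= r -> r < 1 -> N s <= N r.
  move=> sr r1; rewrite -subr_ge0; apply: le_trans (Nd _ _ sr r1).
  by apply: Rintegral_ge0 => t _; rewrite sqr_ge0.
pose S := [set N r | r in `[0, 1[].
have supS : has_sup S.
  split; first by exists (N 0); exists 0 => //=; rewrite in_itv/= lexx ltr01.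
  exists (M ^+ 2 * (2 * pi)); apply/ubP => x [r /=].
  by rewrite in_itv/= => r01 <-; exact: NM.
pose L := sup S.
have NL r : 0 <= r < 1 -> N r <= L.
  by move=> r01; apply: sup_upper_bound => //; exists r => //=; rewrite in_itv.
have /choice[rn rnP] : forall n : nat, exists r, [/\ 0 <= r < 1, 1 - r <= n.+1%:R^-1 &
    L - N r <= 4^-1 ^+ n].
  move=> n; have e0 : 0 < 4^-1 ^+ n :> R by rewrite exprn_gt0// invr_gt0.
  have [x [r /= rr <-] rL] := sup_adherent e0 supS.
  move: rr; rewrite in_itv/= => /andP[r0 r1].
  (* The maximum with [q] drives the radii to 1; monotonicity of [N] keeps the distance to the
     supremum small. *)
  pose q : R := 1 - n.+1%:R^-1.
  have q1 : q < 1 by rewrite gtrBl invr_gt0.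
  have rq : 0 <= Num.max r q < 1 by rewrite le_max r0/= gt_max r1.
  exists (Num.max r q); split => //.
    by rewrite lerBlDr -lerBlDl le_max lexx orbT.
  have : N r <= N (Num.max r q) by apply: Nmono; [rewrite r0 le_max lexx|case/andP: rq].
  by move: rL; rewrite -/L; lra.
pose f n t := F ((rn n)%:C * eit t).
have r01 n : 0 <= rn n < 1 by have [] := rnP n.
have fM n t : cabs (f n t) <= M by apply: FM; exact: c1.
have mf n : cmeasurable (f n) by exact: mFr.
have pf n : Defs.periodic (f n) by move=> t; rewrite /f eit2pi.
have fL2 n : Rintegral leb T0 (fun t => cabs (f n.+1 t - f n t) ^+ 2) <= 4^-1 ^+ n.
  have [_ _ h1] := rnP n; have [_ _ h2] := rnP n.+1.
  have h3 := NL _ (r01 n); have h4 := NL _ (r01 n.+1).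
  have h5 : 4^-1 ^+ n.+1 <= 4^-1 ^+ n :> R.
    by rewrite exprS ler_piMl ?exprn_ge0 ?invr_ge0// invf_le1// ler1n.
  (* The chosen radii need not increase, so both orders are treated. *)
  have [rr|rr] := leP (rn n) (rn n.+1).
    apply: le_trans (Nd _ _ _ _) _; last by lra.
      by rewrite rr andbT; have /andP[] := r01 n.
    by have /andP[] := r01 n.+1.
  under eq_Rintegral do rewrite cabs_subC.
  apply: le_trans (Nd _ _ _ _) _; last by lra.
    by rewrite (ltW rr) andbT; have /andP[] := r01 n.+1.
  by have /andP[] := r01 n.
have [e [me pe eM ae_e]] := fast_L2_cauchy_ae_cvg mf pf fM fL2.
exists e; split => //.
- split => //.
    apply: le_lt_trans (ltry (2 * M)); apply: norm_inf_le.
    by apply: ae_all => t _; exact: eM.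
  case=> // k _; rewrite fourier_neg.
  have h : ccvg \oo (fun n => mavg (fun t => f n t * eit t ^+ k.+1))
      (mavg (fun t => e t * eit t ^+ k.+1)).
    have mE : cmeasurable (fun t : R => eit t ^+ k.+1) by exact/cmeasurableX/cmeasurable_eit.
    apply: (@mavg_bounded_cvg _ _ M).
    + by move=> n; exact: cmeasurableM.
    + exact: cmeasurableM.
    + by move=> n t; rewrite cabsM cabsX cabs_eit expr1n mulr1.
    + by apply: ae_imp ae_e _ => t ht /ht h; apply: ccvgM => //; exact: ccvg_cst.
  apply/esym/(ccvg_unique _ h).
  rewrite (_ : (fun n => _) = (fun=> 0)); first exact: ccvg_cst.
  apply/funext => n; apply: mavg_polyapp_eitX (aF _ (r01 n)) _.
  by rewrite lexx andbT; have /andP[] := r01 n.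
- move=> z z1.
  pose P (t : R) : R[i] := ((1 - cabs z ^+ 2) / cabs (eit t - z) ^+ 2)%:C.
  have mP : cmeasurable P := cmeasurable_Poisson z.
  have h : ccvg \oo (fun n => poisson_ext (f n) z) (poisson_ext e z).
    apply: (@mavg_bounded_cvg (fun n t => f n t * P t) _ (M * (2 / (1 - cabs z)))).
    + by move=> n; exact: cmeasurableM.
    + exact: cmeasurableM.
    + move=> n t; rewrite cabsM ler_pM ?cabs_ge0// cabsC ger0_norm ?Poisson_ge0//.
      exact: Poisson_le.
    + by apply: ae_imp ae_e _ => t ht /ht h; apply: ccvgM => //; exact: ccvg_cst.
  (* The Poisson extensions of the dilations also converge to [F z], by continuity of [F] inside the
     disc. *)
  apply: (ccvg_unique h).
  have fz n : poisson_ext (f n) z = F ((rn n)%:C * z).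
    apply: poisson_ext_polyapp (aF _ (r01 n)) _ z1.
    by rewrite lexx andbT; have /andP[] := r01 n.
  rewrite (_ : (fun n => _) = (fun n => F ((rn n)%:C * z))); last exact/funext.
  have z01 : 0 <= cabs z < 1 by rewrite cabs_ge0.
  suff : cabs (F ((rn n)%:C * z) - F z) @[n --> \oo] --> 0.
    by apply: ccvg_squeeze; apply: nearW.
  apply/cvgrPdist_lt => eps eps0.
  have [d [d0 hd]] := polyapp_continuous (aF _ z01) (lexx _) eps0.
  have := @cvg_harmonic R => /cvgrPdist_lt /(_ _ d0); apply: filterS => n.
  rewrite sub0r normrN ger0_norm; last exact: harmonic_ge0.
  rewrite sub0r normrN ger0_norm ?cabs_ge0// => hn.
  have /andP[rn0 rn1] := r01 n; have [_ hr _] := rnP n.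
  apply: hd.
    by rewrite cabsM cabsC ger0_norm// ler_piMl ?cabs_ge0// ltW.
  have -> : (rn n)%:C * z - z = - ((1 - rn n)%:C * z) by rewrite rmorphB /=; ring.
  rewrite cabsN cabsM cabsC ger0_norm ?subr_ge0 ?(ltW rn1)//.
  apply: le_lt_trans hn; apply: le_trans hr.
  by rewrite ler_piMr ?subr_ge0 ?ltW.
Qed.

End FatouTheorem.

(** * Lebesgue points and Poisson-type averages *)

Section LebesguePoints.
Context {R : realType}.
Local Notation leb := (@lebesgue_measure R).
Local Notation T0 := (@T0 R).
Local Notation mR := (measurableTypeR R).

Lemma lebesgue_pt_average (f : R -> R) (x : R) : lebesgue_pt f x ->
  forall e : R, 0 < e -> exists d : R, 0 < d /\ forall h : R, 0 < h < d ->
    (\int[leb]_(y in ball x h) (`|f y - f x|)%:E <= (e * (2 * h))%:E)%E.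
Proof.
move=> fx e e0.
have := fx; rewrite /lebesgue_pt => /fine_cvgP[ffin /cvgrPdist_lt /(_ _ e0) fe].
have [d /= d0 hd] : \forall r \near (0 : R)^'+, davg f x r \is a fin_num /\
    `|0 - (fine \o davg f x) r| < e.
  by near=> r; split; near: r.
exists d; split => // h /andP[h0 hhd].
have [] := hd h; [by rewrite /ball/= sub0r normrN gtr0_norm|by []|].
rewrite sub0r normrN /= /davg /iavg /=.
rewrite lebesgue_measure_ball//; last exact: ltW.
set I := integral _ _ _ => Ifin.
have I0 : (0 <= I)%E by apply: integral_ge0 => y _; rewrite lee_fin.
have h2 : (h *+ 2)%R != 0 by rewrite mulrn_eq0/= gt_eqF.
move: Ifin; rewrite inver (negbTE h2).
case: I I0 => [I| |] //= I0.
  rewrite -EFinM /= => _.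
  rewrite ger0_norm; last by rewrite mulr_ge0// invr_ge0 mulrn_wge0// ltW.
  rewrite mulrC ltr_pdivrMr ?mulrn_wgt0// => /ltW.
  by rewrite lee_fin mulr_natl.
by rewrite gt0_muley ?lte_fin ?invr_gt0 ?mulrn_wgt0.
Unshelve. all: by end_near. Qed.

(** Lebesgue differentiation is applied to [v] extended by 0 off [T0], which is locally integrable;
    on balls intersected with [T0] the extension agrees with [v]. *)
Lemma lebesgue_pt_T0 (v : R -> R) : measurable_fun setT v ->
  leb.-integrable T0 (EFin \o v) ->
  {ae leb, forall x, T0 x -> forall e : R, 0 < e -> exists d : R, 0 < d /\
    forall h : R, 0 < h < d ->
    (\int[leb]_(y in T0 `&` ball x h) (`|v y - v x|)%:E <= (e * (2 * h))%:E)%E}.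
Proof.
move=> mv iv.
have := lebesgue_differentiation (integrable_locally measurable_T0 iv).
move=> /ae_imp; apply => x fx Tx e e0.
have [d [d0 hd]] := lebesgue_pt_average fx e0.
have mf : measurable_fun setT (v \_ T0).
  by apply/(measurable_restrictT _ measurable_T0); exact: measurable_funTS.
exists d; split => // h hh; apply: le_trans (hd _ hh).
have -> : (\int[leb]_(y in T0 `&` ball x h) (`|v y - v x|)%:E =
  \int[leb]_(y in T0 `&` ball x h) (`|(v \_ T0) y - (v \_ T0) x|)%:E)%E.
  by apply: eq_integral => y; rewrite inE => -[Ty _]; rewrite /patch !mem_set.
apply: ge0_subset_integral.
- by apply: measurableI; [exact: measurable_T0|exact: measurable_ball].
- exact: measurable_ball.
- apply/measurable_EFinP; apply: measurable_funTS.
  by apply: measurableT_comp => //; apply: measurable_funB => //; exact: measurable_cst.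
- by move=> y _; rewrite lee_fin.
- by move=> y [].
Qed.

(* Dyadic decomposition: on [2^n d <= |s - x| < 2^(n+1) d] the kernel is at most
   [(4^n d)^-1], so the averages contribute a geometric series. *)
Lemma kernel_dyadic (g : R -> R) (x e eta d : R) n : measurable_fun setT g ->
  (forall s, 0 <= g s) -> 0 < d -> 0 <= e ->
  (forall h : R, 0 < h < eta ->
    (\int[leb]_(y in T0 `&` ball x h) (g y)%:E <= (e * (2 * h))%:E)%E) ->
  2 ^+ n * d < eta ->
  (\int[leb]_(y in T0 `&` ball x (2 ^+ n * d)%R) (g y * (d / (d ^+ 2 + (y - x) ^+ 2)))%:E
    <= (e * (10 - 8 / 2 ^+ n))%:E)%E.
Proof.
move=> mg g0 d0 e0 gh.
have mK : measurable_fun setT (fun y : R => d / (d ^+ 2 + (y - x) ^+ 2)).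
  apply: measurable_funM; first exact: measurable_cst.
  apply: measurable_funV_ge0 => [|y]; last by rewrite addr_ge0 ?sqr_ge0.
  apply: measurable_funD; first exact: measurable_cst.
  by apply: measurable_funX; apply: measurable_funB => //; exact: measurable_cst.
have den y : 0 < d ^+ 2 + (y - x) ^+ 2 by rewrite ltr_pwDl ?sqr_ge0// exprn_gt0.
have K0 y : 0 <= d / (d ^+ 2 + (y - x) ^+ 2) by rewrite divr_ge0 ?(ltW (den _))// ltW.
have mJ h : measurable (T0 `&` ball x h : set mR).
  by apply: measurableI; [exact: measurable_T0|exact: measurable_ball].
have mE (k : R -> R) (D : set mR) : measurable_fun setT k -> measurable_fun D (fun y => (k y)%:E).
  by move=> mk; apply/measurable_EFinP; exact: measurable_funTS.
have mgK : measurable_fun setT (fun y => g y * (d / (d ^+ 2 + (y - x) ^+ 2))).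
  exact: measurable_funM.
elim: n => [|n IH].
  rewrite expr0 mul1r divr1 => de.
  apply: (@le_trans _ _ (\int[leb]_(y in T0 `&` ball x d) (d^-1%:E * (g y)%:E))%E).
    apply: ge0_le_integral => //.
    + by move=> y _; rewrite lee_fin mulr_ge0.
    + exact: mE.
    + by under eq_fun do rewrite -EFinM; apply: mE; apply: measurable_funM => //; exact: measurable_cst.
    move=> y _; rewrite -EFinM lee_fin mulrC ler_wpM2r//.
    rewrite ler_pdivrMr// mulrC -ler_pdivrMr ?invr_gt0// invrK -expr2.
    by rewrite lerDl sqr_ge0.
  rewrite ge0_integralZl//; [|exact: mE|by move=> y _; rewrite lee_fin|by rewrite lee_fin invr_ge0 ltW].
  apply: (@le_trans _ _ (d^-1%:E * (e * (2 * d))%:E)%E).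
    by apply: lee_wpmul2l; [rewrite lee_fin invr_ge0 ltW|apply: gh; rewrite d0].
  rewrite -EFinM lee_fin; have -> : d^-1 * (e * (2 * d)) = e * 2.
    by field; rewrite gt_eqF.
  by rewrite ler_wpM2l//; lra.
move=> hn; set h := 2 ^+ n * d in IH *.
have hE : 2 ^+ n.+1 * d = 2 * h by rewrite /h exprS mulrA.
rewrite hE in hn *.
have h0 : 0 < h by rewrite mulr_gt0// exprn_gt0.
have hh : h < eta by lra.
have {}IH := IH hh.
pose D2 := (T0 `&` ball x (2 * h)) `\` (T0 `&` ball x h).
have mD2 : measurable (D2 : set mR) by exact: measurableD.
have sub : T0 `&` ball x h `<=` T0 `&` ball x (2 * h).
  by move=> y [Ty hy]; split => //; apply: le_ball hy; lra.
rewrite -(setDUK sub) ge0_integral_setU//; last 3 first.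
- exact: mE.
- by move=> y _; rewrite lee_fin mulr_ge0.
- by apply/disj_setPS => y [h1 [_ h2]].
(* The new ring contributes [(d / h^2) e (4 h) = 4 e / 2^n], the increment of [10 - 8 / 2^n] in
   units of [e]; the start [10 - 8 = 2] comes from the kernel bound [1 / d] on the ball of radius
   [d]. *)
have -> : e * (10 - 8 / 2 ^+ n.+1) = e * (10 - 8 / 2 ^+ n) + e * (4 / 2 ^+ n).
  by rewrite exprS; field; rewrite expf_neq0.
rewrite EFinD; apply: leeD => //.
apply: (@le_trans _ _ (\int[leb]_(y in D2) ((d / h ^+ 2)%:E * (g y)%:E))%E).
  apply: ge0_le_integral => //.
  + by move=> y _; rewrite lee_fin mulr_ge0.
  + exact: mE.
  + by under eq_fun do rewrite -EFinM; apply: mE; apply: measurable_funM => //; exact: measurable_cst.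
  move=> y [[Ty _] nh]; rewrite -EFinM lee_fin mulrC ler_wpM2r//.
  rewrite ler_wpM2l ?(ltW d0)// lef_pV2 ?posrE ?exprn_gt0//.
  have hy : h <= `|y - x|.
    by rewrite leNgt; apply/negP => yh; apply: nh; split => //; rewrite /ball/= distrC.
  have : h ^+ 2 <= `|y - x| ^+ 2 by rewrite ler_pXn2r ?nnegrE// ltW.
  by rewrite real_normK ?num_real// => /le_trans; apply; rewrite lerDr sqr_ge0.
have c0 : 0 <= d / h ^+ 2 by rewrite divr_ge0 ?sqr_ge0// ltW.
rewrite ge0_integralZl//; [|exact: mE|by move=> y _; rewrite lee_fin].
apply: (@le_trans _ _ ((d / h ^+ 2)%:E * (e * (2 * (2 * h)))%:E)%E).
  apply: lee_wpmul2l; first by rewrite lee_fin.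
  apply: le_trans (gh (2 * h) _); last by rewrite hn mulr_gt0.
  apply: ge0_subset_integral => //; [exact: mE|by move=> y _; rewrite lee_fin|exact: subDsetl].
rewrite -EFinM lee_fin le_eqVlt; apply/orP; left; apply/eqP.
by rewrite /h; field; rewrite expf_neq0// gt_eqF.
Qed.

(** Up to a fixed scale [eta] the dyadic bound gives at most [10 * e / 20]; beyond it the kernel is
    [O(d / eta^2)] and multiplies the total integral [G], so a small [d] makes the rest at most
    [e / 2]. *)
Lemma kernel_small (g : R -> R) (x : R) : measurable_fun setT g ->
  (forall s, 0 <= g s) -> leb.-integrable T0 (EFin \o g) ->
  (forall e : R, 0 < e -> exists d : R, 0 < d /\ forall h : R, 0 < h < d ->
    (\int[leb]_(y in T0 `&` ball x h) (g y)%:E <= (e * (2 * h))%:E)%E) ->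
  forall e : R, 0 < e -> exists d0 : R, 0 < d0 /\ forall d : R, 0 < d < d0 ->
    Rintegral leb T0 (fun y => g y * (d / (d ^+ 2 + (y - x) ^+ 2))) <= e.
Proof.
move=> mg g0 ig gh e e0.
have e20 : 0 < e / 20 by rewrite divr_gt0.
have [eta [eta0 heta]] := gh _ e20.
pose G := Rintegral leb T0 g.
have G0 : 0 <= G by apply: Rintegral_ge0.
have A0 : 0 < e * eta ^+ 2 / (8 * (G + 1)).
  by rewrite divr_gt0 ?mulr_gt0 ?exprn_gt0// ltr_wpDl.
exists (Num.min eta (e * eta ^+ 2 / (8 * (G + 1)))); split; first by rewrite lt_min eta0.
move=> d /andP[d0]; rewrite lt_min => /andP[deta dA].
(* The least such index puts the radius [2^m d] between [eta / 2] and [eta]: small enough for the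
   averages, large enough for the outer bound. *)
have exn : exists n, eta <= 2 ^+ n.+1 * d.
  pose N := Num.truncn (eta / d); exists N.
  rewrite -ler_pdivrMr// (le_trans (ltW (truncnS_gt _)))//.
  by rewrite -natrX ler_nat ltnW// ltn_expl.
have [m etam mmin] := ex_minnP exn.
have hm : 2 ^+ m * d < eta.
  case: m etam mmin => [|m] etam mmin; first by rewrite expr0 mul1r.
  by rewrite ltNge; apply/negP => /mmin; rewrite ltnn.
have den y : 0 < d ^+ 2 + (y - x) ^+ 2 by rewrite ltr_pwDl ?sqr_ge0// exprn_gt0.
have K0 y : 0 <= d / (d ^+ 2 + (y - x) ^+ 2) by rewrite divr_ge0 ?(ltW (den _))// ltW.
have mK : measurable_fun setT (fun y : R => d / (d ^+ 2 + (y - x) ^+ 2)).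
  apply: measurable_funM; first exact: measurable_cst.
  apply: measurable_funV_ge0 => [|y]; last by rewrite addr_ge0 ?sqr_ge0.
  apply: measurable_funD; first exact: measurable_cst.
  by apply: measurable_funX; apply: measurable_funB => //; exact: measurable_cst.
have mgK : measurable_fun setT (fun y => g y * (d / (d ^+ 2 + (y - x) ^+ 2))).
  exact: measurable_funM.
have mE (k : R -> R) (D : set mR) : measurable_fun setT k -> measurable_fun D (fun y => (k y)%:E).
  by move=> mk; apply/measurable_EFinP; exact: measurable_funTS.
have mT := @measurable_T0 R.
set h := 2 ^+ m * d in hm.
have h0 : 0 < h by rewrite mulr_gt0// exprn_gt0.
have etah : eta <= 2 * h by rewrite /h mulrA -exprS.
have mJ : measurable (T0 `&` ball x h : set mR).
  by apply: measurableI => //; exact: measurable_ball.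
have sub : T0 `&` ball x h `<=` T0 by exact: subIsetl.
rewrite -lee_fin /Rintegral fineK; last first.
  apply: integrable_fin_num => //.
  apply: (@integrable_dom _ _ _ mT _ (fun y => d^-1 * g y)) => //.
    move=> y _; rewrite ger0_norm; last by rewrite mulr_ge0.
    rewrite mulrC ler_wpM2r//.
    rewrite ler_pdivrMr// mulrC -ler_pdivrMr ?invr_gt0// invrK -expr2.
    by rewrite lerDl sqr_ge0.
  exact: integrableRZ.
rewrite -(setDUK sub) ge0_integral_setU//; last 4 first.
- exact: measurableD.
- exact: mE.
- by move=> y _; rewrite lee_fin mulr_ge0.
- by apply/disj_setPS => y [h1 [_ h2]].
rewrite [X in (_ <= X%:E)%E]splitr EFinD; apply: leeD.
  apply: le_trans (kernel_dyadic mg g0 d0 (ltW e20) heta hm) _.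
  rewrite lee_fin.
  have : 0 <= 8 / 2 ^+ m :> R by rewrite divr_ge0// exprn_ge0.
  by move=> ?; nra.
apply: (@le_trans _ _ (\int[leb]_(y in T0) ((4 * d / eta ^+ 2)%:E * (g y)%:E))%E).
  apply: (@le_trans _ _ (\int[leb]_(y in T0 `\` (T0 `&` ball x h)) ((4 * d / eta ^+ 2)%:E * (g y)%:E))%E).
    apply: ge0_le_integral => //.
    + exact: measurableD.
    + by move=> y _; rewrite lee_fin mulr_ge0.
    + exact: mE.
    + by under eq_fun do rewrite -EFinM; apply: mE; apply: measurable_funM => //; exact: measurable_cst.
    move=> y [Ty nh]; rewrite -EFinM lee_fin mulrC ler_wpM2r//.
    have hy : h <= `|y - x|.
      by rewrite leNgt; apply/negP => yh; apply: nh; split => //; rewrite /ball/= distrC.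
    have : h ^+ 2 <= `|y - x| ^+ 2 by rewrite ler_pXn2r ?nnegrE// ltW.
    rewrite real_normK ?num_real// => hy2.
    have eta2 : eta ^+ 2 <= 4 * h ^+ 2.
      have -> : 4 * h ^+ 2 = (2 * h) ^+ 2 by ring.
      by rewrite ler_pXn2r ?nnegrE ?mulr_ge0// ltW.
    rewrite ler_pdivrMr// mulrAC ler_pdivlMr ?exprn_gt0// [4 * d]mulrC -mulrA.
    rewrite ler_wpM2l ?(ltW d0)// (le_trans eta2)//.
    by have := sqr_ge0 d; lra.
  apply: ge0_subset_integral => //; first exact: measurableD.
  + by under eq_fun do rewrite -EFinM; apply: mE; apply: measurable_funM => //; exact: measurable_cst.
  + by move=> y _; rewrite -EFinM lee_fin mulr_ge0// divr_ge0 ?sqr_ge0// mulr_ge0// ltW.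
have c0 : 0 <= 4 * d / eta ^+ 2 by rewrite divr_ge0 ?sqr_ge0// mulr_ge0// ltW.
rewrite ge0_integralZl//; [|exact: mE|by move=> y _; rewrite lee_fin].
rewrite -[X in (_ * X <= _)%E]fineK; last exact: integrable_fin_num.
rewrite -EFinM lee_fin -/G.
rewrite mulrAC ler_pdivrMr ?exprn_gt0//.
have G1 : 0 < 8 * (G + 1) by rewrite mulr_gt0// ltr_wpDl.
move: dA; rewrite ltr_pdivlMr// => dA.
apply: (@le_trans _ _ (d * (8 * (G + 1)) / 2)); last by move: dA; lra.
by rewrite -[fine _]/G; lra.
Qed.

End LebesguePoints.

(** * Truncated conjugate integrals against the Herglotz kernel *)

Section PrincipalValue.
Context {R : realType}.
Implicit Types (v : R -> R) (x y s t c d : R).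
Local Notation leb := (@lebesgue_measure R).
Local Notation T0 := (@T0 R).
Local Notation mR := (measurableTypeR R).

Lemma sin_lower_small x : `|x| <= 2^-1 -> `|x| / 2 <= `|sin x|.
Proof.
move=> x1; have := @sin_taylor1 R x; rewrite (le_trans x1) => [/(_ isT) h|]; last by lra.
have h1 : `|x| - `|sin x| <= x ^+ 2.
  by apply: le_trans h; rewrite distrC; exact: lerB_dist.
have h2 : x ^+ 2 <= `|x| / 2.
  rewrite -(real_normK (num_real x)) expr2 ler_wpM2l//.
lra.
Qed.

Lemma norm_sin x : `|x| <= pi -> `|sin x| = sin `|x|.
Proof.
move=> xpi; have h : 0 <= sin `|x| by rewrite sin_ge0_pi// normr_ge0.
have [x0|x0] := leP 0 x; first by rewrite ger0_norm//; move: h; rewrite ger0_norm.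
by move: h; rewrite ltr0_norm// sinN => h; rewrite ler0_norm// -oppr_ge0.
Qed.

(** Near 0 the linear lower bound is explicit; on the remaining compact interval, kept away from
    [pi], the sine has a positive minimum. *)
Lemma sin_lower x : 0 < x < pi ->
  exists c, 0 < c /\ forall y, `|y| <= x -> c * `|y| <= `|sin y|.
Proof.
move=> /andP[x0 xpi]; pose X := Num.max x 2^-1.
have X1 : 2^-1 <= X by rewrite le_max lexx orbT.
have Xpi : X < pi by rewrite gt_max xpi (lt_le_trans _ (pi_ge2 R))//; lra.
have [m] := @EVT_min R sin 2^-1 X X1 (continuous_subspaceT (@continuous_sin R)).
rewrite in_itv/= => /andP[m1 m2] mmin.
have sm : 0 < sin m by rewrite sin_gt0_pi// (lt_le_trans _ m1)//= (le_lt_trans m2).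
have smp : 0 < sin m / pi by rewrite divr_gt0// pi_gt0.
exists (Num.min 2^-1 (sin m / pi)); split; first by rewrite lt_min smp andbT.
move=> y yx; have [y1|y1] := leP `|y| 2^-1.
  apply: le_trans (sin_lower_small y1); rewrite [leRHS]mulrC ler_wpM2r//.
  by rewrite ge_min lexx.
have yX : `|y| <= X by rewrite le_max yx.
have ypi : `|y| <= pi by rewrite (le_trans yX)// ltW.
rewrite norm_sin//; apply: le_trans (mmin `|y| _); last by rewrite in_itv/= yX ltW.
apply: (@le_trans _ _ (sin m / pi * `|y|)); first by rewrite ler_wpM2r// ge_min lexx orbT.
by rewrite mulrAC ler_pdivrMr ?pi_gt0// ler_wpM2l// ltW.
Qed.

Lemma cabs_eitBE s t : cabs (eit s - eit t) = 2 * `|sin ((s - t) / 2)|.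
Proof.
apply/eqP; rewrite -(@eqrXn2 _ 2)// ?cabs_ge0 ?mulr_ge0// cabs_eitB exprMn.
by rewrite real_normK ?num_real// -natrX.
Qed.

Lemma cabs_eitB_cos s t : cabs (eit s - eit t) ^+ 2 = 2 * (1 - cos (t - s)).
Proof.
rewrite sqr_cabs !ReD !ImD !ReN !ImN /= cosB.
have := cos2Dsin2 s; have := cos2Dsin2 t; set a := cos t; set b := sin t.
set p := cos s; set q := sin s => ab pq.
have -> : (p - a) ^+ 2 + (q - b) ^+ 2 =
  (p ^+ 2 + q ^+ 2) + (a ^+ 2 + b ^+ 2) - 2 * (a * p + b * q) by ring.
by rewrite ab pq; ring.
Qed.

(** The endpoints are excluded because [T0] is cut there: for [t = 0], an [s] close to [2 * pi] is
    near on the circle but far in angle. *)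
Lemma eit_lower t : 0 < t < 2 * pi ->
  exists c, 0 < c <= 1 /\ forall s, T0 s -> c * `|s - t| <= cabs (eit s - eit t).
Proof.
(* [X] bounds half of every [|s - t|], and it is below [pi] because [t] is interior. *)
move=> /andP[t0 t2]; pose X := Num.max t (2 * pi - t) / 2.
have Xpi : 0 < X < pi.
  apply/andP; split; first by rewrite divr_gt0// lt_max t0.
  by rewrite ltr_pdivrMr// gt_max; apply/andP; split; lra.
have [c [c0 hc]] := sin_lower Xpi.
exists (Num.min c 1); split; first by rewrite lt_min c0 ltr01 ge_min lexx orbT.
move=> s; rewrite /T0/= in_itv/= => /andP[s0 s2]; rewrite cabs_eitBE.
have hX : `|(s - t) / 2| <= X.
  rewrite normrM [`|2^-1|]gtr0_norm ?invr_gt0// ler_wpM2r ?invr_ge0//.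
  rewrite le_max ler_norml; have [st|st] := leP t s.
    by apply/orP; right; rewrite ger0_norm ?subr_ge0//; lra.
  by apply/orP; left; apply/andP; split; lra.
have := hc _ hX; rewrite normrM [`|2^-1|]gtr0_norm ?invr_gt0// => h.
apply: (@le_trans _ _ (c * `|s - t|)); last by lra.
by rewrite ler_wpM2r// ge_min lexx.
Qed.

Definition cotk t s : R := cos ((t - s) / 2) / sin ((t - s) / 2).

(** For [0 <= d <= pi], the angles at circular distance at least [d] from [t]; the cosine makes the
    set periodic without reducing angles. *)
Definition far t d : set R := [set s | cos (t - s) <= cos d].

Definition pvT v t d : R :=
  Rintegral leb (T0 `&` far t d) (fun s => v s * cotk t s).

(** The truncated integral of [conj_fun] without the factor [(2 pi)^-1]; [pvT] is its form over the
    fundamental domain, where it can be compared with Herglotz integrals. *)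
Definition pvint v t d : R := Rintegral leb [set s : R | d <= `|s| <= pi]
  (fun s => v (t - s) * (cos (s / 2) / sin (s / 2))).

Lemma measurable_cos_comp (h : R -> R) : measurable_fun setT h ->
  measurable_fun setT (fun x => cos (h x)).
Proof.
move=> mh; apply: (@measurableT_comp _ _ _ _ _ _ (@cos R)) => //.
by apply: continuous_measurable_fun; exact: continuous_cos.
Qed.

Lemma measurable_sin_comp (h : R -> R) : measurable_fun setT h ->
  measurable_fun setT (fun x => sin (h x)).
Proof.
move=> mh; apply: (@measurableT_comp _ _ _ _ _ _ (@sin R)) => //.
by apply: continuous_measurable_fun; exact: continuous_sin.
Qed.

Lemma measurable_funVT (h : R -> R) : measurable_fun setT h ->
  measurable_fun setT (fun x => (h x)^-1).
Proof.
move=> mh; have e x : (h x)^-1 = h x * (h x ^+ 2)^-1.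
  have [->|h0] := eqVneq (h x) 0; first by rewrite invr0 mul0r.
  by field.
under eq_fun do rewrite e; apply: measurable_funM => //.
apply: measurable_funV_ge0; last by move=> x; exact: sqr_ge0.
exact: measurable_funX.
Qed.

Lemma measurable_halfB t : measurable_fun setT (fun s : R => (t - s) / 2).
Proof.
apply: measurable_funM; last exact: measurable_cst.
by apply: measurable_funB => //; exact: measurable_cst.
Qed.

Lemma measurable_cotk t : measurable_fun setT (cotk t).
Proof.
apply: measurable_funM; first by apply: measurable_cos_comp; exact: measurable_halfB.
by apply: measurable_funVT; apply: measurable_sin_comp; exact: measurable_halfB.
Qed.

Lemma measurable_far t d : measurable (far t d : set mR).
Proof.
have m : measurable_fun setT (fun s : mR => cos (t - s)).
  by apply: measurable_cos_comp; apply: measurable_funB => //; exact: measurable_cst.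
have -> : far t d = setT `&` (fun s : mR => cos (t - s)) @^-1` `]-oo, (cos d)].
  by rewrite setTI; apply/seteqP; split => s /=; rewrite in_itv.
exact: m.
Qed.

Lemma cos_le_cos d s : 0 <= d <= pi -> `|s| <= pi -> (cos s <= cos d) = (d <= `|s|).
Proof.
move=> d0 spi; rewrite -(cos_norm s).
by rewrite leNgt ltr_cos ?in_itv/= ?normr_ge0//= -leNgt.
Qed.

Lemma periodic_cotk t : Defs.periodic (cotk t).
Proof.
move=> s; rewrite /cotk.
have -> : (t - (s + 2 * pi)) / 2 = (t - s) / 2 - pi by field.
rewrite -[in RHS](subrK pi ((t - s) / 2)) sinDpi cosDpi mulNr invrN mulrN opprK.
by [].
Qed.

Lemma far_2pi t d s : far t d (s + 2 * pi) = far t d s.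
Proof.
rewrite /far /=; congr (_ <= _); have -> : t - s = t - (s + 2 * pi) + pi *+ 2.
  by rewrite mulr2n; ring.
by rewrite cosD2pi.
Qed.

(** The integrand cut to [far t d] is [2 pi]-periodic, so the window [T0] may be moved to one
    centred at [t] and then reflected. *)
Lemma pvintE v t d : Defs.periodic v -> measurable_fun setT v ->
  0 < t < 2 * pi -> 0 < d <= pi ->
  pvint v t d = pvT v t d.
Proof.
move=> pv mv /andP[t0 t2] /andP[d0 dpi].
pose W := (fun s => v s * cotk t s) \_ (far t d).
have mvc : measurable_fun setT (fun s => v s * cotk t s).
  by apply: measurable_funM => //; exact: measurable_cotk.
have mW : measurable_fun setT W.
  by apply/(measurable_restrictT _ (measurable_far t d)); exact: measurable_funTS.
have pW : Defs.periodic W.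
  move=> s; rewrite /W /patch; have -> : (s + 2 * pi \in far t d) = (s \in far t d).
    by apply/idP/idP; rewrite !inE far_2pi.
  by rewrite pv periodic_cotk.
rewrite /pvT Rintegral_mkcondr -/W -(@Rintegral_period _ W (t - pi))//; last first.
  by apply/andP; split; lra.
have -> : t - pi + 2 * pi = t + pi by ring.
transitivity (Rintegral leb `[(t - pi), (t + pi)] W); last first.
  rewrite /Rintegral integral_itv_bndo_bndc//.
  by apply/measurable_EFinP; exact: measurable_funTS.
rewrite [RHS](Rintegral_reflect t)// /pvint.
have -> : [set s : R | d <= `|s| <= pi] = `[- pi, pi] `&` [set s | cos s <= cos d].
  apply/seteqP; split => s /=; rewrite in_itv/=.
    move=> /andP[ds spi]; rewrite -ler_norml; split => //.
    by rewrite cos_le_cos// ltW.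
  by move=> []; rewrite -ler_norml => spi; rewrite cos_le_cos// ?spi ?andbT// ltW.
have -> : [set s | [set` `[(t - pi), (t + pi)]] (t - s)] = `[- pi, pi]%classic.
  by apply/seteqP; split => s /=; rewrite !in_itv/= => /andP[h1 h2]; apply/andP; split; lra.
rewrite Rintegral_mkcondr; apply: eq_Rintegral => s _.
rewrite /W /patch /cotk; have -> : t - (t - s) = s by ring.
by have -> : (t - s \in far t d) = (s \in [set s | cos s <= cos d]);
  [apply/idP/idP; rewrite !inE /far /=; have -> : t - (t - s) = s by ring|].
Qed.

(** The cotangent is odd and the domain symmetric; the cut at [d] keeps it bounded, so the integral
    is finite and equals its own opposite. *)
Lemma pvint_cst1 t d : 0 < d <= pi -> pvint (fun=> 1) t d = 0.
Proof.
move=> /andP[d0 dpi]; rewrite /pvint.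
set A := [set s : R | _]; under eq_Rintegral do rewrite mul1r.
pose q s : R := cos (s / 2) / sin (s / 2).
have mA : measurable (A : set mR).
  have -> : A = `[- pi, pi] `&` [set s | d <= `|s|].
    apply/seteqP; split => s /=; rewrite in_itv/= -ler_norml; first by case/andP.
    by case=> h1 h2; rewrite /A /= h1 h2.
  apply: measurableI => //; rewrite -[X in measurable X]setTI.
  have -> : [set s : R | d <= `|s|] = (fun s : R => `|s|) @^-1` `[d, +oo[.
    by apply/seteqP; split => s /=; rewrite in_itv/= andbT.
  by apply: (@normr_measurable R setT).
have mh : measurable_fun setT (fun s : R => s / 2).
  by apply: measurable_funM => //; exact: measurable_cst.
have mq : measurable_fun setT q.
  apply: measurable_funM; first exact: measurable_cos_comp.
  by apply: measurable_funVT; exact: measurable_sin_comp.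
have [c [c0 hc]] := @sin_lower (pi / 2) ltac:(by have := @pi_gt0 R; lra).
have iq : leb.-integrable A (EFin \o q).
  apply: measurable_bounded_integrable => //.
  - apply: (@le_lt_trans _ _ (leb `[- pi, pi])); last first.
      by rewrite lebesgue_measure_itv/= lte_fin; case: ifP => _; rewrite ?ltry// -EFinD ltry.
    apply: le_measure; rewrite ?inE// => s; rewrite /A/= in_itv/= -ler_norml.
    by case/andP.
  - exact: measurable_funTS.
  - exists (2 / (c * d)); split; first exact: num_real.
    move=> x xlt s /andP[ds spi]; apply: ltW; apply: le_lt_trans xlt.
    rewrite normrM normfV.
    have hs : `|s / 2| <= pi / 2 by rewrite normrM [`|2^-1|]gtr0_norm ?invr_gt0// ler_wpM2r.
    have := hc _ hs; rewrite normrM [`|2^-1|]gtr0_norm ?invr_gt0// => h.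
    have h0 : c * d / 2 <= `|sin (s / 2)|.
      by apply: le_trans h; rewrite mulrA ler_wpM2r// ler_wpM2l// ltW.
    have cd : 0 < c * d / 2 by rewrite divr_gt0// mulr_gt0.
    rewrite -[leRHS]mul1r ler_pM ?invr_ge0//; first exact: cos_max.
    have -> : 2 / (c * d) = (c * d / 2)^-1 by rewrite invf_div.
    by rewrite lef_pV2 ?posrE// (lt_le_trans cd).
have := @Rintegral_reflect R 0 A q mA mq.
have -> : [set s | A (0 - s)] = A by apply/seteqP; split => s; rewrite /A/= sub0r normrN.
have -> : (fun s => q (0 - s)) = (fun s => (-1) * q s).
  apply/funext => s; rewrite /q; have -> : (0 - s) / 2 = - (s / 2) by ring.
  by rewrite cosN sinN invrN mulrN mulN1r.
rewrite RintegralZl// mulN1r => h.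
by apply/eqP; rewrite -[X in X == _]/(Rintegral leb A q); lra.
Qed.

(** Dividing by the midpoint [eit (s + y)] turns sum and difference into [2 cos y] and
    [- 2 i sin y]. *)
Lemma Hkernel_boundary t s : eit s != eit t ->
  (eit s + eit t) / (eit s - eit t) = 'i * (cotk t s)%:C.
Proof.
move=> st; pose y := (t - s) / 2.
have ty : t = (s + y) + y by rewrite /y; field.
have sn : sin y != 0.
  apply: contraNneq st => h; rewrite -subr_eq0 -cabs_eq0 cabs_eitBE.
  have -> : (s - t) / 2 = - y by rewrite /y; ring.
  by rewrite sinN h oppr0 normr0 mulr0.
have st' : eit s - eit t != 0 by rewrite subr_eq0.
apply: (canLR (mulfK st')).
rewrite /cotk -/y {st st'}.
have -> : eit s = eit (s + y) * eit (- y) by rewrite -eitD addrK.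
have -> : eit t = eit (s + y) * eit y by rewrite -eitD -ty.
rewrite -mulrDr -mulrBr mulrCA; congr (_ * _).
apply: complex_ext; rewrite ?(ReM, ImM, ReD, ImD, ReN, ImN) /= cosN sinN; field; exact: sn.
Qed.

(** The difference is [2 e^{is} (z - e^{it})] over the product of both denominators, and pulling the
    point inward shortens its distance to [e^{is}] by at most a factor 2. *)
Lemma Hkernel_diff t d s : 0 < d < 1 -> eit s != eit t ->
  cabs ((eit s + (1 - d)%:C * eit t) / (eit s - (1 - d)%:C * eit t) -
        (eit s + eit t) / (eit s - eit t)) <= 4 * d / cabs (eit s - eit t) ^+ 2.
Proof.
move=> /andP[d0 d1] st; set z := (1 - d)%:C * eit t.
have zc : cabs z = 1 - d by rewrite cabs_circle// subr_ge0 ltW.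
have z1 : cabs z < 1 by rewrite zc; lra.
have h1 := eitB_neq0 s z1.
have h2 : eit s - eit t != 0 by rewrite subr_eq0.
have -> : (eit s + z) / (eit s - z) - (eit s + eit t) / (eit s - eit t) =
  2 * eit s * (z - eit t) / ((eit s - z) * (eit s - eit t)).
  by field; rewrite h1 h2.
have -> : z - eit t = - (d%:C * eit t) by rewrite /z rmorphB /=; ring.
have two : cabs (2 : R[i]) = 2.
  by rewrite -[2]/(2%:R) -(rmorph_nat (real_complex R)) cabsC ger0_norm.
rewrite cabsM cabsV !cabsM cabsN cabsM !cabs_eit two cabsC (gtr0_norm d0) !mulr1.
have D0 : 0 < cabs (eit s - eit t) by rewrite cabs_gt0.
have hz : d <= cabs (eit s - z) by apply: le_trans (cabs_eitB_ge s z); rewrite zc; lra.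
have hD : cabs (eit s - eit t) <= 2 * cabs (eit s - z).
  rewrite (le_trans (cabs_triangle z _ _))// mulr2n mulrDl mul1r lerD2l.
  apply: le_trans hz; have -> : z - eit t = - (d%:C * eit t) by rewrite /z rmorphB /=; ring.
  by rewrite cabsN cabsM cabsC cabs_eit mulr1 gtr0_norm.
set D := cabs (eit s - eit t) in D0 hD *; set E := cabs (eit s - z) in hz hD *.
have E0 : 0 < E := lt_le_trans d0 hz.
rewrite invfM mulrA ler_pdivrMr// mulrAC expr2 invfM !mulrA divfK ?gt_eqF//.
rewrite mulrAC ler_pdivrMr// mulrAC ler_pdivlMr//; nra.
Qed.

(** The truncation [d] equals the distance of the point to the circle. Off the arc the two kernels
    differ by [O(d / D^2)] with [D] the chord; on the arc nothing is subtracted and the kernel is at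
    most [2 / d]. Both fit under one multiple of a Poisson-type kernel. *)
Lemma kernel_bound t : 0 < t < 2 * pi -> exists C, 0 < C /\
  forall d s, 0 < d < 1 -> T0 s ->
    cabs ((eit s + (1 - d)%:C * eit t) / (eit s - (1 - d)%:C * eit t) -
          (if s \in far t d then 'i * (cotk t s)%:C else 0)) <=
    C * (d / (d ^+ 2 + (s - t) ^+ 2)).
Proof.
move=> t02; have [c [/andP[c0 c1] hc]] := eit_lower t02.
have c2 : 0 < c ^+ 2 by rewrite exprn_gt0.
exists (32 / c ^+ 2); split; first by rewrite divr_gt0.
move=> d s d01 Ts; have /andP[d0 d1] := d01.
set x := s - t; set D := cabs (eit s - eit t).
have hD : c ^+ 2 * x ^+ 2 <= D ^+ 2.
  have : (c * `|x|) ^+ 2 <= D ^+ 2 by rewrite lerXn2r ?nnegrE ?cabs_ge0 ?mulr_ge0 ?(ltW c0)// hc.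
  by rewrite exprMn real_normK ?num_real.
have DE : D ^+ 2 = 2 * (1 - cos (t - s)) by exact: cabs_eitB_cos.
have dx : 0 < d ^+ 2 + x ^+ 2 by rewrite ltr_pwDl ?sqr_ge0// exprn_gt0.
have c21 : c ^+ 2 <= 1 by rewrite expr_le1// ltW.
have x0 := sqr_ge0 x.
have -> : 32 / c ^+ 2 * (d / (d ^+ 2 + x ^+ 2)) = 32 * d / (c ^+ 2 * (d ^+ 2 + x ^+ 2)).
  by field; rewrite !gt_eqF.
have den : 0 < c ^+ 2 * (d ^+ 2 + x ^+ 2) by rewrite mulr_gt0.
case: ifPn => [|/negP nf].
  rewrite inE /far /= => sfar.
  have sd : d / 2 / 2 <= `|sin (d / 2)|.
    rewrite -[X in X / 2](@ger0_norm _ (d / 2)); last by rewrite divr_ge0// ltW.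
    apply: sin_lower_small; rewrite ger0_norm; last by rewrite divr_ge0// ltW.
    by lra.
  have D4 : d ^+ 2 / 4 <= D ^+ 2.
    have e1 : 2 * (1 - cos d) = 4 * sin (d / 2) ^+ 2.
      have {1}-> : d = (d / 2) *+ 2 by rewrite mulr2n -splitr.
      by rewrite cos_mulr2n cos2sin2; ring.
    have e2 : (d / 2 / 2) ^+ 2 <= sin (d / 2) ^+ 2.
      rewrite -(real_normK (num_real (sin _))) lerXn2r ?nnegrE//.
      by rewrite !divr_ge0// ltW.
    rewrite DE; apply: (@le_trans _ _ (2 * (1 - cos d))); last by lra.
    by rewrite e1; move: e2; rewrite !exprMn; lra.
  have D0 : 0 < D ^+ 2 by apply: lt_le_trans D4; rewrite divr_gt0// exprn_gt0.
  have st : eit s != eit t.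
    by apply: contraTneq D0 => st; rewrite /D st subrr cabs0 expr0n/= ltxx.
  rewrite -Hkernel_boundary// (le_trans (Hkernel_diff d01 st))// -/D.
  rewrite ler_pdivrMr// mulrAC ler_pdivlMr//.
  (* This uses [c^2 x^2 <= D^2], [c <= 1] and [d^2 <= 4 D^2]; the factor 8 times the 4 of
     [Hkernel_diff] gives the 32. *)
  have : c ^+ 2 * (d ^+ 2 + x ^+ 2) <= 8 * D ^+ 2 by nra.
  by nra.
have sfar : cos d < cos (t - s).
  by rewrite ltNge; apply/negP => h; apply: nf; rewrite inE.
rewrite subr0.
have zc : cabs ((1 - d)%:C * eit t) = 1 - d by rewrite cabs_circle// subr_ge0 ltW.
have z1 : cabs ((1 - d)%:C * eit t) < 1 by rewrite zc; lra.
rewrite (le_trans (cabs_Hkernel s z1))// zc.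
have -> : 1 - (1 - d) = d by ring.
have /andP[_ cd] := cos_taylor1 d.
have D1 : D ^+ 2 <= d ^+ 2 by rewrite DE; lra.
rewrite ler_pdivrMr// mulrAC ler_pdivlMr//.
nra.
Qed.

End PrincipalValue.

(** * Radial limits of Herglotz integrals and Poisson extensions *)

Section RadialLimits.
Context {R : realType}.
Implicit Types (v : R -> R) (x y s t c d : R).
Local Notation leb := (@lebesgue_measure R).
Local Notation T0 := (@T0 R).
Local Notation mR := (measurableTypeR R).
Local Notation Re := (@complex.Re R).
Local Notation Im := (@complex.Im R).
Local Notation Tint f := (cintegrable leb T0 f).

Lemma ae_T0_interior : {ae leb, forall t, T0 t -> 0 < t < 2 * pi}.
Proof.
exists [set 0]; split => //=; first exact: lebesgue_measure_set1.
move=> t /= h; apply: contrapT => t0; apply: h; rewrite /T0 /= in_itv/= => /andP[h1 ->].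
by rewrite andbT lt_neqAle h1 andbT eq_sym; apply/eqP.
Qed.

Lemma near_right_lt (e : R) : 0 < e -> \forall d \near (0 : R)^'+, 0 < d < e.
Proof.
by move=> e0; near=> d; apply/andP; split; near: d;
  [exact: nbhs_right_gt|exact: nbhs_right_lt].
Unshelve. all: by end_near. Qed.

Definition hdiff t d s : R[i] :=
  (eit s + (1 - d)%:C * eit t) / (eit s - (1 - d)%:C * eit t) -
  (if s \in far t d then 'i * (cotk t s)%:C else 0).

Lemma mavg_hdiff v t d : measurable_fun setT v ->
  leb.-integrable T0 (EFin \o v) -> 0 < t < 2 * pi -> 0 < d < 1 ->
  cintegrable leb T0 (fun s => hdiff t d s * (v s)%:C) /\
  mavg (fun s => hdiff t d s * (v s)%:C) =
  herglotz v ((1 - d)%:C * eit t) - 'i * ((2 * pi)^-1 * pvT v t d)%:C.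
Proof.
move=> mv iv t02 d01; have /andP[d0 d1] := d01.
have mT := @measurable_T0 R.
have zc : cabs ((1 - d)%:C * eit t) = 1 - d by rewrite cabs_circle// subr_ge0 ltW.
have z1 : cabs ((1 - d)%:C * eit t) < 1 by rewrite zc; lra.
have [C [C0 hC]] := kernel_bound t02.
pose B s : R[i] := if s \in far t d then 'i * (cotk t s)%:C else 0.
have mpc : measurable_fun setT (cotk t \_ (far t d)).
  by apply/(measurable_restrictT _ (measurable_far t d)); apply: measurable_funTS; exact: measurable_cotk.
have BE s : B s = 'i * ((cotk t \_ (far t d)) s)%:C.
  by rewrite /B /patch; case: ifPn => // _; rewrite mulr0.
have mB : cmeasurable B.
  rewrite (_ : B = (fun s => 'i * ((cotk t \_ (far t d)) s)%:C)); last exact/funext.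
  by apply: cmeasurableM; [exact: cmeasurable_cst|exact: cmeasurableC].
have mK := cmeasurable_Hkernel ((1 - d)%:C * eit t).
have mh : cmeasurable (hdiff t d) by exact: cmeasurableB.
have hb s : T0 s -> cabs (hdiff t d s) <= C / d.
  move=> Ts; apply: le_trans (hC _ _ d01 Ts) _; rewrite ler_wpM2l ?(ltW C0)//.
  have dd : 0 < d ^+ 2 + (s - t) ^+ 2 by rewrite ltr_pwDl ?sqr_ge0// exprn_gt0.
  rewrite ler_pdivrMr// mulrC -ler_pdivrMr ?invr_gt0// invrK -expr2.
  by rewrite lerDl sqr_ge0.
have ih : cintegrable leb T0 (fun s => hdiff t d s * (v s)%:C).
  by apply: (@cintegrable_bddM _ _ _ _ (C / d)) => //; rewrite divr_ge0 ?ltW.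
have iK := cintegrable_Hkernel z1 mv iv.
have iB : cintegrable leb T0 (fun s => B s * (v s)%:C).
  have := cintegrableB mT iK ih.
  rewrite (_ : (fun s => _) = (fun s => B s * (v s)%:C))//.
  by apply/funext => s; rewrite /hdiff -/(B s); ring.
split => //.
under eq_mavg do rewrite /hdiff mulrBl.
rewrite mavgB// -/(herglotz _ _); congr (_ - _).
have e1 : Rintegral leb T0 (fun s => Re (B s * (v s)%:C)) = 0.
  rewrite (_ : (fun s => _) = (fun=> 0)); first by rewrite Rintegral_T0_cst mul0r.
  by apply/funext => s; rewrite BE ReMC ReM /=; ring.
have e2 : Rintegral leb T0 (fun s => Im (B s * (v s)%:C)) =
    Rintegral leb (T0 `&` far t d) (fun s => v s * cotk t s).
  rewrite Rintegral_mkcondr; apply: eq_Rintegral => s _.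
  transitivity (v s * (cotk t \_ (far t d)) s); first by rewrite BE ImMC ImM /=; ring.
  by rewrite /patch; case: ifPn => // _; rewrite mulr0.
rewrite /mavg /cint e1 e2 /pvT.
by apply: complex_ext; rewrite ?ReM ?ImM ?ReCM ?ImCM /=; ring.
Qed.

(** At a Lebesgue point the constant [v t] contributes exactly itself, as the Herglotz integral of 1
    is 1 and the truncated integral of a constant is 0; the remainder [v - v t] is absorbed by
    [kernel_small]. The real part yields the Poisson limit, the imaginary part ties the harmonic
    conjugate to the truncated integrals. *)
Theorem herglotz_radial v : measurable_fun setT v ->
  leb.-integrable T0 (EFin \o v) ->
  {ae leb, forall t, T0 t -> ccvg (0 : R)^'+
    (fun d => herglotz v ((1 - d)%:C * eit t) - 'i * ((2 * pi)^-1 * pvT v t d)%:C)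
    (v t)%:C}.
Proof.
move=> mv iv; have mT := @measurable_T0 R.
apply: ae_imp (ae_and ae_T0_interior (lebesgue_pt_T0 mv iv)) _ => t [h1 h2] Tt.
have t02 := h1 Tt; have {h1}h2 := h2 Tt.
have [C [C0 hC]] := kernel_bound t02.
pose g s := `|v s - v t|.
have mg : measurable_fun setT g.
  by apply: measurableT_comp => //; apply: measurable_funB => //; exact: measurable_cst.
have ig : leb.-integrable T0 (EFin \o g).
  exact: (integrable_norm (integrableRB mT iv (integrable_leb_cst (v t)))).
have ks := kernel_small mg (fun s => normr_ge0 _) ig h2.
apply: (@ccvg_squeeze _ _ _ _ _ _ (fun d => cabs (mavg (fun s => hdiff t d s * (v s - v t)%:C)))).
  near=> d.
  have d01 : 0 < d < 1 by near: d; exact: near_right_lt.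
  have [i1 e1] := mavg_hdiff mv iv t02 d01.
  have m1 : measurable_fun setT (fun _ : R => 1 : R) by exact: measurable_cst.
  have [i2 e2] := @mavg_hdiff (fun=> 1) t d m1 (integrable_leb_cst 1) t02 d01.
  have /andP[d0 d1] := d01.
  have z1 : cabs ((1 - d)%:C * eit t) < 1 by rewrite cabs_circle ?subr_ge0 ?ltW//; lra.
  have dpi : 0 < d <= pi by rewrite d0/= (le_trans (ltW d1))// (le_trans _ (pi_ge2 R))// ler1n.
  rewrite -e1 (_ : (v t)%:C = mavg (fun s => (v t)%:C * (hdiff t d s * 1%:C))).
    rewrite -mavgB//; last exact: (cintegrableZ mT).
    rewrite (_ : (fun s => _ - _) = (fun s => hdiff t d s * (v s - v t)%:C))//.
    by apply/funext => s; rewrite rmorphB /=; ring.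
  by rewrite mavgZ// e2 herglotz1// -pvintE// pvint_cst1// mulr0 mulr0 subr0 mulr1.
apply/cvgrPdist_le => /= e e0.
have K0 : 0 < 2 * pi / (2 * C) * e by rewrite mulr_gt0// divr_gt0 ?twopi_gt0// mulr_gt0.
near=> d.
have d01 : 0 < d < 1 by near: d; exact: near_right_lt.
rewrite sub0r normrN ger0_norm ?cabs_ge0//.
have mw : measurable_fun setT (fun s => v s - v t).
  by apply: measurable_funB => //; exact: measurable_cst.
have iw : leb.-integrable T0 (EFin \o (fun s => v s - v t)).
  by apply: integrableRB => //; exact: integrable_leb_cst.
have [iwh _] := @mavg_hdiff (fun s => v s - v t) t d mw iw t02 d01.
have /andP[d0 d1] := d01.
have den s : 0 < d ^+ 2 + (s - t) ^+ 2 by rewrite ltr_pwDl ?sqr_ge0// exprn_gt0.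
have igk : leb.-integrable T0 (EFin \o (fun s => g s * (d / (d ^+ 2 + (s - t) ^+ 2)))).
  apply: (@integrable_dom _ _ _ mT _ (fun s => d^-1 * g s)).
  - apply: measurable_funM => //.
    apply: measurable_funM; first exact: measurable_cst.
    apply: measurable_funV_ge0 => [|s]; last by rewrite ltW// den.
    apply: measurable_funD; first exact: measurable_cst.
    by apply: measurable_funX; apply: measurable_funB => //; exact: measurable_cst.
  - move=> s _; rewrite ger0_norm; last first.
      by apply: mulr_ge0; [exact: normr_ge0|rewrite divr_ge0 ?(ltW d0)// ltW].
    rewrite mulrC; apply: ler_wpM2r; first exact: normr_ge0.
    rewrite ler_pdivrMr// mulrC -ler_pdivrMr ?invr_gt0// invrK -expr2.
    by rewrite lerDl sqr_ge0.
  - exact: integrableRZ.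
have bound : cabs (cint leb T0 (fun s => hdiff t d s * (v s - v t)%:C)) <=
    2 * (C * Rintegral leb T0 (fun s => g s * (d / (d ^+ 2 + (s - t) ^+ 2)))).
  rewrite -RintegralZl//; apply: (cabs_cint_le mT) => //; first exact: integrableRZ.
  move=> s Ts; rewrite cabsM cabsC mulrCA mulrC ler_wpM2l//.
  exact: hC.
have small : Rintegral leb T0 (fun s => g s * (d / (d ^+ 2 + (s - t) ^+ 2))) <= 2 * pi / (2 * C) * e.
  near: d; have [d0' [d0'0 hd0']] := ks _ K0.
  by apply: filterS (near_right_lt d0'0) => x /hd0'.
rewrite /mavg cabsM cabsC ger0_norm ?twopiV_ge0// ler_pdivrMl ?twopi_gt0//.
apply: (le_trans bound).
apply: (@le_trans _ _ (2 * (C * (2 * pi / (2 * C) * e)))).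
  by rewrite ler_wpM2l// ler_wpM2l// ltW.
by rewrite le_eqVlt; apply/orP; left; apply/eqP; field; rewrite gt_eqF.
Unshelve. all: by end_near. Qed.

Lemma poisson_radial v : measurable_fun setT v ->
  leb.-integrable T0 (EFin \o v) ->
  {ae leb, forall t, T0 t -> Re (herglotz v ((1 - d)%:C * eit t)) @[d --> 0^'+] --> v t}.
Proof.
move=> mv iv; apply: ae_imp (herglotz_radial mv iv) _ => t h /h[hr _].
apply: cvg_trans hr; apply: near_eq_cvg; apply: nearW => d.
have iC x : Re ('i * x%:C) = 0 by rewrite ReM /= mul0r mulr0 subrr.
by rewrite ReD ReN iC subr0.
Qed.

Lemma poisson_ext_radial_bdd (f : R -> R[i]) (M : R) : cmeasurable f ->
  (forall t, cabs (f t) <= M) ->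
  {ae leb, forall t, T0 t -> ccvg (0 : R)^'+
    (fun d => poisson_ext f ((1 - d)%:C * eit t)) (f t)}.
Proof.
move=> [mr mi] fM; have mT := @measurable_T0 R.
have ir : leb.-integrable T0 (EFin \o (fun t => Re (f t))).
  apply: (@integrable_dom _ _ _ mT _ (fun=> M)) => //; last exact: integrable_leb_cst.
  by move=> t _; exact: le_trans (Re_le_cabs _) (fM t).
have ii : leb.-integrable T0 (EFin \o (fun t => Im (f t))).
  apply: (@integrable_dom _ _ _ mT _ (fun=> M)) => //; last exact: integrable_leb_cst.
  by move=> t _; exact: le_trans (Im_le_cabs _) (fM t).
apply: ae_imp (ae_and (poisson_radial mr ir) (poisson_radial mi ii)) _ => t [h1 h2] Tt.
split.
  apply: cvg_trans (h1 Tt); apply: near_eq_cvg; apply: nearW => d.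
  rewrite Re_herglotz /poisson_ext /mavg ReCM /=; congr (_ * _).
  by apply: eq_Rintegral => s _; rewrite ReMC mulrC.
apply: cvg_trans (h2 Tt); apply: near_eq_cvg; apply: nearW => d.
rewrite Re_herglotz /poisson_ext /mavg ImCM /=; congr (_ * _).
by apply: eq_Rintegral => s _; rewrite ImMC mulrC.
Qed.

Lemma norm_inf_lty (f : R -> R[i]) : (norm_inf f < +oo)%E ->
  exists M : R, 0 <= M /\ {ae leb, forall t, T0 t -> cabs (f t) <= M}.
Proof.
move=> /ereal_inf_lt[y /= hy yoo]; exists (Num.max 0 (fine y)); split; first by rewrite le_max lexx.
apply: ae_imp hy _ => t h /h; case: y yoo {h} => // r _.
by rewrite lee_fin => /le_trans; apply; rewrite le_max lexx orbT.
Qed.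

Lemma mavg_ae_eq (f g : R -> R[i]) : cmeasurable f -> cmeasurable g ->
  {ae leb, forall t, T0 t -> f t = g t} -> mavg f = mavg g.
Proof.
move=> [mfr mfi] [mgr mgi] fg; rewrite /mavg /cint.
congr (_ * (_ +i* _)); congr fine; apply: ae_eq_integral.
- exact: measurable_T0.
- by apply/measurable_EFinP; exact: measurable_funTS.
- by apply/measurable_EFinP; exact: measurable_funTS.
- by apply: ae_imp fg _ => t h /= Tt; rewrite h.
- exact: measurable_T0.
- by apply/measurable_EFinP; exact: measurable_funTS.
- by apply/measurable_EFinP; exact: measurable_funTS.
- by apply: ae_imp fg _ => t h /= Tt; rewrite h.
Qed.

(** A bound valid almost everywhere is made to hold everywhere by cutting [f] to the set where it
    holds; Poisson extensions do not see the change. *)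
Theorem poisson_ext_radial (f : R -> R[i]) : cmeasurable f -> (norm_inf f < +oo)%E ->
  {ae leb, forall t, T0 t -> ccvg (0 : R)^'+
    (fun d => poisson_ext f ((1 - d)%:C * eit t)) (f t)}.
Proof.
move=> mf /norm_inf_lty[M [M0 fM]].
pose A := [set t : R | cabs (f t) <= M].
have mA : measurable (A : set mR).
  rewrite (_ : A = setT `&` (fun t => cabs (f t)) @^-1` `]-oo, M]).
    exact: (measurable_cabs mf).
  by rewrite setTI; apply/seteqP; split => t /=; rewrite in_itv.
pose g t : R[i] := f t * (\1_A t)%:C.
have mg : cmeasurable g.
  by apply: cmeasurableM => //; apply: cmeasurableC; exact: measurable_indic.
have gM t : cabs (g t) <= M.
  rewrite cabsM cabsC indicE; have [tA|tA] := boolP (t \in A).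
    by rewrite normr1 mulr1; move: tA; rewrite inE.
  by rewrite normr0 mulr0.
have fg : {ae leb, forall t, T0 t -> f t = g t}.
  apply: ae_imp fM _ => t h /h tM; rewrite /g indicE mem_set ?mulr1//.
apply: ae_imp (ae_and fg (poisson_ext_radial_bdd mg gM)) _ => t [h1 h2] Tt.
rewrite h1//; have := h2 Tt; rewrite (_ : (fun d => poisson_ext g _) =
  (fun d => poisson_ext f ((1 - d)%:C * eit t)))//.
apply/funext => d; apply/esym; apply: mavg_ae_eq.
- by apply: cmeasurableM => //; exact: cmeasurable_Poisson.
- by apply: cmeasurableM => //; exact: cmeasurable_Poisson.
- by apply: ae_imp fg _ => s h /h ->.
Qed.

End RadialLimits.

(** * Existence of the conjugate function and the outer factor *)

Section ConjugateFunction.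
Context {R : realType}.
Implicit Types (u v : R -> R) (x y s t c d : R).
Local Notation leb := (@lebesgue_measure R).
Local Notation T0 := (@T0 R).
Local Notation Re := (@complex.Re R).
Local Notation Im := (@complex.Im R).

(** Close to 0 the point [eit (q d)] stays in the open half-plane around [w]. By continuity the
    phase relative to [w] then cannot leave one branch []- pi / 2, pi / 2[], on which [asin]
    recovers it from its sine. *)
Lemma argument_lift (q : R -> R) (w : R[i]) : {in `]0, 1[, continuous q} ->
  cabs w = 1 -> ccvg (0 : R)^'+ (fun d => eit (q d)) w ->
  exists l, q d @[d --> 0^'+] --> l /\ eit l = w.
Proof.
move=> cq w1 qw.
have w0 : w != 0 by rewrite -cabs_gt0 w1.
have qw1 : ccvg (0 : R)^'+ (fun d => eit (q d) * conjc w) 1.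
  have -> : 1 = w * conjc w by rewrite mulcJ w1 expr1n.
  by apply: ccvgM => //; exact: ccvg_cst.
have [d0 /= d00 hd0] : \forall d \near (0 : R)^'+, 0 < d < 1 /\ 0 < Re (eit (q d) * conjc w).
  near=> d; split; near: d; first exact: near_right_lt.
  have [qr _] := qw1; exact: (cvgr_gt 1 qr).
have {}hd0 d : 0 < d < d0 -> 0 < d < 1 /\ 0 < Re (eit (q d) * conjc w).
  move=> /andP[dp dd]; apply: hd0 => //.
  by rewrite /ball/= sub0r normrN gtr0_norm.
pose d1 := d0 / 2; have d1d : 0 < d1 < d0 by rewrite /d1; lra.
have [d101 r1] := hd0 _ d1d.
set W := eit (q d1) * conjc w in r1.
have WE : Re W ^+ 2 + Im W ^+ 2 = 1.
  by rewrite -sqr_cabs cabsM cabs_eit cabs_conj w1 mulr1 expr1n.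
have ImW : -1 < Im W < 1.
  have : Im W ^+ 2 < 1 by rewrite -WE ltrDr exprn_gt0.
  by rewrite -[ltRHS](expr1n _ 2) -(real_normK (num_real (Im W))) ltr_pXn2r ?nnegrE// ltr_norml.
pose b := asin (Im W).
have Iin : Im W \in `[-1, 1] by rewrite in_itv/=; move: ImW; lra.
have b1 : - (pi / 2) < b < pi / 2.
  by rewrite asin_gtNpi2 ?asin_ltpi2//; move: ImW; lra.
have eb : eit b = W.
  apply: complex_ext => /=; last by rewrite /b asinK.
  rewrite cos_asin; last by move: ImW; lra.
  by rewrite -WE addrK sqrtr_sqr gtr0_norm.
(* The argument of [w] on the branch singled out by the sample point [d1]. *)
pose al := q d1 - b.
have eal : eit al = w.
  rewrite /al eitD eitN eb /W; have := eit_neq0 (q d1) => h.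
  by rewrite (conj_unit w1); field; rewrite w0 h.
pose p d := q d - al.
have ep d : eit (p d) = eit (q d) * conjc w.
  by rewrite /p eitD eitN eal conj_unit.
have pb : p d1 = b by rewrite /p /al; ring.
have cp : {in `]0, 1[, continuous p}.
  by move=> d din; apply: cvgB; [exact: cq|exact: cvg_cst].
(* A value of modulus at least [pi / 2] would force, between [d] and [d1], the value [pi / 2]
   itself, where the cosine vanishes although it is positive. *)
have psmall d : 0 < d < d0 -> `|p d| < pi / 2.
  move=> dd; rewrite ltNge; apply/negP => big.
  have cps a c' : 0 < a -> c' < d0 -> {within `[a, c'], continuous (fun d => `|p d|)}.
    move=> a0 cd; apply: continuous_in_subspaceT => x; rewrite inE/= in_itv/= => /andP[ax xc].
    have x01 : 0 < x < 1.
      by apply: (proj1 (hd0 x _)); rewrite (lt_le_trans a0)//= (le_lt_trans xc).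
    apply: (@cvg_norm _ _ _ (nbhs x)); apply: cp; rewrite in_itv/=; exact: x01.
  have pd1 : `|p d1| <= pi / 2 by rewrite pb ler_norml; move: b1; lra.
  have [x x0 xe] : exists2 x, 0 < x < d0 & `|p x| = pi / 2.
    have /andP[dp dlt] := dd; have /andP[d1p d1lt] := d1d.
    have [dd1|dd1] := leP d d1.
      have [x] := IVT dd1 (cps _ _ dp d1lt) (v := pi / 2) ltac:(by
        rewrite ge_min le_max pd1 big orbT).
      rewrite in_itv/= => /andP[h1 h2] h3; exists x => //.
      by rewrite (lt_le_trans dp h1) (le_lt_trans h2).
    have [x] := IVT (ltW dd1) (cps _ _ d1p dlt) (v := pi / 2) ltac:(by
        rewrite ge_min le_max pd1 big orbT).
    rewrite in_itv/= => /andP[h1 h2] h3; exists x => //.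
    by rewrite (lt_le_trans d1p h1) (le_lt_trans h2).
  have [_] := hd0 _ x0; rewrite -ep /= -cos_norm xe cos_pihalf ltxx.
  by [].
have sp : sin (p d) @[d --> 0^'+] --> 0.
  have [_ qi] := qw1; move: qi => /=; apply: cvg_trans; apply: near_eq_cvg.
  by apply: nearW => d; rewrite -[sin _]/(Im (eit (p d))) ep.
have asin0 : asin (0 : R) = 0.
  rewrite -[X in asin X](@sin0 R) sinK// in_itv/=.
  by have := @pi_ge0 R; lra.
have pc : p d @[d --> 0^'+] --> 0.
  have ca : asin (sin (p d)) @[d --> 0^'+] --> asin (0 : R).
    apply: (@cvg_comp _ _ _ (fun d => sin (p d)) asin _ _ _ sp).
    by apply: continuous_asin; rewrite ltr01 ltrN10.
  rewrite asin0 in ca; apply: cvg_trans ca; apply: near_eq_cvg.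
  near=> d; rewrite sinK// in_itv/= -ler_norml ltW//.
  by apply: psmall; near: d; exact: near_right_lt.
exists al; split => //.
rewrite -[X in _ --> X]add0r.
have -> : q = (fun d => p d + al) by apply/funext => d; rewrite /p subrK.
by apply: cvgD => //; exact: cvg_cst.
Unshelve. all: by end_near. Qed.

Lemma continuous_radial (F : R[i] -> R[i]) t :
  (forall r, 0 <= r < 1 -> polyapp r F) ->
  {in `]0, 1[, continuous (fun d => Im (F ((1 - d)%:C * eit t)))}.
Proof.
move=> aF x; rewrite in_itv/= => /andP[x0 x1].
have r01 : 0 <= 1 - x / 2 < 1 by apply/andP; split; lra.
have zr : cabs ((1 - x)%:C * eit t) <= 1 - x / 2.
  by rewrite cabs_circle ?subr_ge0 ?ltW//; lra.
apply/cvgrPdist_lt => e e0.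
have [d [d0 hd]] := polyapp_continuous (aF _ r01) zr e0.
have m0 : 0 < Num.min d (Num.min (x / 2) (1 - x)).
  by rewrite !lt_min d0 /= subr_gt0 x1 andbT divr_gt0.
near=> y.
have hy : `|x - y| < Num.min d (Num.min (x / 2) (1 - x)).
  by near: y; exact: (nbhsx_ballx x _ m0).
move: hy; rewrite !lt_min => /and3P[y1 y2 y3].
have y4 : x / 2 < y by move: y2; rewrite ltr_norml; lra.
have y5 : y < 1 by move: y3; rewrite ltr_norml; lra.
rewrite distrC -ImN -ImD (le_lt_trans (Im_le_cabs _))//; apply: hd.
  by rewrite cabs_circle ?subr_ge0 ?ltW//; lra.
have -> : (1 - y)%:C * eit t - (1 - x)%:C * eit t = (x - y)%:C * eit t.
  by rewrite -mulrBl -rmorphB; congr (_%:C * _); ring.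
by rewrite cabsM cabs_eit mulr1 cabsC.
Unshelve. all: by end_near. Qed.

Lemma near_radius t : \forall d \near (0 : R)^'+, cabs ((1 - d)%:C * eit t) < 1.
Proof.
near=> d; have /andP[d0 d1] : 0 < d < 1 by near: d; exact: near_right_lt.
by rewrite cabs_circle ?subr_ge0 ?ltW//; lra.
Unshelve. all: by end_near. Qed.

(* A radial limit of [exp (herglotz v)] only gives the phase modulo [2 pi]; as
   the phase is continuous along the radius it converges itself, which makes
   the limit defining [conj_fun v t] exist. *)
Lemma conj_fun_radial v : Defs.periodic v -> measurable_fun setT v ->
  leb.-integrable T0 (EFin \o v) ->
  {ae leb, forall t, T0 t -> forall w : R[i],
    ccvg (0 : R)^'+ (fun d => cexp (herglotz v ((1 - d)%:C * eit t))) w ->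
    w = cexp (v t +i* conj_fun v t)}.
Proof.
move=> pv mv iv.
apply: ae_imp (ae_and ae_T0_interior (ae_and (herglotz_radial mv iv) (poisson_radial mv iv))) _.
move=> t [h1 [h2 h3]] Tt w cw; have t02 := h1 Tt; have [_ hi] := h2 Tt; have hr := h3 Tt.
set z := fun d : R => (1 - d)%:C * eit t.
have er : expR (Re (herglotz v (z d))) @[d --> 0^'+] --> expR (v t).
  by apply: (@cvg_comp _ _ _ (fun d => Re (herglotz v (z d))) expR _ _ _ hr); exact: continuous_expR.
have wv : cabs w = expR (v t).
  have cwa : cabs (cexp (herglotz v (z d))) @[d --> 0^'+] --> cabs w by exact: ccvg_cabs.
  move: cwa; rewrite (_ : (fun d => cabs _) = (fun d => expR (Re (herglotz v (z d))))).
    by move=> h; exact: (cvg_unique _ h er).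
  by apply/funext => d; rewrite cabs_cexp.
(* Dividing out the modulus leaves a pure phase, to which [argument_lift] applies. *)
pose w' := w * (expR (- v t))%:C.
have w'1 : cabs w' = 1.
  by rewrite cabsM wv cabsC ger0_norm ?expR_ge0// expRN mulfV// gt_eqF// expR_gt0.
have cw' : ccvg (0 : R)^'+ (fun d => eit (Im (herglotz v (z d)))) w'.
  have -> : (fun d => eit (Im (herglotz v (z d)))) = (fun d => cexp (herglotz v (z d)) *
      (expR (- Re (herglotz v (z d))))%:C).
    apply/funext => d; rewrite cexpE mulrAC -rmorphM /= expRN mulfV ?mul1r//.
    by rewrite gt_eqF// expR_gt0.
  apply: ccvgM => //; split => /=; last exact: cvg_cst.
  apply: (@cvg_comp _ _ _ (fun d => - Re (herglotz v (z d))) expR _ _ _ (cvgN hr)).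
  exact: continuous_expR.
have [l [ql el]] := argument_lift (continuous_radial (fun r => polyapp_herglotz mv iv)) w'1 cw'.
(* The phase minus the truncated integral is the imaginary part of the expression in
   [herglotz_radial], whose limit [v t] is real. *)
have pvl : ((2 * pi)^-1 * pvT v t d) @[d --> 0^'+] --> l.
  move: hi => /(cvgB ql); rewrite subr0; apply: cvg_trans; apply: near_eq_cvg.
  apply: nearW => d; have iC x : Im ('i * x%:C) = x by rewrite ImM /= mul0r add0r mul1r.
  rewrite -[LHS]/(Im (herglotz v (z d)) -
    Im (herglotz v (z d) - 'i * ((2 * pi)^-1 * pvT v t d)%:C)).
  by rewrite ImD ImN iC opprB addrC subrK.
have cl : conj_fun v t = l.
  apply: cvg_lim => //; apply: cvg_trans pvl; apply: near_eq_cvg.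
  near=> d; rewrite -pvintE//.
  have /andP[-> d1] : 0 < d < 1 by near: d; exact: near_right_lt.
  by rewrite (le_trans (ltW d1))// (le_trans _ (pi_ge2 R))// ler1n.
rewrite cl cexpE /= el /w' mulrCA -rmorphM /= expRN mulfV ?mulr1//.
by rewrite gt_eqF// expR_gt0.
Unshelve. all: by end_near. Qed.

(** Radial limits of [|Phi|] computed from [Phi] and from [k] give [ln k = u + v] almost everywhere,
    so [Phi] extends as [c exp (H u) exp (H v)] with [H] the Herglotz integral. As [u] is bounded,
    so is [exp (- H u)], and [fatou] supplies its boundary values [e]; the product keeps only
    [exp (H v)], whose radial limit [conj_fun_radial] identifies. *)
Theorem outer_HelsonSzego (Phi : R -> R[i]) u v (k : R -> R) (c : R[i]) (M : R) :
  Hinf Phi -> (forall t, 0 < k t) -> measurable_fun setT k ->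
  leb.-integrable T0 (EFin \o (fun t => ln (k t))) -> cabs c = 1 ->
  (forall z, cabs z < 1 ->
     poisson_ext Phi z = c * cexp (herglotz (fun t => ln (k t)) z)) ->
  Defs.periodic v -> measurable_fun setT u -> measurable_fun setT v ->
  (forall t, `|u t| <= M) -> leb.-integrable T0 (EFin \o v) ->
  {ae leb, forall t, T0 t -> cabs (Phi t) = expR (u t + v t)} ->
  exists e, [/\ Hinf e, forall t, cabs (e t) <= 2 * expR M &
    {ae leb, forall t, T0 t -> Phi t * e t = c * cexp (v t +i* conj_fun v t)}].
Proof.
move=> [pPhi mPhi bPhi _] k0 mk ik c1 PhiE pv mu mv uM iv PhiHS.
have mT := @measurable_T0 R.
have mlk : measurable_fun setT (fun t => ln (k t)).
  apply: (@measurableT_comp _ _ _ _ _ _ (@ln R)) => //; exact: measurable_ln.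
have iu : leb.-integrable T0 (EFin \o u).
  by apply: (@integrable_dom _ _ _ mT _ (fun=> M)) => //; exact: integrable_leb_cst.
have cPhi := poisson_ext_radial mPhi bPhi.
have lnk : {ae leb, forall t, T0 t -> ln (k t) = u t + v t}.
  apply: ae_imp (ae_and PhiHS (ae_and cPhi (poisson_radial mlk ik))) _ => t [h1 [h2 h3]] Tt.
  have c2 : cabs (poisson_ext Phi ((1 - d)%:C * eit t)) @[d --> 0^'+] --> expR (u t + v t).
    by rewrite -h1//; apply: ccvg_cabs; exact: h2.
  have c3 : expR (Re (herglotz (fun t => ln (k t)) ((1 - d)%:C * eit t))) @[d --> 0^'+] -->
      expR (ln (k t)).
    apply: (@cvg_comp _ _ _ _ expR _ _ _ (h3 Tt)); exact: continuous_expR.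
  have c4 : expR (Re (herglotz (fun t => ln (k t)) ((1 - d)%:C * eit t))) @[d --> 0^'+] -->
      expR (u t + v t).
    apply: cvg_trans c2; apply: near_eq_cvg; near=> d.
    rewrite PhiE; last by near: d; exact: near_radius.
    by rewrite cabsM c1 mul1r cabs_cexp.
  by apply: expR_inj; exact: (cvg_unique _ c3 c4).
have muv : measurable_fun setT (fun t => u t + v t) by exact: measurable_funD.
have PhiE' z : cabs z < 1 -> poisson_ext Phi z = c * (cexp (herglotz u z) * cexp (herglotz v z)).
  by move=> z1; rewrite PhiE// (herglotz_ae_eq z1 mlk muv lnk) herglotzD// cexpD.
pose E z := cexp (- herglotz u z).
have aE r : 0 <= r < 1 -> polyapp r E.
  by move=> r01; apply: polyapp_cexp; apply: polyappN; exact: polyapp_herglotz.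
have EM z : cabs z < 1 -> cabs (E z) <= expR M.
  move=> z1; rewrite cabs_cexp ler_expR ReN.
  have := Re_herglotz_bounded z1 mu uM; rewrite ler_norml => /andP[h _].
  by rewrite lerNl.
have [e [He eM eE]] := fatou aE EM.
exists e; split => //.
have [_ me be _] := He.
apply: ae_imp (ae_and cPhi (ae_and (poisson_ext_radial me be) (conj_fun_radial pv mv iv))) _.
move=> t [h1 [h2 h3]] Tt.
have c0 : c != 0 by rewrite -cabs_gt0 c1.
have h4 : ccvg (0 : R)^'+ (fun d => c^-1 * (poisson_ext Phi ((1 - d)%:C * eit t) *
    poisson_ext e ((1 - d)%:C * eit t))) (c^-1 * (Phi t * e t)).
  by apply: ccvgM; [exact: ccvg_cst|apply: ccvgM; [exact: h1|exact: h2]].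
have : c^-1 * (Phi t * e t) = cexp (v t +i* conj_fun v t).
  apply: (h3 Tt); case: h4 => hr hi; split.
    apply: cvg_trans hr; apply: near_eq_cvg; near=> d.
    have d1 : cabs ((1 - d)%:C * eit t) < 1 by near: d; exact: near_radius.
    congr Re; rewrite PhiE'// eE// /E cexpN; have := cexp_neq0 (herglotz u ((1 - d)%:C * eit t)) => hn.
    by field; rewrite hn c0.
  apply: cvg_trans hi; apply: near_eq_cvg; near=> d.
  have d1 : cabs ((1 - d)%:C * eit t) < 1 by near: d; exact: near_radius.
  congr Im; rewrite PhiE'// eE// /E cexpN; have := cexp_neq0 (herglotz u ((1 - d)%:C * eit t)) => hn.
  by field; rewrite hn c0.
by move=> <-; rewrite mulrA mulfV// mul1r.
Unshelve. all: by end_near. Qed.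

End ConjugateFunction.

(** * Inverses up to a positive factor and a small relative error *)

Section PositiveInverse.
Context {R : realType}.
Implicit Types (K : set R) (J : R -> R[i]) (G H : R[i] -> R[i]) (w z : R[i]) (t : R).

(* Up to an arbitrarily small relative error, [J] has an inverse on [K] of the
   form (disc algebra) / (positive function). *)
Definition posinv K J := forall e : R, 0 < e -> exists G (eta : R),
  [/\ polyapp 1 G, 0 < eta & forall t, K t -> exists P : R,
    eta <= P /\ cabs (J t * G (eit t) - P%:C) <= e * P].

Lemma eq_posinv K J1 J2 : (forall t, K t -> J1 t = J2 t) -> posinv K J1 -> posinv K J2.
Proof.
move=> J12 p1 e /p1[G [eta [aG eta0 h]]]; exists G, eta; split => // t Kt.
by rewrite -J12//; exact: h.
Qed.

Lemma posinvM K J1 J2 : posinv K J1 -> posinv K J2 -> posinv K (fun t => J1 t * J2 t).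
Proof.
(* The product has relative error [2 d + d^2 <= 3 d <= e]. *)
move=> p1 p2 e e0; pose d := Num.min 1 (e / 3).
have d0 : 0 < d by rewrite lt_min ltr01 divr_gt0.
have d1 : d <= 1 by rewrite ge_min lexx.
have de : d <= e / 3 by rewrite ge_min lexx orbT.
have [G1 [n1 [a1 n10 h1]]] := p1 _ d0; have [G2 [n2 [a2 n20 h2]]] := p2 _ d0.
exists (fun z => G1 z * G2 z), (n1 * n2); split; [exact: polyappM|exact: mulr_gt0|].
move=> t Kt; have [P [nP hP]] := h1 _ Kt; have [Q [nQ hQ]] := h2 _ Kt.
have P0 : 0 <= P by rewrite (le_trans (ltW n10)).
have Q0 : 0 <= Q by rewrite (le_trans (ltW n20)).
exists (P * Q); split; first by rewrite ler_pM// ltW.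
set x := J1 t * G1 (eit t) in hP; set y := J2 t * G2 (eit t) in hQ.
have -> : J1 t * J2 t * (G1 (eit t) * G2 (eit t)) - (P * Q)%:C =
  (x - P%:C) * Q%:C + P%:C * (y - Q%:C) + (x - P%:C) * (y - Q%:C).
  by rewrite /x /y rmorphM /=; ring.
rewrite (le_trans (cabsD _ _))//.
have t1 : cabs ((x - P%:C) * Q%:C + P%:C * (y - Q%:C)) <= d * P * Q + P * (d * Q).
  rewrite (le_trans (cabsD _ _))// !cabsM !cabsC !ger0_norm// lerD//.
    by rewrite ler_wpM2r.
  by rewrite ler_wpM2l.
have t2 : cabs ((x - P%:C) * (y - Q%:C)) <= (d * P) * (d * Q).
  by rewrite cabsM ler_pM ?cabs_ge0.
have PQ : 0 <= P * Q by rewrite mulr_ge0.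
have d2 : d ^+ 2 <= d by rewrite expr2 ler_piMl// ltW.
have t3 : d * P * Q + P * (d * Q) + (d * P) * (d * Q) = (2 * d + d ^+ 2) * (P * Q) by ring.
have t4 : (2 * d + d ^+ 2) * (P * Q) <= e * (P * Q) by rewrite ler_wpM2r//; lra.
by lra.
Qed.

Lemma posinv_positive K (p : R -> R) (eta : R) : 0 < eta ->
  (forall t, K t -> eta <= p t) -> posinv K (fun t => (p t)%:C).
Proof.
move=> eta0 hp e e0; exists (fun=> 1), eta; split => //; first exact: polyapp_cst.
move=> t Kt; exists (p t); split; first exact: hp.
by rewrite mulr1 subrr cabs0 mulr_ge0 ?(ltW e0)// (le_trans (ltW eta0))// hp.
Qed.

Lemma posinv_factor K J H : polyapp 1 H -> posinv K (fun t => J t * H (eit t)) -> posinv K J.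
Proof.
move=> aH p e /p[G [eta [aG eta0 h]]].
exists (fun z => H z * G z), eta; split => //; first exact: polyappM.
by move=> t /h[P [h1 h2]]; exists P; split => //; rewrite mulrA.
Qed.

Lemma posinv_cst K (c : R[i]) : c != 0 -> posinv K (fun=> c).
Proof.
move=> c0; apply: (@posinv_factor _ _ (fun=> c^-1)); first exact: polyapp_cst.
apply: eq_posinv (posinv_positive (p := fun=> 1) ltr01 (fun _ _ => lexx 1)) => t _.
by rewrite mulfV.
Qed.

(* With [q = 1 - p z] and [p = eit (- t0)] one has [- p z = q^2 / |q|^2] on the
   circle; replacing [p] by [(1 - s) p] puts [1 / q^2] in the disc algebra. *)
Lemma posinv_eit K (t0 d : R) : 0 < d ->
  (forall t, K t -> d <= cabs (eit t - eit t0)) -> posinv K (@eit R).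
Proof.
move=> d0 hK e e0; pose p : R[i] := eit (- t0).
have p1 : cabs p = 1 by exact: cabs_eit.
(* The bounds keep [1 - s] positive, give [|q'| >= d / 2], and put [q / q'] within [min 1 (e / 3)]
   of 1, so that its square is within [e] of 1. *)
pose s := Num.min (2^-1) (Num.min (d / 2) (Num.min 1 (e / 3) * d / 2)).
have m0 : 0 < Num.min 1 (e / 3) by rewrite lt_min ltr01 divr_gt0.
have s0 : 0 < s.
  by rewrite !lt_min invr_gt0 ltr0n/= !divr_gt0//= mulr_gt0.
have s1 : s <= 2^-1 by rewrite ge_min lexx.
have s2 : s <= d / 2 by rewrite !ge_min lexx !orbT.
have s3 : s <= Num.min 1 (e / 3) * d / 2 by rewrite !ge_min lexx !orbT.
pose r := (1 - s)%:C * p.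
have r1 : cabs r * 1 < 1.
  by rewrite mulr1 cabsM p1 mulr1 cabsC ger0_norm; lra.
exists (fun z => - p * ((1 - r * z)^-1) ^+ 2), (4^-1); split.
- by apply: polyappZ; apply: polyappX; exact: polyapp_geometric.
- by rewrite invr_gt0.
move=> t Kt; have hd := hK _ Kt.
pose q : R[i] := 1 - p * eit t; pose q' : R[i] := 1 - r * eit t.
have qE : cabs q = cabs (eit t - eit t0).
  have pt0 : p * eit t0 = 1 by rewrite /p -eitD addNr eit0.
  rewrite -[RHS]mul1r -p1 -cabsM -cabsN; congr cabs; rewrite /q mulrBr pt0.
  by ring.
have hq : d <= cabs q by rewrite qE.
have q0 : q != 0 by rewrite -cabs_gt0 (lt_le_trans d0).
have q2 : cabs q <= 2 by rewrite (le_trans (cabsB _ _))// cabs1 cabsM p1 cabs_eit; lra.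
have qq : q' = q + s%:C * p * eit t by rewrite /q' /q /r rmorphB /=; ring.
have hq' : d / 2 <= cabs q'.
  have : cabs q - cabs (- (s%:C * p * eit t)) <= cabs q'.
    by rewrite qq -{2}[s%:C * p * eit t]opprK; exact: cabs_lerB.
  rewrite cabsN !cabsM p1 cabs_eit cabsC !mulr1 (gtr0_norm s0); lra.
have q'0 : q' != 0 by rewrite -cabs_gt0 (lt_le_trans _ hq')// divr_gt0.
(* On the circle [|q| <= 2], whence the lower bound [1 / 4]. *)
exists ((cabs q ^+ 2)^-1); split.
  rewrite lef_pV2 ?posrE ?exprn_gt0 ?cabs_gt0//.
  have -> : 4 = 2 ^+ 2 :> R by rewrite -natrX.
  by rewrite lerXn2r ?nnegrE ?cabs_ge0.
have key : - p * eit t * (q ^+ 2)^-1 = (cabs q ^+ 2)^-1%:C.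
  have e1 : (cabs q ^+ 2)^-1%:C = (q * conjc q)^-1.
    by rewrite mulcJ fmorphV.
  have cq : conjc q = 1 - (p * eit t)^-1.
    by rewrite /q conjcD conjcN conjc1 conj_unit// cabsM p1 cabs_eit mulr1.
  have pe0 : p * eit t != 0 by rewrite mulf_neq0// eit_neq0.
  have cq' : conjc q = - q / (p * eit t).
    have gen (x : R[i]) : x != 0 -> 1 - x^-1 = - (1 - x) / x by move=> x0; field.
    by rewrite cq; exact: gen.
  rewrite e1 cq'; have ep0 := eit_neq0 t; have pp0 := eit_neq0 (- t0).
  by field; rewrite ep0 q0 pp0.
have -> : eit t * (- p * q'^-1 ^+ 2) - (cabs q ^+ 2)^-1%:C =
    ((q / q') ^+ 2 - 1) * (cabs q ^+ 2)^-1%:C.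
  by rewrite -key; field; rewrite q0 q'0.
rewrite cabsM cabsC (ger0_norm (_ : 0 <= (cabs q ^+ 2)^-1)) ?invr_ge0 ?sqr_ge0//.
rewrite ler_wpM2r ?invr_ge0 ?sqr_ge0//.
set x := q / q' - 1.
have xs : cabs x <= Num.min 1 (e / 3).
  have -> : x = - (s%:C * p * eit t) / q' by rewrite /x qq; field; rewrite -qq.
  rewrite cabsM cabsV cabsN !cabsM p1 cabs_eit cabsC !mulr1 (gtr0_norm s0).
  rewrite ler_pdivrMr ?cabs_gt0// (le_trans s3)// -mulrA ler_wpM2l//.
  exact: ltW.
have -> : (q / q') ^+ 2 - 1 = x * (2 + x) by rewrite /x; ring.
rewrite cabsM.
have x1 : cabs x <= 1 by rewrite (le_trans xs)// ge_min lexx.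
have x2 : cabs x <= e / 3 by rewrite (le_trans xs)// ge_min lexx orbT.
have x3 : cabs (2 + x) <= 3.
  rewrite (le_trans (cabsD _ _))//.
  have -> : cabs (2 : R[i]) = 2.
    by rewrite -[2]/(2%:R) -(rmorph_nat (real_complex R)) cabsC ger0_norm.
  by lra.
apply: (@le_trans _ _ (e / 3 * 3)); first by rewrite ler_pM ?cabs_ge0.
by lra.
Qed.

End PositiveInverse.

(** * Blaschke factors and finite products *)

Section BlaschkeFactors.
Context {R : realType}.
Implicit Types (K : set R) (w z : R[i]) (t : R) (a : nat -> option R[i]).

Lemma bfactorE w z : w != 0 ->
  bfactor w z = (cabs w)%:C / w * ((w - z) / (1 - conjc w * z)).
Proof. by move=> w0; rewrite /bfactor (negbTE w0). Qed.

Lemma bfactor0 z : bfactor 0 z = z.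
Proof. by rewrite /bfactor eqxx. Qed.

Lemma cabs_bfactor_den w t : cabs (1 - conjc w * eit t) = cabs (w - eit t).
Proof.
rewrite -[LHS]cabs_conj conjcD conjcN conjc1 conjcM conjcK conj_eit.
rewrite -[LHS]mulr1 -(cabs_eit t) -cabsM -cabsN; congr cabs.
by rewrite mulrBl mul1r -mulrA -eitD addNr eit0 mulr1 opprB.
Qed.

Lemma cabs_bfactor_eit w t : cabs w < 1 -> cabs (bfactor w (eit t)) = 1.
Proof.
move=> w1; have [->|w0] := eqVneq w 0; first by rewrite bfactor0 cabs_eit.
rewrite bfactorE// !cabsM !cabsV cabs_bfactor_den cabsC ger0_norm ?cabs_ge0//.
rewrite mulfV ?cabs_eq0// mul1r mulfV// cabs_eq0 -opprB oppr_eq0.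
exact: eitB_neq0.
Qed.

(** From [|1 - conj w z|^2 = |w - z|^2 + (1 - |w|^2) (1 - |z|^2)]. *)
Lemma cabs_bfactor_le1 w z : cabs w < 1 -> cabs z <= 1 -> cabs (bfactor w z) <= 1.
Proof.
move=> w1 z1; have [->|w0] := eqVneq w 0; first by rewrite bfactor0.
rewrite bfactorE// !cabsM !cabsV cabsC ger0_norm ?cabs_ge0//.
rewrite mulfV ?cabs_eq0// mul1r.
have d0 : 0 < cabs (1 - conjc w * z).
  apply: lt_le_trans (cabs_lerB _ _); rewrite cabs1 cabsM cabs_conj subr_gt0.
  by rewrite (le_lt_trans _ w1)// ler_piMr// cabs_ge0.
rewrite ler_pdivrMr// mul1r -(@ler_pXn2r _ 2) ?nnegrE ?cabs_ge0//.
have : 0 <= (1 - cabs w ^+ 2) * (1 - cabs z ^+ 2).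
  by rewrite mulr_ge0// subr_ge0 expr_le1 ?cabs_ge0// ltW.
have -> : cabs (1 - conjc w * z) ^+ 2 =
  cabs (w - z) ^+ 2 + (1 - cabs w ^+ 2) * (1 - cabs z ^+ 2).
  by rewrite !sqr_cabs !(ReD, ImD, ReN, ImN, ReM, ImM, Re_conj, Im_conj) /=; ring.
by rewrite lerDl.
Qed.

(** The numerator of [bfactor w z - 1] carries the factor [1 - cabs w], which makes the bound
    summable over a Blaschke sequence. The assumption [d <= 2] covers a zero at the origin, where
    the factor is [z] itself. *)
Lemma cabs_bfactorB1 w z (d : R) : cabs w < 1 -> cabs z <= 1 -> 0 < d <= 2 ->
  d / 2 <= cabs (1 - conjc w * z) ->
  cabs (bfactor w z - 1) <= 4 / d * (1 - cabs w).
Proof.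
move=> w1 z1 /andP[d0 d2] hd; have [->|w0] := eqVneq w 0.
  rewrite bfactor0 cabs0 subr0 mulr1 (le_trans (cabsB _ _))// cabs1.
  by rewrite ler_pdivlMr//; nra.
have D0 : 0 < cabs (1 - conjc w * z) by rewrite (lt_le_trans _ hd)// divr_gt0.
have Dn : 1 - conjc w * z != 0 by rewrite -cabs_gt0.
have -> : bfactor w z - 1 = - ((1 - cabs w)%:C * (w + (cabs w)%:C * z)) / (w * (1 - conjc w * z)).
  have h : w * (1 - conjc w * z) = w - (cabs w)%:C ^+ 2 * z.
    by rewrite mulrBr mulr1 mulrA mulcJ rmorphXn.
  have hn : w - (cabs w)%:C ^+ 2 * z != 0 by rewrite -h mulf_neq0.
  rewrite bfactorE//.
  have -> : (cabs w)%:C / w * ((w - z) / (1 - conjc w * z)) =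
    (cabs w)%:C * (w - z) / (w * (1 - conjc w * z)) by field; rewrite Dn w0.
  by rewrite h rmorphB /=; field.
rewrite cabsM cabsN cabsV !cabsM cabsC ger0_norm ?subr_ge0 ?(ltW w1)//.
have n1 : cabs (w + (cabs w)%:C * z) <= 2 * cabs w.
  rewrite (le_trans (cabsD _ _))// cabsM cabsC ger0_norm ?cabs_ge0//.
  rewrite mulr2n mulrDl mul1r lerD2l; rewrite -[leRHS]mulr1 ler_wpM2l ?cabs_ge0//.
have cw0 : 0 < cabs w by rewrite cabs_gt0.
rewrite ler_pdivrMr ?mulr_gt0//.
set x := 1 - cabs w; have x0 : 0 <= x by rewrite subr_ge0 ltW.
apply: (@le_trans _ _ (x * (2 * cabs w))); first by rewrite ler_wpM2l.
have -> : 4 / d * x * (cabs w * cabs (1 - conjc w * z)) =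
  x * (2 * cabs w) * (cabs (1 - conjc w * z) / (d / 2)) by field; rewrite gt_eqF.
rewrite -[leLHS]mulr1 ler_wpM2l ?mulr_ge0 ?cabs_ge0//.
by rewrite ler_pdivlMr ?divr_gt0// mul1r.
Qed.

Lemma posinv_bfactor K w : cabs w < 1 -> posinv K (@eit R) ->
  posinv K (fun t => bfactor w (eit t)).
Proof.
move=> w1 pe; have [->|w0] := eqVneq w 0.
  by apply: eq_posinv pe => t _; rewrite bfactor0.
apply: (@posinv_factor _ _ _ (fun z => (1 - conjc w * z) ^+ 2)).
  apply: polyappX; apply: polyappD; first exact: polyapp_cst.
  by apply: polyappN; apply: polyappZ; exact: polyapp_id.
(* On the circle [w - z = - z * conjc (1 - conjc w * z)], which produces this constant and the
   squared modulus below. *)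
have c0 : - (cabs w)%:C / w != 0.
  rewrite mulf_neq0 ?invr_eq0// oppr_eq0.
  by apply: contraNneq w0 => /complexI/eqP; rewrite cabs_eq0.
have p0 : posinv K (fun t => ((cabs (1 - conjc w * eit t)) ^+ 2)%:C).
  apply: (@posinv_positive _ _ _ ((1 - cabs w) ^+ 2)).
    by rewrite exprn_gt0// subr_gt0.
  move=> t _; rewrite lerXn2r ?nnegrE ?cabs_ge0 ?subr_ge0 ?(ltW w1)//.
  by rewrite (le_trans _ (cabs_lerB _ _))// cabs1 cabsM cabs_conj cabs_eit mulr1.
apply: eq_posinv (posinvM (posinvM (posinv_cst K c0) pe) p0) => t _.
have D0 : 1 - conjc w * eit t != 0.
  rewrite -cabs_gt0 cabs_bfactor_den cabs_gt0 -opprB oppr_eq0; exact: eitB_neq0.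
rewrite -mulcJ bfactorE// conjcD conjcN conjc1 conjcM conjcK conj_eit eitN.
by have en := eit_neq0 t; field; rewrite w0 D0 en.
Qed.

Lemma posinv_bpartial K a N : (forall k w, a k = Some w -> cabs w < 1) ->
  posinv K (@eit R) -> posinv K (fun t => bpartial a N (eit t)).
Proof.
move=> a1 pe; elim: N => [|N IH].
  apply: eq_posinv (posinv_cst K (oner_neq0 _)) => t _.
  by rewrite /bpartial big_ord0.
apply: eq_posinv (posinvM IH (_ : posinv K (fun t => if a N is Some w then bfactor w (eit t) else 1))).
  by move=> t _; rewrite /bpartial big_ord_recr.
case E : (a N) => [w|]; first by apply: posinv_bfactor => //; exact: a1 E.
exact: posinv_cst (oner_neq0 _).
Qed.

Lemma cabs_bpartial_eit a N t : (forall k w, a k = Some w -> cabs w < 1) ->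
  cabs (bpartial a N (eit t)) = 1.
Proof.
move=> a1; elim: N => [|N IH]; first by rewrite /bpartial big_ord0 cabs1.
rewrite /bpartial big_ord_recr /= cabsM -/(bpartial a N _) IH mul1r.
by case E : (a N) => [w|]; rewrite ?cabs1// cabs_bfactor_eit//; exact: a1 E.
Qed.

Lemma cabs_bpartial_le1 a N z : (forall k w, a k = Some w -> cabs w < 1) ->
  cabs z <= 1 -> cabs (bpartial a N z) <= 1.
Proof.
move=> a1 z1; elim: N => [|N IH]; first by rewrite /bpartial big_ord0 cabs1.
rewrite /bpartial big_ord_recr /= cabsM -/(bpartial a N _) mulr_ile1 ?cabs_ge0//.
by case E : (a N) => [w|]; rewrite ?cabs1// cabs_bfactor_le1//; exact: a1 E.
Qed.

Lemma bpartialS a N z : bpartial a N.+1 z =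
  bpartial a N z * (if a N is Some w then bfactor w z else 1).
Proof. by rewrite /bpartial big_ord_recr. Qed.

Lemma ccvg_radius t : ccvg (0 : R)^'+ (fun d => (1 - d)%:C * eit t) (eit t).
Proof.
apply: (@ccvg_squeeze _ _ _ _ _ _ (fun d : R => d)).
  near=> d; have -> : (1 - d)%:C * eit t - eit t = - (d%:C * eit t).
    by rewrite rmorphB /=; ring.
  by rewrite cabsN cabsM cabs_eit mulr1 cabsC ger0_norm// ltW.
by apply: cvg_at_right_filter; exact: cvg_id.
Unshelve. all: by end_near. Qed.

Lemma ccvg_bfactor w t : cabs w < 1 ->
  ccvg (0 : R)^'+ (fun d => bfactor w ((1 - d)%:C * eit t)) (bfactor w (eit t)).
Proof.
move=> w1; have cz := ccvg_radius t; have [->|w0] := eqVneq w 0.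
  by rewrite bfactor0; under eq_fun do rewrite bfactor0.
rewrite bfactorE//.
rewrite (_ : (fun d => _) = (fun d => (cabs w)%:C / w *
  ((w - (1 - d)%:C * eit t) / (1 - conjc w * ((1 - d)%:C * eit t))))); last first.
  by apply/funext => d; rewrite bfactorE.
apply: ccvgM; first exact: ccvg_cst.
apply: ccvgM; first by apply: ccvgD; [exact: ccvg_cst|exact: ccvgN].
apply: ccvgV.
  rewrite -cabs_gt0 cabs_bfactor_den cabs_gt0 -opprB oppr_eq0; exact: eitB_neq0.
apply: ccvgD; first exact: ccvg_cst.
by apply: ccvgN; apply: ccvgM => //; exact: ccvg_cst.
Qed.

Lemma ccvg_bpartial a N t : (forall k w, a k = Some w -> cabs w < 1) ->
  ccvg (0 : R)^'+ (fun d => bpartial a N ((1 - d)%:C * eit t)) (bpartial a N (eit t)).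
Proof.
move=> a1; elim: N => [|N IH].
  rewrite /bpartial; under eq_fun do rewrite big_ord0.
  by rewrite big_ord0; exact: ccvg_cst.
rewrite bpartialS; under eq_fun do rewrite bpartialS.
apply: ccvgM => //; case E : (a N) => [w|]; last exact: ccvg_cst.
by apply: ccvg_bfactor; exact: a1 E.
Qed.

End BlaschkeFactors.

(** * Blaschke tails, the singular factor and inner functions off their spectrum *)

Section InnerFunctions.
Context {R : realType}.
Implicit Types (K : set R) (w z : R[i]) (t : R) (a : nat -> option R[i]).
Implicit Types (mu : {measure set (measurableTypeR R) -> \bar R}).
Local Notation T0 := (@T0 R).
Local Notation mR := (measurableTypeR R).

(** Each new factor moves the partial product, of modulus at most 1, by at most [q * b k]; the
    convergent series of [b] does not involve [z], which makes [N] uniform. *)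
Lemma blaschke_tail a (d e : R) : blaschke_seq a -> 0 < d <= 2 -> 0 < e ->
  exists N, forall z, cabs z <= 1 ->
    (forall k w, a k = Some w -> d / 2 <= cabs (1 - conjc w * z)) ->
    cabs (blaschke_prod a z - bpartial a N z) <= e.
Proof.
move=> [a1 asum] d02 e0; have /andP[d0 d2] := d02.
pose b k : R := if a k is Some w then 1 - cabs w else 0.
have b0 k : 0 <= b k.
  by rewrite /b; case E : (a k) => [w|] //; rewrite subr_ge0 ltW//; exact: a1 E.
have cb : cvgn (series b) by exact: nnseries_is_cvg.
pose q : R := 4 / d; have q0 : 0 < q by rewrite divr_gt0.
have ndb : nondecreasing_seq (series b).
  by apply/nondecreasing_seqP => n; rewrite /series/= big_nat_recr//= lerDl.
have bL n : series b n <= limn (series b) by exact: nondecreasing_cvgn_le.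
have [N hN] : exists N, limn (series b) - series b N <= e / q.
  have := cb => /cvgrPdist_le /(_ _ (divr_gt0 e0 q0))[N _ /(_ N (leqnn N))/= h].
  by exists N; apply: le_trans h; exact: ler_norm.
exists N => z z1 za.
have step k : cabs (bpartial a k.+1 z - bpartial a k z) <= q * b k.
  rewrite bpartialS -{2}[bpartial a k z]mulr1 -mulrBr cabsM.
  rewrite -[leRHS]mul1r ler_pM ?cabs_ge0//; first exact: cabs_bpartial_le1.
  rewrite /b; case E : (a k) => [w|]; last by rewrite subrr cabs0 mulr0.
  by apply: cabs_bfactorB1 => //; [exact: a1 E|exact: za E].
have dist m : cabs (bpartial a (N + m) z - bpartial a N z) <= q * (series b (N + m)%N - series b N).
  elim: m => [|m IH]; first by rewrite addn0 !subrr cabs0 mulr0.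
  rewrite addnS; apply: le_trans (cabs_triangle (bpartial a (N + m) z) _ _) _.
  apply: le_trans (lerD (step _) IH) _; rewrite -mulrDr ler_wpM2l ?(ltW q0)//.
  by rewrite /series/= big_nat_recr//= addrA [b _ + _]addrC.
have cqb : cvgn (series (fun k => q * b k)).
  rewrite (_ : series _ = (fun n => q * series b n)); last first.
    by apply/funext => n; rewrite /series/= mulr_sumr.
  by apply: is_cvgM => //; exact: is_cvg_cst.
have key (p : R[i] -> R) : (forall w, `|p w| <= cabs w) ->
    (forall z w, p (z - w) = p z - p w) -> cvgn (fun n => p (bpartial a n z)).
  move=> ple pB; pose u : R^nat := fun n => p (bpartial a n z).
  have ct : cvgn (series (telescope u)).
    apply: normed_cvg; apply: (series_le_cvg _ _ _ cqb) => n.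
    - exact: normr_ge0.
    - by rewrite mulr_ge0// ltW.
    rewrite /=; have -> : telescope u n = p (bpartial a n.+1 z - bpartial a n z) by rewrite pB.
    exact: le_trans (ple _) (step n).
  rewrite (_ : (fun n => p (bpartial a n z)) = (fun n => u 0%N + series (telescope u) n)).
    by apply: is_cvgD => //; exact: is_cvg_cst.
  by apply/funext => n; rewrite -eq_sum_telescope.
have cB : ccvg \oo (fun n => bpartial a n z) (blaschke_prod a z).
  split; first by apply: key => [w|y w]; [exact: Re_le_cabs|rewrite ReD ReN].
  by apply: key => [w|y w]; [exact: Im_le_cabs|rewrite ImD ImN].
have cBN : ccvg \oo (fun n => bpartial a n z - bpartial a N z)
    (blaschke_prod a z - bpartial a N z).
  by apply: ccvgD => //; exact: ccvg_cst.
apply: (ccvg_cabs_le cBN); exists N => // n /= Nn.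
rewrite -(subnKC Nn) (le_trans (dist _))// mulrC -ler_pdivlMr//.
by apply: le_trans hN; rewrite lerD2r.
Qed.

Lemma cexp_sub1 z : cabs z <= 2^-1 -> cabs (cexp z - 1) <= 4 * cabs z.
Proof.
move=> z1; have h := cexp_taylor1 z1; have z0 := cabs_ge0 z.
have -> : cexp z - 1 = (cexp z - 1 - z) + z by ring.
rewrite (le_trans (cabsD _ _))//; nra.
Qed.

Lemma cabs_eitB_radius s t (x : R) : 0 <= x < 1 ->
  cabs (eit s - eit t) <= 2 * cabs (eit s - x%:C * eit t).
Proof.
move=> /andP[x0 x1]; rewrite (le_trans (cabs_triangle (x%:C * eit t) _ _))//.
rewrite mulr2n mulrDl mul1r lerD2l.
have -> : x%:C * eit t - eit t = - ((1 - x)%:C * eit t) by rewrite rmorphB /=; ring.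
rewrite cabsN cabsM cabs_eit mulr1 cabsC ger0_norm; last by rewrite subr_ge0 ltW.
by apply: le_trans (cabs_eitB_ge _ _); rewrite cabs_circle.
Qed.

Lemma measurable_arc t (d : R) : measurable ([set s | cabs (eit s - eit t) < d] : set mR).
Proof.
have m : measurable_fun setT (fun s : mR => cabs (eit s - eit t)).
  by apply: measurable_cabs; apply: cmeasurableB; [exact: cmeasurable_eit|exact: cmeasurable_cst].
have -> : [set s | cabs (eit s - eit t) < d] =
    setT `&` (fun s : mR => cabs (eit s - eit t)) @^-1` `]-oo, d[.
  by rewrite setTI; apply/seteqP; split => s /=; rewrite in_itv.
exact: m.
Qed.

Definition sing_exponent mu z : R[i] :=
  cint mu T0 (fun s => (eit s + z) / (eit s - z)).

Lemma cintegrable_sing mu z : (mu T0 < +oo)%E -> cabs z < 1 ->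
  cintegrable mu T0 (fun s => (eit s + z) / (eit s - z)).
Proof.
move=> muT z1; apply: (@cintegrable_bdd _ _ _ (2 / (1 - cabs z))) => //.
  exact: cmeasurable_Hkernel.
by move=> s _; exact: cabs_Hkernel.
Qed.

(** The measure does not charge the arc of radius [d] around [t], and elsewhere both denominators
    are at least [d / 2], so the kernels differ by [O(1 - rho)] with a constant free of [t] and
    [r]. *)
Lemma sing_exponent_close mu t (d r rho : R) : (mu T0 < +oo)%E -> 0 < d ->
  mu (T0 `&` [set s | (cabs (eit s - eit t) < d)%R]) = 0%E ->
  0 <= rho <= r -> r < 1 ->
  cabs (sing_exponent mu (rho%:C * eit t) - sing_exponent mu (r%:C * eit t)) <=
  16 * (1 - rho) / d ^+ 2 * fine (mu T0).
Proof.
move=> muT d0 mu0 /andP[rho0 rhor] r1; have mT := @measurable_T0 R.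
have r0 := le_trans rho0 rhor; have rho1 := le_lt_trans rhor r1.
have c1 (x : R) : 0 <= x -> x < 1 -> cabs (x%:C * eit t) < 1 by move=> x0 x1; rewrite cabs_circle.
have i1 := cintegrable_sing muT (c1 _ rho0 rho1).
have i2 := cintegrable_sing muT (c1 _ r0 r1).
pose A := [set s | cabs (eit s - eit t) < d].
have mA : measurable (A : set mR) := measurable_arc t d.
pose B := 2 / (1 - rho) + 2 / (1 - r).
have B0 : 0 <= B by rewrite addr_ge0// divr_ge0// subr_ge0 ltW.
(* On the arc only the crude bound [B] is available, but the arc has measure 0. *)
pose k s : R := 8 * (1 - rho) / d ^+ 2 + B * \1_A s.
have k0 : 0 <= 8 * (1 - rho) / d ^+ 2.
  by rewrite divr_ge0 ?sqr_ge0// mulr_ge0// subr_ge0 ltW.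
have ii : mu.-integrable T0 (EFin \o (\1_A : mR -> R)).
  apply: (@integrable_dom _ _ _ mT _ (fun=> 1)); last exact: integrable_T0_cst.
    exact: measurable_indic.
  by move=> s _; rewrite indicE ger0_norm ?ler0n// lern1 leq_b1.
have ik : mu.-integrable T0 (EFin \o k).
  apply: (integrableRD mT); first exact: integrable_T0_cst.
  exact: integrableRZ.
have intk : Rintegral mu T0 k = 8 * (1 - rho) / d ^+ 2 * fine (mu T0).
  rewrite /k RintegralD//; [|exact: integrable_T0_cst|exact: integrableRZ].
  rewrite Rintegral_cst// RintegralZl//.
  have -> : Rintegral mu T0 (\1_A : mR -> R) = 0.
    by rewrite /Rintegral integral_indic// setIC mu0.
  by rewrite mulr0 addr0.
rewrite /sing_exponent -cintB//.
apply: (le_trans (cabs_cint_le mT (cintegrableB mT i1 i2) ik _)); last by rewrite intk; lra.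
move=> s _; rewrite /k indicE; have [sA|sA] := boolP (s \in A).
  rewrite mulr1 (le_trans (cabsB _ _))// -[leLHS]add0r lerD// /B.
  by rewrite lerD// (le_trans (cabs_Hkernel s (c1 _ _ _)))// cabs_circle.
rewrite mulr0 addr0.
have sd : d <= cabs (eit s - eit t).
  by rewrite leNgt; apply/negP => h; move/negP: sA; apply; rewrite inE.
set z := rho%:C * eit t; set z' := r%:C * eit t.
have h1 : d / 2 <= cabs (eit s - z).
  have := @cabs_eitB_radius s t rho; rewrite rho0 rho1 => /(_ isT); rewrite -/z; lra.
have h2 : d / 2 <= cabs (eit s - z').
  have := @cabs_eitB_radius s t r; rewrite r0 r1 => /(_ isT); rewrite -/z'; lra.
have n1 : eit s - z != 0 by rewrite -cabs_gt0 (lt_le_trans _ h1)// divr_gt0.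
have n2 : eit s - z' != 0 by rewrite -cabs_gt0 (lt_le_trans _ h2)// divr_gt0.
have -> : (eit s + z) / (eit s - z) - (eit s + z') / (eit s - z') =
    2 * eit s * (z - z') / ((eit s - z) * (eit s - z')) by field; rewrite n1 n2.
have two : cabs (2 : R[i]) = 2.
  by rewrite -[2]/(2%:R) -(rmorph_nat (real_complex R)) cabsC ger0_norm.
have zz : cabs (z - z') = r - rho.
  rewrite cabs_subC /z /z' -mulrBl -rmorphB /= cabsM cabs_eit mulr1 cabsC.
  by rewrite ger0_norm// subr_ge0.
rewrite cabsM cabsV !cabsM two cabs_eit mulr1 zz.
have h3 : d ^+ 2 / 4 <= cabs (eit s - z) * cabs (eit s - z').
  have -> : d ^+ 2 / 4 = (d / 2) * (d / 2) by field.
  by rewrite ler_pM// divr_ge0// ltW.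
have h4 : 0 < d ^+ 2 / 4 by rewrite divr_gt0// exprn_gt0.
have -> : 8 * (1 - rho) / d ^+ 2 = 2 * (1 - rho) / (d ^+ 2 / 4) by field; rewrite gt_eqF.
rewrite ler_pM ?invr_ge0 ?mulr_ge0 ?cabs_ge0 ?subr_ge0//; first by lra.
by rewrite lef_pV2 ?posrE// (lt_le_trans h4).
Qed.

(** The finite part of the Blaschke product is inverted by [posinv_bpartial], the tail is close to
    1, and [1 / S] is replaced by the dilation [exp (X (rho z))], which lies in the disc algebra. As
    [I] is given only as a radial limit, the comparison is made inside the disc and passed to the
    limit. *)
Lemma inner_posinv K (I : R -> R[i]) a mu (c : R[i]) (t0 d : R) :
  blaschke_seq a -> (mu T0 < +oo)%E -> cabs c = 1 -> 0 < d <= 1 ->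
  (forall t, K t -> [/\ d <= cabs (eit t - eit t0),
    forall k w, a k = Some w -> d <= cabs (w - eit t) &
    mu (T0 `&` [set s | (cabs (eit s - eit t) < d)%R]) = 0%E]) ->
  (forall t, K t -> ccvg (0 : R)^'+ (fun x => c * blaschke_prod a ((1 - x)%:C * eit t) *
     sing_inner mu ((1 - x)%:C * eit t)) (I t)) ->
  posinv K I.
Proof.
move=> ba muT c1 /andP[d0 d1] hK hI e e0; have [a1 _] := ba.
have c0 : c != 0 by rewrite -cabs_gt0 c1.
(* [I G] will differ from [BN g] by at most [2 e1] times [2 P], a quarter of the allowed error; half
   is left to the finite product. *)
pose e1 := Num.min 1 (e / 16).
have e10 : 0 < e1 by rewrite lt_min ltr01 divr_gt0.
have e11 : e1 <= 1 by rewrite ge_min lexx.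
have e12 : e1 <= e / 16 by rewrite ge_min lexx orbT.
have d02 : 0 < d <= 2 by rewrite d0; lra.
have [N hN] := blaschke_tail ba d02 e10.
pose m := 16 / d ^+ 2 * fine (mu T0).
have m0 : 0 <= m by rewrite mulr_ge0 ?fine_ge0// divr_ge0 ?sqr_ge0.
(* The exponents will differ by at most [e1 / 8]; the exponential then contributes [e1 / 2], times
   at most 2 for the Blaschke product. *)
pose q := Num.min (2^-1) (e1 / 8 / (m + 1)).
have q0 : 0 < q by rewrite lt_min invr_gt0 ltr0n/= !divr_gt0// ltr_wpDl.
have q1 : q <= 2^-1 by rewrite ge_min lexx.
have qm : q * m <= e1 / 8.
  have h : q <= e1 / 8 / (m + 1) by rewrite ge_min lexx orbT.
  rewrite (le_trans (ler_wpM2r m0 h))// mulrAC ler_pdivrMr ?ltr_wpDl//.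
  by rewrite ler_wpM2l ?divr_ge0 ?(ltW e10)// lerDl.
pose rho := 1 - q; have rho0 : 0 <= rho by rewrite /rho; lra.
have rho1 : rho < 1 by rewrite /rho; lra.
have pe : posinv K (@eit R) by apply: (@posinv_eit _ _ t0 d) => // t /hK[].
have [GN [eta [aGN eta0 hGN]]] := posinv_bpartial N a1 pe (e := Num.min 1 (e / 2))
  ltac:(by rewrite lt_min ltr01 divr_gt0).
pose X z := sing_exponent mu z.
pose G z := c^-1 * cexp (X (rho%:C * z)) * GN z.
exists G, eta; split => //.
  apply: polyappM => //; apply: polyappZ; apply: polyapp_cexp.
  apply: polyapp_dilate => //; rewrite mulr1.
  have i1 : mu.-integrable T0 (EFin \o (fun=> 1)) by exact: integrable_T0_cst.
  have m1 : measurable_fun setT (fun _ : R => 1 : R) by exact: measurable_cst.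
  apply: (eq_polyapp _ (@polyapp_cint _ mu (fun=> 1) rho m1 i1 _)); last by rewrite rho0.
  by move=> z _; rewrite /X /sing_exponent; apply: eq_cint => s _; rewrite mulr1.
move=> t Kt; have [gap zeros mu0] := hK _ Kt.
have [P [etaP hP]] := hGN _ Kt; exists P; split => //.
have P0 : 0 < P := lt_le_trans eta0 etaP.
set BN := bpartial a N (eit t) in hP.
set y := X (rho%:C * eit t).
have main : cabs (I t * (c^-1 * cexp y) - BN) <= 2 * e1.
  have cv : ccvg (0 : R)^'+ (fun x => c * blaschke_prod a ((1 - x)%:C * eit t) *
      sing_inner mu ((1 - x)%:C * eit t) * (c^-1 * cexp y) - bpartial a N ((1 - x)%:C * eit t))
      (I t * (c^-1 * cexp y) - BN).
    apply: ccvgD; first by apply: ccvgM; [exact: hI|exact: ccvg_cst].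
    by apply: ccvgN; exact: ccvg_bpartial.
  apply: (ccvg_cabs_le cv); near=> x.
  have /andP[x0 xq] : 0 < x < q by near: x; exact: near_right_lt.
  have /andP[_ xd] : 0 < x < d / 2 by near: x; apply: near_right_lt; rewrite divr_gt0.
  set z := (1 - x)%:C * eit t.
  have zc : cabs z = 1 - x by rewrite cabs_circle//; lra.
  have z1 : cabs z <= 1 by rewrite zc; lra.
  (* Moving inward by [x < d / 2] costs at most half of the distance [d] valid on the circle. *)
  have zden k w : a k = Some w -> d / 2 <= cabs (1 - conjc w * z).
    move=> E; have h := zeros _ _ E.
    have -> : 1 - conjc w * z = (1 - conjc w * eit t) - - (x%:C * (conjc w * eit t)).
      by rewrite /z rmorphB /=; ring.
    apply: le_trans (cabs_lerB _ _); rewrite cabs_bfactor_den cabsN !cabsM cabs_conj.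
    rewrite cabs_eit cabsC mulr1 (gtr0_norm x0).
    have w1 : cabs w < 1 by exact: a1 E.
    have : x * cabs w <= x by rewrite ler_piMr// ltW.
    lra.
  have hB := hN _ z1 zden.
  set B := blaschke_prod a z in hB *.
  have hX : cabs (y - X z) <= e1 / 8.
    apply: le_trans (sing_exponent_close muT d0 mu0 (rho := rho) (r := 1 - x) _ _) _.
    - by rewrite rho0 /rho; lra.
    - by lra.
    apply: le_trans qm; rewrite /m /rho.
    by have -> : 16 * (1 - (1 - q)) / d ^+ 2 * fine (mu T0) = q * (16 / d ^+ 2 * fine (mu T0)) by ring.
  have hE : cabs (cexp (y - X z) - 1) <= e1 / 2.
    apply: le_trans (cexp_sub1 _) _; lra.
  have -> : c * B * sing_inner mu z * (c^-1 * cexp y) - bpartial a N z =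
      B * (cexp (y - X z) - 1) + (B - bpartial a N z).
    rewrite -[sing_inner mu z]/(cexp (- X z)) cexpD; field; exact: c0.
  have Bn : cabs B <= 2.
    have -> : B = (B - bpartial a N z) + bpartial a N z by ring.
    rewrite (le_trans (cabsD _ _))//.
    have := cabs_bpartial_le1 N a1 z1; lra.
  rewrite (le_trans (cabsD _ _))// cabsM.
  have : cabs B * cabs (cexp (y - X z) - 1) <= 2 * (e1 / 2) by rewrite ler_pM ?cabs_ge0.
  lra.
have BN1 : cabs BN = 1 by exact: cabs_bpartial_eit.
set g := GN (eit t) in hP.
have gP : cabs g <= 2 * P.
  have -> : cabs g = cabs (BN * g) by rewrite cabsM BN1 mul1r.
  have -> : BN * g = (BN * g - P%:C) + P%:C by ring.
  rewrite (le_trans (cabsD _ _))// cabsC gtr0_norm//.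
  have : Num.min 1 (e / 2) * P <= P by rewrite ler_piMl ?(ltW P0)// ge_min lexx.
  lra.
have -> : I t * G (eit t) - P%:C =
    (I t * (c^-1 * cexp y) - BN) * g + (BN * g - P%:C).
  by rewrite /G -/y -/g; ring.
rewrite (le_trans (cabsD _ _))// cabsM.
have h1 : cabs (I t * (c^-1 * cexp y) - BN) * cabs g <= (2 * e1) * (2 * P).
  by rewrite ler_pM ?cabs_ge0.
have h2 : Num.min 1 (e / 2) * P <= e / 2 * P by rewrite ler_wpM2r ?(ltW P0)// ge_min lexx orbT.
have h3 : e1 * P <= e / 16 * P by rewrite ler_wpM2r ?(ltW P0).
have h4 : 0 <= e * P by rewrite mulr_ge0 ?ltW.
lra.
Unshelve. all: by end_near. Qed.

End InnerFunctions.

(** * Essential suprema and the variational criterion *)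

Section EssentialSupremum.
Context {R : realType}.
Implicit Types (A : set R) (g : R -> R).
Local Notation leb := (@lebesgue_measure R).
Local Notation T0 := (@T0 R).

(** The bound [y] is approached through the levels [y + 1 / (n + 1)], whose countably many null sets
    are discarded together. *)
Lemma esssup_on_ae A g (y : R) : (esssup_on A g <= y%:E)%E ->
  {ae leb, forall t, A t -> g t <= y}.
Proof.
move=> h.
have hn n : {ae leb, forall t, A t -> g t <= y + n.+1%:R^-1}.
  have : (esssup_on A g < (y + n.+1%:R^-1)%:E)%E.
    by rewrite (le_lt_trans h)// lte_fin ltrDl invr_gt0 ltr0n.
  move=> /ereal_inf_lt[x /= hx xy]; apply: ae_imp hx _ => t ht /ht tx.
  by rewrite -lee_fin (le_trans tx)// ltW.
have h' : {ae leb, forall t, forall n, A t -> g t <= y + n.+1%:R^-1} := ae_foralln hn.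
apply: ae_imp h' _ => t ht At; apply/ler_addgt0Pr => e e0.
have [n ne] : exists n, n.+1%:R^-1 < e.
  have [n _ hN] := near_infty_natSinv_lt (PosNum e0).
  by exists n; exact: (hN n (leqnn n)).
by apply: le_trans (ht n At) _; rewrite lerD2l ltW.
Qed.

Lemma eq_esssup_on A f g : {ae leb, forall t, A t -> f t = g t} ->
  esssup_on A f = esssup_on A g.
Proof.
move=> fg; rewrite /esssup_on; congr ereal_inf; apply/seteqP; split => y /= hy;
  apply: ae_imp (ae_and fg hy) _ => t [h1 h2] At; first by rewrite -h1//; exact: h2.
by rewrite h1//; exact: h2.
Qed.

Lemma T0_non_negligible : ~ {ae leb, forall t, ~ T0 t}.
Proof.
case=> N [mN N0 TN].
have : leb T0 = 0%E.
  by apply: (subset_measure0 _ mN _ N0); [exact: measurable_T0|move=> t Tt; apply: TN => /(_ Tt)].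
by rewrite leb_T0 => /eqP; rewrite eqe gt_eqF// twopi_gt0.
Qed.

Lemma norm_inf_gt0 (f : R -> R[i]) : {ae leb, forall t, 0 < cabs (f t)} ->
  (0 < norm_inf f)%E.
Proof.
move=> f0; rewrite ltNge; apply/negP => /esssup_on_ae h; apply: T0_non_negligible.
by apply: ae_imp (ae_and f0 h) _ => t [h1 h2] /h2; rewrite leNgt h1.
Qed.

(* [|phi - conj (tau g)|^2 = |phi|^2 - 2 tau Re (phi g) + O(tau^2)]. *)
Lemma not_saturated (phi g : R -> R[i]) (N r k B : R) :
  norm_inf phi = N%:E -> 0 <= r < N -> 0 < k -> 0 < B ->
  (forall x : R, Hinf0 (fun t => x%:C * g t)) -> (forall t, cabs (g t) <= B) ->
  {ae leb, forall t, T0 t -> cabs (phi t) <= r \/ k <= complex.Re (phi t * g t)} ->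
  ~ saturated phi.
Proof.
move=> phiN /andP[r0 rN] k0 B0 gH gB hg; rewrite /saturated phiN => sat.
have N0 : 0 < N := le_lt_trans r0 rN.
(* The first bound makes the quadratic term [tau^2 B^2] at most half of the gain [2 tau k]; the
   second keeps the perturbation within half of [N - r]. *)
pose tau := Num.min (k / B ^+ 2) ((N - r) / (2 * B)).
have tau0 : 0 < tau by rewrite lt_min !divr_gt0 ?exprn_gt0 ?mulr_gt0 ?subr_gt0.
have tB2 : tau * B ^+ 2 <= k by rewrite -ler_pdivlMr ?exprn_gt0// ge_min lexx.
have tB : tau * B <= (N - r) / 2.
  have : tau <= (N - r) / (2 * B) by rewrite ge_min lexx orbT.
  by rewrite ler_pdivlMr ?mulr_gt0//; lra.
(* The square root serves where [Re (phi g) >= k], the midpoint where [|phi| <= r]. *)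
pose m := Num.max (Num.sqrt (N ^+ 2 - tau * k)) ((N + r) / 2).
have mN : m < N.
  rewrite gt_max; apply/andP; split; last by lra.
  rewrite -[ltRHS](ger0_norm (ltW N0)) -sqrtr_sqr ltr_sqrt ?exprn_gt0//.
  by rewrite ltrBlDr ltrDl mulr_gt0.
have phile : {ae leb, forall t, T0 t -> cabs (phi t) <= N}.
  by apply: esssup_on_ae; rewrite -[esssup_on _ _]/(norm_inf phi) phiN.
have le_m : (norm_inf (fun t => (phi t - conjc (tau%:C * g t))%R) <= m%:E)%E.
  apply: norm_inf_le; apply: ae_imp (ae_and phile hg) _ => t [h1 h2] Tt.
  have {h1} h1 := h1 Tt; have gt := gB t.
  have ct : cabs (tau%:C * g t) <= tau * B.
    by rewrite cabsM cabsC gtr0_norm// ler_wpM2l// ltW.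
  rewrite le_max; case: (h2 Tt) => {h2} h2; apply/orP.
    right; rewrite (le_trans (cabsB _ _))// cabs_conj; lra.
  left; rewrite -[leLHS](ger0_norm (cabs_ge0 _)) -sqrtr_sqr ler_wsqrtr//.
  have E : cabs (phi t - conjc (tau%:C * g t)) ^+ 2 =
      cabs (phi t) ^+ 2 - 2 * tau * complex.Re (phi t * g t) + cabs (tau%:C * g t) ^+ 2.
    by rewrite !sqr_cabs !(ReD, ImD, ReN, ImN, Re_conj, Im_conj, ReCM, ImCM, ReM) /=; ring.
  rewrite E.
  have e1 : cabs (phi t) ^+ 2 <= N ^+ 2 by rewrite lerXn2r ?nnegrE ?cabs_ge0// ltW.
  have e2 : cabs (tau%:C * g t) ^+ 2 <= (tau * B) ^+ 2.
    by rewrite lerXn2r ?nnegrE ?cabs_ge0// mulr_ge0// ltW.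
  have e3 : (tau * B) ^+ 2 <= tau * k.
    by rewrite exprMn expr2 -mulrA ler_wpM2l// ltW.
  have e4 : tau * k <= tau * complex.Re (phi t * g t) by rewrite ler_wpM2l// ltW.
  by lra.
suff : (N%:E <= m%:E)%E by rewrite lee_fin leNgt mN.
rewrite sat; apply: le_trans le_m; apply: ereal_inf_lbound => /=.
by exists (fun t => tau%:C * g t).
Qed.

End EssentialSupremum.

(** * Products of bounded analytic functions with the disc algebra *)

Section DiscAlgebraMultiples.
Context {R : realType}.
Local Notation leb := (@lebesgue_measure R).
Local Notation T0 := (@T0 R).

Lemma mavg_Hinf_poly (e : R -> R[i]) (B : R) (p : {poly R[i]}) k : Hinf e ->
  (forall t, cabs (e t) <= B) ->
  mavg (fun t => e t * eit t ^+ k.+1 * p.[eit t]) = 0.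
Proof.
move=> [_ me _ e0] eB.
have Ti i : cintegrable leb T0 (fun t => e t * eit t ^+ (k + i).+1).
  apply: (@Tint_bdd _ _ B) => [|t _]; last by rewrite cabsM cabsX cabs_eit expr1n mulr1.
  by apply: cmeasurableM => //; apply: cmeasurableX; exact: cmeasurable_eit.
rewrite (@eq_mavg _ _ (fun t => \sum_(i < size p) p`_i * (e t * eit t ^+ (k + i).+1))).
  rewrite mavg_sum => [|i]; last exact: (cintegrableZ measurable_T0).
  by apply: big1 => i _; rewrite mavgZ// -fourier_neg e0// mulr0.
move=> t; rewrite horner_coef mulr_sumr; apply: eq_bigr => i _.
by rewrite -addSn exprD; ring.
Qed.

Lemma mavg_Hinf_polyapp (e : R -> R[i]) (B : R) G k : Hinf e ->
  (forall t, cabs (e t) <= B) -> polyapp 1 G ->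
  mavg (fun t => e t * eit t ^+ k.+1 * G (eit t)) = 0.
Proof.
move=> He eB aG; have [_ me _ _] := He.
have B0 : 0 <= B := le_trans (cabs_ge0 _) (eB 0).
have mG : cmeasurable (fun t => G (eit t)).
  rewrite (_ : (fun t => _) = (fun t => G (1%:C * eit t))).
    by apply: (cmeasurable_polyapp aG); rewrite ler01 lexx.
  by apply/funext => t; rewrite mul1r.
have mek : cmeasurable (fun t => e t * eit t ^+ k.+1).
  by apply: cmeasurableM => //; apply: cmeasurableX; exact: cmeasurable_eit.
have ekB t : cabs (e t * eit t ^+ k.+1) <= B.
  by rewrite cabsM cabsX cabs_eit expr1n mulr1.
have eit1 (t : R) : cabs (eit t) <= 1 by rewrite cabs_eit.
have [MG [MG0 hMG]] := polyapp_bounded aG.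
have TG : cintegrable leb T0 (fun t => e t * eit t ^+ k.+1 * G (eit t)).
  apply: (@Tint_bdd _ _ (B * MG)); first exact: cmeasurableM.
  by move=> t _; rewrite cabsM ler_pM ?cabs_ge0// hMG.
apply/eqP; rewrite -cabs_eq0 eq_le cabs_ge0 andbT; apply/ler_addgt0Pr => x x0.
rewrite add0r; pose y := x / (2 * (B + 1)).
have y0 : 0 < y by rewrite divr_gt0// mulr_gt0// ltr_wpDl.
have [p hp] := aG _ y0; have [Mp [Mp0 hMp]] := poly_bounded p 1.
have mp : cmeasurable (fun t : R => p.[eit t]).
  rewrite (_ : (fun t => _) = (fun t => p.[1%:C * eit t])).
    exact: cmeasurable_poly_circle.
  by apply/funext => t; rewrite mul1r.
have Tp : cintegrable leb T0 (fun t => e t * eit t ^+ k.+1 * p.[eit t]).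
  apply: (@Tint_bdd _ _ (B * Mp)); first exact: cmeasurableM.
  by move=> t _; rewrite cabsM ler_pM ?cabs_ge0// hMp.
rewrite -[mavg _]subr0 -(mavg_Hinf_poly p k He eB) -mavgB//.
apply: le_trans (@cabs_mavg_le _ _ (B * y) _ _) _.
- exact: (cintegrableB measurable_T0).
- by move=> t _; rewrite -mulrBr cabsM ler_pM ?cabs_ge0// hp.
have -> : 2 * (B * y) = B / (B + 1) * x by rewrite /y; field; rewrite gt_eqF// ltr_wpDl.
by rewrite ler_piMl ?(ltW x0)// ler_pdivrMr ?ltr_wpDl// mul1r lerDl.
Qed.

(** Negative coefficients and the coefficient at 0 vanish together: the factor [eit t] raises every
    exponent in [mavg_Hinf_polyapp] to at least 1. There, approximating [G] by polynomials reduces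
    to finite sums of negative coefficients of [e]. *)
Lemma Hinf0_eit_mul (e : R -> R[i]) (B : R) G (x : R[i]) : Hinf e ->
  (forall t, cabs (e t) <= B) -> polyapp 1 G ->
  Hinf0 (fun t => x * (e t * (eit t * G (eit t)))).
Proof.
move=> He eB aG; have [pe me _ _] := He.
have B0 : 0 <= B := le_trans (cabs_ge0 _) (eB 0).
have mG : cmeasurable (fun t => G (eit t)).
  rewrite (_ : (fun t => _) = (fun t => G (1%:C * eit t))).
    by apply: (cmeasurable_polyapp aG); rewrite ler01 lexx.
  by apply/funext => t; rewrite mul1r.
have eit1 (t : R) : cabs (eit t) <= 1 by rewrite cabs_eit.
have [MG [MG0 hMG]] := polyapp_bounded aG.
have mf : cmeasurable (fun t => e t * (eit t * G (eit t))).
  by apply: cmeasurableM => //; apply: cmeasurableM => //; exact: cmeasurable_eit.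
have fB t : cabs (e t * (eit t * G (eit t))) <= B * MG.
  by rewrite !cabsM cabs_eit mul1r ler_pM ?cabs_ge0// hMG.
have F j : mavg (fun t => x * (e t * (eit t * G (eit t))) * eit t ^+ j) = 0.
  rewrite (@eq_mavg _ _ (fun t => x * (e t * eit t ^+ j.+1 * G (eit t)))); last first.
    by move=> t; rewrite exprS; ring.
  rewrite mavgZ ?(mavg_Hinf_polyapp j He eB aG) ?mulr0//.
  apply: (@Tint_bdd _ _ (B * MG)).
    apply: cmeasurableM => //; apply: cmeasurableM => //; apply: cmeasurableX.
    exact: cmeasurable_eit.
  move=> t _; rewrite cabsM ler_pM ?cabs_ge0// ?hMG//.
  by rewrite cabsM cabsX cabs_eit expr1n mulr1.
split; [split|].
- by move=> t; rewrite pe eit2pi.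
- by apply: cmeasurableM => //; exact: cmeasurable_cst.
- apply: (@le_lt_trans _ _ (cabs x * (B * MG))%:E); last exact: ltry.
  apply: norm_inf_le; apply: ae_all => t _.
  by rewrite cabsM ler_wpM2l ?cabs_ge0.
- by case=> // k _; rewrite fourier_neg.
rewrite /fourier -[RHS](F 0%N); apply: eq_mavg => t.
by rewrite mul0r oppr0 eit0 expr0.
Qed.

End DiscAlgebraMultiples.

(** * Uniform distance to the spectrum and to the gap *)

Section SpectrumGap.
Context {R : realType}.
Implicit Types (O : set R) (t x : R) (a : nat -> option R[i]).
Implicit Types (mu : {measure set (measurableTypeR R) -> \bar R}).
Local Notation T0 := (@T0 R).

(** Failure of accumulation only bounds a tail of the zeros away from [eit x]; the finitely many
    others lie in the open disc, at positive distance. *)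
Lemma zero_gap a x : (forall k w, a k = Some w -> cabs w < 1) -> ~ zero_acc a x ->
  exists e : R, 0 < e /\ forall k w, a k = Some w -> e <= cabs (w - eit x).
Proof.
move=> a1 nx.
have [e [e0 [N hN]]] : exists e : R, 0 < e /\ exists N, forall k w, (N <= k)%N ->
    a k = Some w -> e <= cabs (w - eit x).
  apply: contrapT => H; apply: nx => e e0 N; apply: contrapT => H'; apply: H.
  exists e; split => //; exists N => k w Nk aw; rewrite leNgt; apply/negP => ew.
  by apply: H'; exists k, w.
have [e' [e'0 he']] : exists e' : R, 0 < e' /\ forall k w, (k < N)%N ->
    a k = Some w -> e' <= cabs (w - eit x).
  elim: N {hN} => [|N [e' [e'0 IH]]]; first by exists 1.
  case E : (a N) => [w|].
    exists (Num.min e' (cabs (w - eit x))); split.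
      by rewrite lt_min e'0 cabs_gt0 -opprB oppr_eq0 eitB_neq0//; exact: a1 E.
    move=> k z; rewrite ltnS leq_eqVlt => /predU1P[->|kN az].
      by rewrite E => -[<-]; rewrite ge_min lexx orbT.
    by rewrite ge_min (IH _ _ kN az).
  exists e'; split => // k z; rewrite ltnS leq_eqVlt => /predU1P[->|kN az].
    by rewrite E.
  exact: IH kN az.
exists (Num.min e e'); split; first by rewrite lt_min e0.
move=> k w aw; rewrite ge_min; have [Nk|kN] := leqP N k; first by rewrite (hN _ _ Nk aw).
by rewrite (he' _ _ kN aw) orbT.
Qed.

Lemma support_gap mu x : ~ msupport mu x -> exists e : R, 0 < e /\
  mu (T0 `&` [set s | (cabs (eit s - eit x) < e)%R]) = 0%E.
Proof.
move=> nx; apply: contrapT => H; apply: nx => e e0.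
rewrite lt0e measure_ge0 andbT; apply/eqP => h; apply: H.
by exists e.
Qed.

(** The distance available at [x] gives half of it at all nearby [t], and compactness makes it
    uniform. The closed interval [[0, 2 * pi]] replaces [T0], which is not compact. *)
Lemma sigma_inner_gap a mu O : blaschke_seq a -> open O -> sigma_inner a mu `<=` O ->
  exists d : R, 0 < d /\ forall t, T0 t -> ~ O t ->
    (forall k w, a k = Some w -> d <= cabs (w - eit t)) /\
    mu (T0 `&` [set s | (cabs (eit s - eit t) < d)%R]) = 0%E.
Proof.
move=> [a1 _] oO sO.
pose P (d t : R) := (forall k w, a k = Some w -> d <= cabs (w - eit t)) /\
    mu (T0 `&` [set s | (cabs (eit s - eit t) < d)%R]) = 0%E.
have cK : compact (`[0, 2 * pi] `&` ~` O : set R).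
  by apply: compact_closedI; [exact: segment_compact|exact: open_closedC].
have : \forall d \near (0 : R)^'+, `[0, 2 * pi] `&` ~` O `<=` P d.
  have /compact_near_coveringP := cK; apply => x [_ nOx].
  have nz : ~ zero_acc a x by move=> h; apply: nOx; apply: sO; left.
  have ns : ~ msupport mu x by move=> h; apply: nOx; apply: sO; right.
  have [e1 [e10 h1]] := zero_gap a1 nz; have [e2 [e20 h2]] := support_gap ns.
  pose e := Num.min e1 e2 / 2.
  have e0 : 0 < e by rewrite divr_gt0// lt_min e10.
  have m1 : Num.min e1 e2 <= e1 by rewrite ge_min lexx.
  have m2 : Num.min e1 e2 <= e2 by rewrite ge_min lexx orbT.
  exists (ball x e, [set d | 0 < d < e]).
    by split; [exact: nbhsx_ballx|exact: near_right_lt].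
  move=> [t d] /= [xt /andP[d0 de]].
  have txe : cabs (eit t - eit x) < e.
    by apply: le_lt_trans (cabs_eitB_le _ _) _; rewrite distrC.
  split.
    move=> k w aw; have := h1 _ _ aw.
    have := cabs_triangle (eit t) w (eit x); rewrite /e in txe de *; lra.
  apply: (subset_measure0 _ _ _ h2); try (apply: measurableI;
    [exact: measurable_T0|exact: measurable_arc]).
  move=> s [Ts /= sd]; split => //=.
  have := cabs_triangle (eit t) (eit s) (eit x); rewrite /e in txe de *; lra.
move=> hP; have [d [/andP[d0 _] hd]] := filter_ex (filterI (near_right_lt ltr01) hP).
exists d; split => // t; rewrite /Defs.T0 /= in_itv/= => /andP[t0 t2] nOt.
by apply: hd; split => //=; rewrite in_itv/= t0 ltW.
Qed.

(** A point of [O] is brought into [T0] by periodicity and, if it is 0, moved slightly to the right,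
    because [eit_lower] compares chord and angle only at interior points. *)
Lemma periodic_open_gap O t0 : open O -> (forall t, O (t + 2 * pi) <-> O t) -> O t0 ->
  exists s d, 0 < d /\ forall t, T0 t -> ~ O t -> d <= cabs (eit t - eit s).
Proof.
move=> oO pO Ot0; have p0 := @twopi_gt0 R.
have pn n t : O (t + n%:R * (2 * pi)) <-> O t.
  elim: n => [|n IH]; first by rewrite mul0r addr0.
  by rewrite -natr1 mulrDl mul1r addrA pO.
have [s0 Os0 Ts0] : exists2 s, O s & T0 s.
  pose n := Num.floor (t0 / (2 * pi)).
  have /andP[n1 n2] := floor_itv (t0 / (2 * pi)).
  exists (t0 - n%:~R * (2 * pi)); last first.
    rewrite /Defs.T0 /= in_itv/= subr_ge0 -ler_pdivlMr// n1/=.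
    rewrite ltrBlDr; move: n2; rewrite -/n ltr_pdivrMr// => n2; apply: lt_le_trans n2 _.
    by rewrite intrD mulr1z mulrDl mul1r addrC.
  case: n {n1 n2} => n; first by apply/(pn n); rewrite subrK.
  by rewrite NegzE mulrNz mulNr opprK; apply/(pn n.+1).
have [r /= r0 rO] : exists2 r : R, 0 < r & ball s0 r `<=` O.
  by have /nbhs_ballP := open_nbhs_nbhs (conj oO Os0).
move: Ts0; rewrite /Defs.T0 /= in_itv/= => /andP[s00 s02].
have [s [r' [s12 r'0 r'O]]] : exists s (r' : R), [/\ 0 < s < 2 * pi, 0 < r' & ball s r' `<=` O].
  move: s00; rewrite le_eqVlt => /predU1P[s0E|s00]; last by exists s0, r; rewrite s00 s02.
  pose q := Num.min (r / 2) pi.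
  have q0 : 0 < q by rewrite lt_min divr_gt0//= pi_gt0.
  have q1 : q <= r / 2 by rewrite ge_min lexx.
  have q2 : q <= pi by rewrite ge_min lexx orbT.
  have pp := @pi_gt0 R.
  exists q, (r / 2); split; [by rewrite q0/=; lra|by rewrite divr_gt0|].
  move=> y; rewrite /ball/= => qy; apply: rO; rewrite /ball/= -s0E.
  apply: le_lt_trans (ler_distD q _ _) _; rewrite sub0r normrN gtr0_norm//; lra.
have [c [/andP[c0 _] hc]] := eit_lower s12.
exists s, (c * r'); split; first exact: mulr_gt0.
move=> t Tt nOt; apply: le_trans (hc _ Tt); rewrite ler_wpM2l ?(ltW c0)//.
rewrite leNgt; apply/negP => tr; apply: nOt; apply: r'O.
by rewrite /ball/= distrC.
Qed.

Lemma periodic_interior (A : set R) : (forall t, A (t + 2 * pi) <-> A t) ->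
  forall t, A° (t + 2 * pi) <-> A° t.
Proof.
move=> pA t; rewrite /interior /=; split => /nbhs_ballP[r /= r0 rA];
  apply/nbhs_ballP; exists r => //= s ts.
  by apply/pA; apply: rA; rewrite /ball/= opprD addrACA subrr addr0.
rewrite -(subrK (2 * pi) s); apply/pA; apply: rA; move: ts; rewrite /ball/=.
by have -> : t + 2 * pi - s = t - (s - 2 * pi) by ring.
Qed.

End SpectrumGap.

(** * The lower bound for the real part and the assembly of [g] *)

Lemma Re_cexp_perturb (R : realType) (x th c0 P : R) (Y : R[i]) :
  c0 <= cos th -> 0 <= P -> cabs (Y - P%:C) <= c0 / 2 * P ->
  expR x * (P * (c0 / 2)) <= complex.Re (cexp (x +i* th) * Y).
Proof.
move=> hc P0 hY; rewrite cexpE /= -mulrA ReCM ler_wpM2l ?expR_ge0//.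
(* The first term has real part at least [c0 * P]; the error term takes away at most half of it. *)
have -> : eit th * Y = eit th * P%:C + eit th * (Y - P%:C) by ring.
rewrite ReD ReMC /=.
have h1 : c0 * P <= cos th * P by rewrite ler_wpM2r.
have := Re_le_cabs (eit th * (Y - P%:C)).
rewrite cabsM cabs_eit mul1r ler_norml => /andP[h2 _]; lra.
Qed.

(* [Lm.-integrable] is elaborated at the default measure display of [R],
   [lebesgue_measure.-integrable] at the one of [measurableTypeR R]: the two
   integrals are not convertible. *)
Lemma integrable_Lm (R : realType) (f : R -> R) :
  (@Lm R).-integrable (@T0 R) (EFin \o f) ->
  (@lebesgue_measure R).-integrable (@T0 R) (EFin \o f).
Proof.
pose R' : measurableType default_measure_display := R.
move=> /integrableP[mf intf]; apply/integrableP; split; first exact: mf.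
have mid : measurable_fun [set: measurableTypeR R] (fun x : measurableTypeR R => x : R').
  by [].
have mT : measurable (@T0 R : set R') by exact: measurable_T0.
have := @ge0_integral_pushforward _ _ _ _ R _ mid (@lebesgue_measure R) (@T0 R)
  (fun x => `|(f x)%:E|%E) mT.
have mabs : measurable_fun (@T0 R) (fun x => `|(f x)%:E|)%E by apply: measurableT_comp.
by move=> /(_ mabs (fun x _ => abse_ge0 _)) <-; exact: intf.
Qed.

Theorem theorem5 (R : realType) (phi Phi I : R -> R[i]) (delta : R)
    (a : nat -> option R[i]) (mu : {measure set (measurableTypeR R) -> \bar R})
    (c : R[i]) :
  Hinf phi -> inner I -> outer Phi ->
  (\forall t \ae @Lm R, phi t = Phi t * I t) ->
  (* factorization I = c B S of the inner function *)
  blaschke_seq a -> singular_meas mu -> cabs c = 1 ->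
  (forall z : R[i], cabs z < 1 ->
     poisson_ext I z = c * blaschke_prod a z * sing_inner mu z) ->
  0 < delta < 1 ->
  apical_HS (fun t => cabs (phi t)) delta ->
  (Lminus (fun t => cabs (Phi t)) delta)° !=set0 ->
  sigma_inner a mu `<=` (Lminus (fun t => cabs (Phi t)) delta)° ->
  ~ saturated phi.
Proof.
set leb := @lebesgue_measure R.
move=> _ [[_ mI bI _] I1] [HPhi [k [c' [k0 mk ik c'1 PhiE]]]] fac ba [muT _] c1 facI.
move=> /andP[d0 d1] [_ _ wfin wpos [u [v [[_ pv] [mu' mv] [ub iv] wE hconj]]]] [t0 Ot0] sO.
set O := (Lminus _ _)° in Ot0 sO.
have PphiE : {ae leb, forall t, cabs (Phi t) = cabs (phi t)}.
  apply: ae_imp (ae_and fac I1) _ => t [-> h]; by rewrite cabsM h mulr1.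
have [N N0 phiN] : exists2 N : R, 0 < N & norm_inf phi = N%:E.
  have h := norm_inf_gt0 wpos.
  have f : norm_inf phi \is a fin_num by rewrite fin_real// (lt_trans _ h)//=; exact: wfin.
  exists (fine (norm_inf phi)); last by rewrite fineK.
  by rewrite fine_gt0// h; exact: wfin.
have PhiN : esssup_on (@T0 R) (fun t => cabs (Phi t)) = N%:E.
  by rewrite -phiN; apply: eq_esssup_on; apply: ae_imp PphiE _.
have [M [M0 uM]] : exists M : R, 0 <= M /\ {ae leb, forall t, T0 t -> `|u t| <= M}.
  have [|M [M0 h]] := @norm_inf_lty R (fun t => (u t)%:C).
    rewrite /norm_inf (_ : (fun t => cabs _) = (fun t => `|u t|))//.
    by apply/funext => t; rewrite cabsC.
  by exists M; split => //; apply: ae_imp h _ => t h /h; rewrite cabsC.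
(* [u] clamped to [[- M, M]], since [outer_HelsonSzego] asks for a bound everywhere; the negated
   inner maximum is a minimum. *)
pose u' t := Num.max (- M) (- Num.max (- M) (- u t)).
have mu'' : measurable_fun setT u'.
  apply: measurable_maxr; first exact: measurable_cst.
  apply: measurableT_comp => //; apply: measurable_maxr; first exact: measurable_cst.
  exact: measurableT_comp.
have u'M t : `|u' t| <= M.
  rewrite ler_norml le_max lexx/= ge_max; apply/andP; split; first lra.
  by rewrite lerNl le_max lexx.
have u'E t : `|u t| <= M -> u' t = u t.
  rewrite ler_norml => /andP[h1 h2]; rewrite /u'.
  by rewrite [Num.max (- M) (- u t)]max_r ?lerN2// opprK max_r.
have wE' : {ae leb, forall t, T0 t -> cabs (Phi t) = expR (u' t + v t)}.
  by apply: ae_imp (ae_and (ae_and PphiE wE) uM) _ => t [[-> h1] h2] /h2/u'E ->.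
have ik' := integrable_Lm ik; have iv' := integrable_Lm iv.
have [e [He eM eE]] := outer_HelsonSzego HPhi k0 mk ik' c'1 PhiE pv mu'' mv u'M iv' wE'.
(* The strict inequality on the essential supremum leaves one angle [th] below [pi / 2]; the maximum
   with 0 covers a negative bound, possible over a negligible set. *)
have [th [th0 thpi hth]] : exists th : R, [/\ 0 <= th, th < pi / 2 &
    {ae leb, forall t, T0 t -> N * delta <= cabs (phi t) -> `|conj_fun v t| <= th}].
  have [y /= hy ypi] := ereal_inf_lt hconj.
  exists (Num.max 0 (fine y)); split.
  - by rewrite le_max lexx.
  - rewrite gt_max; apply/andP; split; first by rewrite divr_gt0// pi_gt0.
    case: y ypi {hy} => [y| |]; rewrite ?lte_fin//= => _.
    by rewrite divr_gt0// pi_gt0.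
  apply: ae_imp hy _ => t hy Tt Nt; rewrite le_max; apply/orP; right.
  have {hy} : (`|conj_fun v t|%:E <= y)%E.
    by apply: hy; split => //; rewrite /Lplus/= -[esssup_on _ _]/(norm_inf phi) phiN.
  by case: y ypi => [y| |]//=.
pose c0 := cos th.
have c00 : 0 < c0.
  by rewrite cos_gt0_pihalf// thpi andbT (lt_le_trans _ th0)// oppr_lt0 divr_gt0// pi_gt0.
have oO : open O by exact: open_interior.
have pO : forall t, O (t + 2 * pi) <-> O t.
  apply: periodic_interior => t; rewrite /Lminus/=.
  by have [pPhi _ _ _] := HPhi; rewrite pPhi.
have [s [d2 [d20 gap]]] := periodic_open_gap oO pO Ot0.
have [d3 [d30 sgap]] := sigma_inner_gap ba oO sO.
pose dd := Num.min 1 (Num.min d2 d3).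
have dd1 : 0 < dd <= 1 by rewrite !lt_min ltr01 d20 d30/= ge_min lexx.
have dd2 : dd <= d2 by rewrite !ge_min lexx !orbT.
have dd3 : dd <= d3 by rewrite !ge_min lexx !orbT.
(* Radial convergence to [I t] is built into [K] because [inner_posinv] needs it at every point; on
   [T0] it fails only on a null set. *)
pose K := [set t : R | [/\ T0 t, ~ O t & ccvg (0 : R)^'+
   (fun x => poisson_ext I ((1 - x)%:C * eit t)) (I t)]].
have pI : posinv K I.
  apply: (inner_posinv (t0 := s) ba muT c1 dd1) => t [Tt nOt It].
    have [h1 h2] := sgap _ Tt nOt; split.
    - exact: le_trans (gap _ Tt nOt).
    - by move=> n w /h1; exact: le_trans.
    apply: (subset_measure0 _ _ _ h2); try (apply: measurableI;
      [exact: measurable_T0|exact: measurable_arc]).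
    by move=> x [Tx /= xd]; split => //=; exact: lt_le_trans dd3.
  apply: (ccvg_squeeze (h := fun x => cabs (poisson_ext I ((1 - x)%:C * eit t) - I t))).
    have hr := near_radius t; near=> x; rewrite facI//; near: x; exact: hr.
  exact: ccvg_cabsB.
have pe : posinv K (@eit R) by apply: (posinv_eit d20 (t0 := s)) => t [Tt nOt _]; exact: gap.
have [G [eta [aG eta0 hG]]] := posinvM pe pI (divr_gt0 c00 (ltr0n R 2)).
have c'0 : c' != 0 by rewrite -cabs_gt0 c'1.
(* [e] removes [u], [eit] makes [g] vanish at the origin, [G] compensates [eit * I], and [c'^-1]
   cancels the constant of the outer function. *)
pose g t := c'^-1 * (e t * (eit t * G (eit t))).
have [MG [MG0 hMG]] := polyapp_bounded aG.
(* Uses [expR v = |phi| expR (- u)] with [|phi| >= N * delta] and [u <= M], then [P >= eta] and the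
   loss [c0 / 2] from [Re_cexp_perturb]. *)
pose kap := N * delta * expR (- M) * (eta * (c0 / 2)).
have Irad := poisson_ext_radial mI bI.
apply: (@not_saturated _ _ g N (N * delta) kap (2 * expR M * MG)) => //.
- by rewrite mulr_ge0 ?ltW//= ?gtr_pMr// ltW.
- by rewrite !mulr_gt0// ?expR_gt0// divr_gt0.
- by rewrite !mulr_gt0// expR_gt0.
- move=> x; rewrite (_ : (fun t => _) = (fun t => x%:C * c'^-1 * (e t * (eit t * G (eit t))))).
    exact: (Hinf0_eit_mul _ He eM aG).
  by apply/funext => t; exact: mulrA.
- move=> t; rewrite /g !cabsM cabsV c'1 invr1 cabs_eit !mul1r ler_pM ?cabs_ge0//.
  by rewrite hMG// cabs_eit.
apply: ae_imp (ae_and (ae_and (ae_and fac PphiE) (ae_and eE wE')) (ae_and Irad hth)) _.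
move=> t [[[h1 h2] [h3 h4]] [h5 h6]] Tt.
have [hN|hN] := leP (cabs (phi t)) (N * delta); [by left|right].
(* Since [|Phi| = |phi|] almost everywhere, with the same essential supremum, a point where [|phi|]
   is large avoids the low level set of [Phi]. *)
have nOt : ~ O t.
  move=> /interior_subset; rewrite /Lminus/= PhiN h2 /=.
  by rewrite ltNge (ltW hN).
have [P [etaP hP]] := hG t (And3 Tt nOt (h5 Tt)).
have P0 : 0 <= P := le_trans (ltW eta0) etaP.
have cth : c0 <= cos (conj_fun v t).
  have h := h6 Tt (ltW hN); have pp := @pi_gt0 R.
  have hpi : th <= pi by lra.
  rewrite /c0 -[leRHS]cos_norm cos_le_cos; first by rewrite (ger0_norm th0).
    by rewrite normr_ge0/=; exact: le_trans hpi.
  by rewrite ger0_norm.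
have -> : phi t * g t = cexp (v t +i* conj_fun v t) * (eit t * I t * G (eit t)).
  rewrite h1 /g -[cexp _]mul1r -(mulVf c'0) -[c'^-1 * c' * _]mulrA -(h3 Tt).
  by ring.
apply: le_trans (Re_cexp_perturb (v t) cth P0 hP).
have ev : N * delta * expR (- M) <= expR (v t).
  have -> : expR (v t) = cabs (phi t) * expR (- u' t) by rewrite -h2 h4// -expRD; congr expR; ring.
  rewrite ler_pM ?expR_ge0 ?mulr_ge0 ?(ltW N0) ?(ltW d0) ?(ltW hN)//.
  rewrite ler_expR lerN2.
  by rewrite (le_trans (ler_norm _)).
rewrite /kap ler_pM ?mulr_ge0 ?expR_ge0 ?(ltW N0) ?(ltW d0) ?(ltW eta0) ?divr_ge0 ?(ltW c00)//.
by rewrite ler_wpM2r// divr_ge0// ltW.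
Unshelve. all: by end_near. Qed.
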